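(* Let $g\in\mathcal{H}(\mathbb{D})$ and let $X\subset\mathcal{H}(\mathbb{D})$ be an admissible Banach space such that $H^\infty\subset X$. (i) $T_g:X\to H^\infty$ is compact if and only if $T_g:X\to A$ is compact. (ii) Let $\{\beta_n\}_{n=0}^\infty$ be a sequence of positive numbers with $\lim_{n\to\infty}\sqrt[n]{\beta_n}=1$. If $Y\subset\mathcal{H}(\mathbb{D})$ is a Banach space with $Y\simeq X^*$ via the $H(\beta)$-pairing, and for every bounded sequence in $X$ there is a subsequence which converges uniformly on compact subsets of $\mathbb{D}$ to an element of $X$, then $T_g:X\to A$ is compact if and only if the set $\{T_g^*(K^{H(\beta)}_z):z\in\mathbb{D}\}=\{G^{H(\beta)}_{g,z}:z\in\mathbb{D}\}$ is relatively compact in $Y$.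
   Context: $\mathbb{D}$ is the open unit disc, $\mathcal{H}(\mathbb{D})$ the space of analytic functions in $\mathbb{D}$, $H^\infty$ the bounded analytic functions with sup norm, $A$ the disc algebra (functions analytic in $\mathbb{D}$ and continuous on $\overline{\mathbb{D}}$, sup norm). $T_g(f)(z)=\int_0^z f(\zeta)g'(\zeta)\,d\zeta$. A Banach space $X\subset\mathcal{H}(\mathbb{D})$ is admissible if: (P1) $A\subset X$; (P2) if $f\in X$, then $f_r\in X$ for $0<r<1$, where $f_r(z)=f(rz)$, and $\sup_{0<r<1}\|f_r\|_X\le C\|f\|_X$ with $C$ independent of $f$; (P3) for every $z\in\mathbb{D}$ the point evaluation $f\mapsto f(z)$ belongs to $X^*$. $H(\beta)$-pairing: for $f(z)=\sum\widehat f(n)z^n$, $h(z)=\sum\widehat h(n)z^n$, $\langle f,h\rangle_{H(\beta)}=\lim_{r\to1^-}\sum_{n=0}^\infty\widehat f(n)\overline{\widehat h(n)}\beta_n r^n$. $H(\beta)$ is the Hilbert space of analytic functions in $\mathbb{D}$ induced by this pairing; its reproducing kernels are $K^{H(\beta)}_z(\zeta)=\sum_{n=0}^\infty(\zeta\overline z)^n/\beta_n$. $X^*\simeq Y$ via the $H(\beta)$-pairing means: $\langle f,h\rangle_{H(\beta)}$ exists for all $f\in X$, $h\in Y$; $L_h(f)=\langle f,h\rangle_{H(\beta)}$ satisfies $C^{-1}\|h\|_Y\le\|L_h\|\le C\|h\|_Y$ for some constant $C>0$; and each $L\in X^*$ equals $L_h$ for some $h\in Y$. $G^{H(\beta)}_{g,z}$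 is defined by $\overline{G^{H(\beta)}_{g,z}(w)}=\int_0^z g'(\zeta)\overline{K^{H(\beta)}_\zeta(w)}\,d\zeta$, $w\in\overline{\mathbb{D}}$; one has $T_g(f)(z)=\langle f,G^{H(\beta)}_{g,z}\rangle_{H(\beta)}$, and $T_g^*(K_z^{H(\beta)})$ denotes this function. *)

(* Defs.v *)
From Stdlib Require Export Reals Factorial List.
From Coquelicot Require Export Coquelicot.
Open Scope R_scope.

Definition disc (z : C) : Prop := Cmod z < 1.

(** Functions on the unit disc are represented by total functions [C -> C];
    values outside [disc] are irrelevant, so equality of such functions means
    [eq_disc]. *)
Definition eq_disc (f h : C -> C) : Prop := forall z, disc z -> f z = h z.

Definition analytic (f : C -> C) : Prop :=
  forall z0, disc z0 ->
  exists (r : R) (a : nat -> C), 0 < r /\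
    forall z, disc z -> Cmod (z - z0) < r ->
      is_pseries (K := C_AbsRing) (V := C_NormedModule) a (z - z0)%C (f z).

(** [C_derive] is the complex derivative wherever that derivative exists, in
    particular at every point of [disc] when [f] is analytic. *)
Definition taylor_coef (f : C -> C) (n : nat) : C :=
  (Nat.iter n C_derive f 0 / INR (fact n))%C.

(** Integral along the segment from [0] to [z]; for an integrand analytic in the
    disc it does not depend on the path. *)
Definition path_int (F : C -> C) (z : C) : C :=
  (z * RInt (V := C_R_CompleteNormedModule) (fun t : R => F (t * z)%C) 0 1)%C.

Definition Tg (g f : C -> C) (z : C) : C :=
  path_int (fun zeta => (f zeta * C_derive g zeta)%C) z.

Definition compact_for {T : Type} (is_open : (T -> Prop) -> Prop)
    (K : T -> Prop) : Prop :=
  forall F : (T -> Prop) -> Prop,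
    (forall U, F U -> is_open U) ->
    (forall x, K x -> exists U, F U /\ U x) ->
    exists l : list (T -> Prop),
      (forall U, In U l -> F U) /\ (forall x, K x -> exists U, In U l /\ U x).

Definition compact_C (K : C -> Prop) : Prop :=
  compact_for (@open C_UniformSpace) K.

Record fspace := FSpace { mem : (C -> C) -> Prop; nrm : (C -> C) -> R }.

Definition fadd (f h : C -> C) (z : C) : C := (f z + h z)%C.
Definition fsub (f h : C -> C) (z : C) : C := (f z - h z)%C.
Definition fscal (c : C) (f : C -> C) (z : C) : C := (c * f z)%C.
Definition fzero (z : C) : C := 0%C.

Record banach (X : fspace) : Prop := {
  banach_analytic : forall f, mem X f -> analytic f;
  banach_ext : forall f h, eq_disc f h -> mem X f -> mem X h /\ nrm X h = nrm X f;
  banach_zero : mem X fzero;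
  banach_add : forall f h, mem X f -> mem X h -> mem X (fadd f h);
  banach_scal : forall c f, mem X f -> mem X (fscal c f);
  banach_norm_eq0 : forall f, mem X f -> nrm X f = 0 -> eq_disc f fzero;
  banach_norm_scal : forall c f, mem X f -> nrm X (fscal c f) = Cmod c * nrm X f;
  banach_triangle : forall f h, mem X f -> mem X h ->
    nrm X (fadd f h) <= nrm X f + nrm X h;
  banach_complete : forall u : nat -> C -> C,
    (forall n, mem X (u n)) ->
    (forall eps, 0 < eps -> exists N, forall n m, (N <= n)%nat -> (N <= m)%nat ->
       nrm X (fsub (u n) (u m)) < eps) ->
    exists f, mem X f /\ is_lim_seq (fun n => nrm X (fsub (u n) f)) 0
}.

Definition subspace (X Y : fspace) : Prop := forall f, mem X f -> mem Y f.

Definition open_in (X : fspace) (U : (C -> C) -> Prop) : Prop :=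
  forall f, mem X f -> U f ->
  exists eps, 0 < eps /\ forall h, mem X h -> nrm X (fsub h f) < eps -> U h.

Definition closure_in (X : fspace) (E : (C -> C) -> Prop) (f : C -> C) : Prop :=
  mem X f /\ forall eps, 0 < eps -> exists h, E h /\ nrm X (fsub h f) < eps.

Definition relatively_compact (X : fspace) (E : (C -> C) -> Prop) : Prop :=
  (forall f, E f -> mem X f) /\ compact_for (open_in X) (closure_in X E).

Definition compact_operator (X Y : fspace) (T : (C -> C) -> (C -> C)) : Prop :=
  (forall f, mem X f -> mem Y (T f)) /\
  relatively_compact Y (fun h => exists f, mem X f /\ nrm X f <= 1 /\ h = T f).

Definition sup_norm (f : C -> C) : R :=
  real (Lub_Rbar (fun x => exists z, disc z /\ x = Cmod (f z))).

Definition Hinfty : fspace :=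
  FSpace (fun f => analytic f /\ exists M, forall z, disc z -> Cmod (f z) <= M)
    sup_norm.

(** The continuous function [F] on the closed disc is the boundary extension of
    [f]; the supremum over the closed disc is the one over the open disc. *)
Definition disc_algebra : fspace :=
  FSpace (fun f => analytic f /\
      exists F : C -> C, eq_disc f F /\
        forall z, Cmod z <= 1 ->
          filterlim F (within (fun w => Cmod w <= 1) (locally (T := C_UniformSpace) z))
            (locally (T := C_UniformSpace) (F z)))
    sup_norm.

Definition in_dual (X : fspace) (L : (C -> C) -> C) : Prop :=
  (forall f h, mem X f -> mem X h -> L (fadd f h) = (L f + L h)%C) /\
  (forall c f, mem X f -> L (fscal c f) = (c * L f)%C) /\
  (exists M, forall f, mem X f -> Cmod (L f) <= M * nrm X f).

Definition dual_norm (X : fspace) (L : (C -> C) -> C) : Rbar :=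
  Lub_Rbar (fun x => exists f, mem X f /\ nrm X f <= 1 /\ x = Cmod (L f)).

Definition dilate (r : R) (f : C -> C) (z : C) : C := f (r * z)%C.

Record admissible (X : fspace) : Prop := {
  admissible_P1 : subspace disc_algebra X;
  admissible_P2_mem : forall f r, mem X f -> 0 < r < 1 -> mem X (dilate r f);
  admissible_P2_norm : exists K, forall f r, mem X f -> 0 < r < 1 ->
    nrm X (dilate r f) <= K * nrm X f;
  admissible_P3 : forall z, disc z -> in_dual X (fun f => f z)
}.

Definition is_pairing (beta : nat -> R) (f h : C -> C) (l : C) : Prop :=
  exists S : R -> C,
    (forall r, 0 < r < 1 ->
       is_series (K := C_AbsRing) (V := C_NormedModule)
         (fun n => taylor_coef f n * Cconj (taylor_coef h n) * beta n * r ^ n)%C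
         (S r)) /\
    filterlim S (at_left 1) (locally (T := C_UniformSpace) l).

Definition pairing (beta : nat -> R) (f h : C -> C) : C :=
  iota (T := C_CompleteNormedModule) (is_pairing beta f h).

Definition dual_via_pairing (beta : nat -> R) (X Y : fspace) : Prop :=
  (forall f h, mem X f -> mem Y h -> exists l, is_pairing beta f h l) /\
  (exists K, 0 < K /\ forall h, mem Y h ->
     Rbar_le (/ K * nrm Y h) (dual_norm X (fun f => pairing beta f h)) /\
     Rbar_le (dual_norm X (fun f => pairing beta f h)) (K * nrm Y h)) /\
  (forall L, in_dual X L ->
     exists h, mem Y h /\ forall f, mem X f -> L f = pairing beta f h).

Definition kernel (beta : nat -> R) (z w : C) : C :=
  iota (T := C_CompleteNormedModule)
    (is_series (K := C_AbsRing) (V := C_NormedModule)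
       (fun n => (w * Cconj z) ^ n / beta n)%C).

(** The function [G_{g,z}], also written [T_g^*(K_z)]. *)
Definition G (beta : nat -> R) (g : C -> C) (z w : C) : C :=
  Cconj (path_int (fun zeta => (C_derive g zeta * Cconj (kernel beta zeta w))%C) z).

Definition bounded_seq (X : fspace) (u : nat -> C -> C) : Prop :=
  (forall n, mem X (u n)) /\ exists M, forall n, nrm X (u n) <= M.

Definition cv_compacts (u : nat -> C -> C) (f : C -> C) : Prop :=
  forall K : C -> Prop, compact_C K -> (forall z, K z -> disc z) ->
  forall eps, 0 < eps -> exists N, forall n z, (N <= n)%nat -> K z ->
    Cmod (u n z - f z) < eps.

Definition bounded_cv_subseq (X : fspace) : Prop :=
  forall u, bounded_seq X u ->
  exists (phi : nat -> nat) (f : C -> C),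
    (forall n, (phi n < phi (S n))%nat) /\ mem X f /\
    cv_compacts (fun n => u (phi n)) f.

(* Main.v *)
(** Both parts compare total boundedness in the sup norm with uniform behaviour on
    the unit ball of [X].

    (i) A closed graph argument makes the inclusion of H^infty in [X] continuous, so
    the peak functions [p = (1-a)/(1 - a conj(zeta) z)], [a -> 1], are bounded in [X]
    and tend to [0] locally uniformly. Compactness of [T_g] turns pointwise
    convergence of [T_g p] into uniform smallness, and [T_g p - p g] is Lipschitz;
    hence [g] oscillates arbitrarily little near [zeta], that is, [g] lies in [A].
    Then [T_g (f_r)] lies in [A] for every [f] in [X], and by compactness [T_g f] is a
    uniform limit of such functions.

    (ii) By duality the norm of [G_z - G_w] in [Y] is comparable with the supremum of
    [|T_g f (z) - T_g f (w)|] over the unit ball of [X], so total boundedness of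
    [{G_z}] and of the image of the ball are equivalent, as in Schauder's theorem on
    the compactness of adjoints. *)

Require Import Defs.
From Stdlib Require Import Lra Lia Classical ClassicalEpsilon.

(** * Complex derivatives *)

(** An analytic function is given by local expansions only, whereas the pairing reads Taylor
    coefficients at [0]. So the expansion at [0] must be shown to converge in the whole disc.
    Cauchy's formula, obtained by contracting a circle to a point under the integral sign, provides
    this. From then on [Tg g f] is treated as the primitive of [f g'] that vanishes at [0].

    The obstacle in (i) is that nothing controls [g'] near the circle. It disappears from
    [Tg g p - p g], whose derivative is [- p' g], and [g] is bounded because [Tg g 1 = g - g 0]. As
    [Hinfty] and the disc algebra carry the same norm, only the membership of [Tg g f] in the disc
    algebra is at stake.

    In (ii) it must first be shown that [G_z] lies in [Y]: the functional sending [f] to [Tg g f z]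
    is represented by some element of [Y], and testing on monomials identifies that element with
    [G_z]. Conversely, duality controls only suprema over the open disc, so it yields compactness
    into [Hinfty], which (i) then upgrades. *)

(** The difference quotient is multiplied out, and the inequality is not strict, so the case [w = z]
    needs no exclusion. *)
Definition cderiv (f : C -> C) (z l : C) : Prop :=
  forall eps, 0 < eps -> exists d, 0 < d /\ forall w, Cmod (w - z) < d ->
    Cmod (f w - f z - l * (w - z)) <= eps * Cmod (w - z).

Definition ccont (f : C -> C) (z : C) : Prop :=
  forall eps, 0 < eps -> exists d, 0 < d /\ forall w, Cmod (w - z) < d ->
    Cmod (f w - f z) < eps.

Definition rderiv (p : R -> C) (t : R) (l : C) : Prop :=
  forall eps, 0 < eps -> exists d, 0 < d /\ forall s, Rabs (s - t) < d ->
    Cmod (p s - p t - l * RtoC (s - t)) <= eps * Rabs (s - t).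

Lemma Cmod_minus_sym (a b : C) : Cmod (a - b) = Cmod (b - a).
Proof. rewrite <- Cmod_opp. f_equal. ring. Qed.

Lemma Cmod_triangle_minus (a b : C) : Cmod a <= Cmod b + Cmod (a - b).
Proof.
  replace a with (b + (a - b))%C at 1 by ring. apply Cmod_triangle.
Qed.

Lemma Cmod_sub_le (a b : C) : Cmod (a - b) <= Cmod a + Cmod b.
Proof. rewrite <- (Cmod_opp b). apply Cmod_triangle. Qed.

Lemma Cmod_dist (b a c : C) : Cmod (a - c) <= Cmod (a - b) + Cmod (b - c).
Proof. replace (a - c)%C with ((a - b) + (b - c))%C by ring. apply Cmod_triangle. Qed.

Lemma Cmod_minus_diag (a : C) : Cmod (a - a) = 0.
Proof. unfold Cminus. now rewrite Cplus_opp_r, Cmod_0. Qed.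

Lemma RtoC_neq_0 (x : R) : x <> 0 -> RtoC x <> 0.
Proof. intros H E. now apply RtoC_inj in E. Qed.

Lemma lt_Rmin_l (a b x : R) : x < Rmin a b -> x < a.
Proof. intros H. exact (Rlt_le_trans _ _ _ H (Rmin_l _ _)). Qed.

Lemma lt_Rmin_r (a b x : R) : x < Rmin a b -> x < b.
Proof. intros H. exact (Rlt_le_trans _ _ _ H (Rmin_r _ _)). Qed.

Lemma Cmod_scal_pos (x : R) (z : C) : 0 <= x -> Cmod (RtoC x * z) = x * Cmod z.
Proof. intros H. now rewrite Cmod_mult, Cmod_R, Rabs_pos_eq. Qed.

Lemma Cmod_zero_minus (a b : C) : Cmod (a - b) = 0 -> a = b.
Proof.
  intros H. apply Cmod_eq_0 in H. replace a with (b + (a - b))%C by ring.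
  rewrite H. ring.
Qed.

Lemma Cmod_le_eps (a b : C) : (forall eps, 0 < eps -> Cmod (a - b) <= eps) -> a = b.
Proof.
  intros H. apply Cmod_zero_minus. apply Rle_antisym; [|apply Cmod_ge_0].
  apply le_epsilon. intros e He. rewrite Rplus_0_l. now apply H.
Qed.

Lemma im_le_Cmod (c : C) : Rabs (Im c) <= Cmod c.
Proof. eapply Rle_trans; [|apply Rmax_Cmod]. apply Rmax_r. Qed.

Lemma Cmod_le_re_im (c : C) : Cmod c <= Rabs (Re c) + Rabs (Im c).
Proof.
  destruct c as [x y]; simpl.
  replace (x, y) with (RtoC x + Ci * RtoC y)%C
    by (unfold RtoC, Ci, Cplus, Cmult; simpl; f_equal; ring).
  eapply Rle_trans; [apply Cmod_triangle|].
  rewrite Cmod_mult, Cmod_Ci, !Cmod_R. lra.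
Qed.

Lemma Re_minus (a b : C) : Re (a - b)%C = Re a - Re b.
Proof. reflexivity. Qed.

Lemma Im_minus (a b : C) : Im (a - b)%C = Im a - Im b.
Proof. reflexivity. Qed.

(** The uniform structure of [C] is that of a product, whose balls are squares; comparing them with
    round discs costs the factor [sqrt 2]. *)
Lemma locally_Cmod (z : C) (P : C -> Prop) :
  locally (T := C_UniformSpace) z P <->
  exists d, 0 < d /\ forall w, Cmod (w - z) < d -> P w.
Proof.
  split.
  - intros [e He]. exists e. split; [apply cond_pos|]. intros w Hw. apply He.
    apply C_NormedModule_mixin_compat1. exact Hw.
  - intros [d [Hd H]].
    assert (Hs : 0 < sqrt 2) by (apply sqrt_lt_R0; lra).
    assert (He : 0 < d / sqrt 2) by (apply Rdiv_lt_0_compat; lra).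
    exists (mkposreal _ He). intros w Hw. apply H.
    generalize (C_NormedModule_mixin_compat2 z w (mkposreal _ He) Hw). simpl.
    replace (sqrt 2 * (d / sqrt 2)) with d by (field; lra). exact (fun h => h).
Qed.

Lemma filterlim_Cmod {T : Type} (F : (T -> Prop) -> Prop) {FF : Filter F} (f : T -> C) (l : C) :
  filterlim f F (locally (T := C_UniformSpace) l) <->
  forall eps, 0 < eps -> F (fun x => Cmod (f x - l) < eps).
Proof.
  split.
  - intros H eps He. apply (H (fun y => Cmod (y - l) < eps)). apply locally_Cmod. now exists eps.
  - intros H P HP. apply locally_Cmod in HP. destruct HP as [d [Hd HP]].
    unfold filtermap. generalize (H d Hd). apply filter_imp. intros x Hx. now apply HP.
Qed.

Lemma cderiv_C_derive (f : C -> C) (z l : C) : cderiv f z l -> C_derive f z = l.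
Proof.
  intros H. apply is_C_lim_unique. apply filterlim_Cmod.
  { apply within_filter, locally_filter. }
  intros eps He. destruct (H (eps / 2)) as [d [Hd Hw]]; [lra|].
  apply locally_Cmod. exists d. split; [exact Hd|]. intros w Hwd Hne.
  assert (Hne' : (w - z)%C <> 0).
  { intros E. apply Hne, Cmod_zero_minus. rewrite E. apply Cmod_0. }
  assert (Hp : 0 < Cmod (w - z)) by now apply Cmod_gt_0.
  replace ((f w - f z) / (w - z) - l)%C with ((f w - f z - l * (w - z)) / (w - z))%C
    by now field.
  rewrite Cmod_div by exact Hne'. specialize (Hw w Hwd).
  apply Rle_lt_trans with (eps / 2); [|lra].
  apply Rmult_le_reg_r with (Cmod (w - z)); [exact Hp|].
  unfold Rdiv at 1. rewrite Rmult_assoc, Rinv_l, Rmult_1_r by lra. exact Hw.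
Qed.

Lemma cderiv_ext_loc (f h : C -> C) (z l : C) (r : R) :
  0 < r -> (forall w, Cmod (w - z) < r -> f w = h w) -> cderiv f z l -> cderiv h z l.
Proof.
  intros Hr E H eps He. destruct (H eps He) as [d [Hd Hw]].
  exists (Rmin d r). split; [now apply Rmin_pos|]. intros w Hwd.
  rewrite <- !E.
  - apply Hw. eapply Rlt_le_trans; [exact Hwd|apply Rmin_l].
  - rewrite Cmod_minus_diag. exact Hr.
  - eapply Rlt_le_trans; [exact Hwd|apply Rmin_r].
Qed.

Lemma cderiv_ccont (f : C -> C) (z l : C) : cderiv f z l -> ccont f z.
Proof.
  intros H eps He. destruct (H 1) as [d [Hd Hw]]; [lra|].
  assert (Hl := Cmod_ge_0 l).
  assert (Hq : 0 < eps / (2 + Cmod l)) by (apply Rdiv_lt_0_compat; lra).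
  exists (Rmin d (eps / (2 + Cmod l))). split; [now apply Rmin_pos|].
  intros w Hwd. assert (Hw1 := Hw w (lt_Rmin_l _ _ _ Hwd)).
  assert (Hw2 := lt_Rmin_r _ _ _ Hwd).
  assert (Hw0 := Cmod_ge_0 (w - z)).
  assert (H3 := Cmod_triangle_minus (f w - f z) (l * (w - z))). rewrite Cmod_mult in H3.
  apply Rmult_lt_compat_l with (r := 2 + Cmod l) in Hw2; [|lra].
  replace ((2 + Cmod l) * (eps / (2 + Cmod l))) with eps in Hw2 by (field; lra). lra.
Qed.

Lemma cderiv_ext (f h : C -> C) (z l m : C) :
  (forall w, f w = h w) -> l = m -> cderiv f z l -> cderiv h z m.
Proof. intros E <-. apply cderiv_ext_loc with 1; [lra|]. intros w _. apply E. Qed.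

(** The bridge through which product rule and chain rule are inherited from the general theory of
    derivatives. *)
Lemma cderiv_is_derive (f : C -> C) (z l : C) :
  cderiv f z l <-> is_derive (K := C_AbsRing) (V := AbsRing_NormedModule C_AbsRing) f z l.
Proof.
  split.
  - intros H. split; [apply is_linear_scal_l|]. intros x Hx.
    apply (is_filter_lim_locally_unique (V := AbsRing_NormedModule C_AbsRing)) in Hx.
    subst x. intros eps. destruct (H eps (cond_pos eps)) as [d [Hd Hw]].
    exists (mkposreal d Hd). intros w Hwd.
    change (Cmod (f w - f z - (w - z) * l) <= eps * Cmod (w - z)).
    rewrite (Cmult_comm (w - z)). now apply Hw.
  - intros [_ H] eps He. destruct (H z (fun P HP => HP) (mkposreal eps He)) as [d Hd].
    exists d. split; [apply cond_pos|]. intros w Hw. rewrite (Cmult_comm l). exact (Hd w Hw).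
Qed.

Lemma cderiv_const (c z : C) : cderiv (fun _ => c) z 0.
Proof. apply cderiv_is_derive. exact (is_derive_const _ _). Qed.

Lemma cderiv_id (z : C) : cderiv (fun w => w) z 1.
Proof. apply cderiv_is_derive. exact (is_derive_id _). Qed.

Lemma cderiv_plus (f h : C -> C) (z l m : C) :
  cderiv f z l -> cderiv h z m -> cderiv (fun w => f w + h w)%C z (l + m)%C.
Proof. rewrite !cderiv_is_derive. exact (is_derive_plus _ _ _ _ _). Qed.

Lemma cderiv_minus (f h : C -> C) (z l m : C) :
  cderiv f z l -> cderiv h z m -> cderiv (fun w => f w - h w)%C z (l - m)%C.
Proof. rewrite !cderiv_is_derive. exact (is_derive_minus _ _ _ _ _). Qed.

Lemma cderiv_mult (f h : C -> C) (z l m : C) :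
  cderiv f z l -> cderiv h z m ->
  cderiv (fun w => f w * h w)%C z (l * h z + f z * m)%C.
Proof.
  rewrite !cderiv_is_derive. intros Hf Hh.
  exact (is_derive_mult _ _ _ _ _ Hf Hh Cmult_comm).
Qed.

Lemma cderiv_scal (c : C) (f : C -> C) (z l : C) :
  cderiv f z l -> cderiv (fun w => c * f w)%C z (c * l)%C.
Proof.
  intros H. apply (cderiv_ext (fun w => c * f w)%C _ z (0 * f z + c * l)%C).
  - reflexivity.
  - ring.
  - exact (cderiv_mult _ _ _ _ _ (cderiv_const c z) H).
Qed.

Lemma cderiv_comp (f h : C -> C) (z l m : C) :
  cderiv f (h z) l -> cderiv h z m -> cderiv (fun w => f (h w)) z (m * l)%C.
Proof. rewrite !cderiv_is_derive. exact (is_derive_comp _ _ _ _ _). Qed.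

Lemma cderiv_comp_affine (f : C -> C) (c b z l : C) :
  cderiv f (c + b * z)%C l -> cderiv (fun w => f (c + b * w)%C) z (b * l)%C.
Proof.
  intros H. apply (cderiv_comp f (fun w => c + b * w)%C _ _ _ H).
  apply (cderiv_ext (fun w => c + b * w)%C _ z (0 + b * 1)%C); [reflexivity|ring|].
  apply cderiv_plus; [apply cderiv_const|apply cderiv_scal, cderiv_id].
Qed.

Lemma rderiv_Re (p : R -> C) (t : R) (l : C) :
  rderiv p t l -> is_derive (fun s => Re (p s)) t (Re l).
Proof.
  intros H. split; [apply is_linear_scal_l|]. intros x Hx.
  apply (is_filter_lim_locally_unique (V := R_NormedModule)) in Hx. subst x.
  intros eps. destruct (H eps (cond_pos eps)) as [d [Hd Hs]].
  exists (mkposreal d Hd). intros s Hsd.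
  change (Rabs (Re (p s) - Re (p t) - (s - t) * Re l) <= eps * Rabs (s - t)).
  eapply Rle_trans; [|exact (Hs s Hsd)]. eapply Rle_trans; [|apply re_le_Cmod].
  right. f_equal. destruct (p s), (p t), l; simpl; ring.
Qed.

Lemma rderiv_of_components (p : R -> C) (t : R) (l : C) :
  is_derive (fun s => Re (p s)) t (Re l) -> is_derive (fun s => Im (p s)) t (Im l) ->
  rderiv p t l.
Proof.
  intros [_ H1] [_ H2] eps He. assert (He2 : 0 < eps / 2) by lra.
  destruct (H1 t (fun P HP => HP) (mkposreal _ He2)) as [d Hd].
  destruct (H2 t (fun P HP => HP) (mkposreal _ He2)) as [e Hde].
  exists (Rmin d e). split; [apply Rmin_pos; apply cond_pos|]. intros s Hs.
  specialize (Hd s (lt_Rmin_l _ _ _ Hs)). specialize (Hde s (lt_Rmin_r _ _ _ Hs)).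
  change (Rabs (Re (p s) - Re (p t) - (s - t) * Re l) <= eps / 2 * Rabs (s - t)) in Hd.
  change (Rabs (Im (p s) - Im (p t) - (s - t) * Im l) <= eps / 2 * Rabs (s - t)) in Hde.
  eapply Rle_trans; [apply Cmod_le_re_im|].
  replace (Re (p s - p t - l * RtoC (s - t))%C) with (Re (p s) - Re (p t) - (s - t) * Re l)
    by (destruct (p s), (p t), l; simpl; ring).
  replace (Im (p s - p t - l * RtoC (s - t))%C) with (Im (p s) - Im (p t) - (s - t) * Im l)
    by (destruct (p s), (p t), l; simpl; ring).
  lra.
Qed.

Lemma rderiv_comp (f : C -> C) (p : R -> C) (t : R) (l m : C) :
  cderiv f (p t) l -> rderiv p t m -> rderiv (fun s => f (p s)) t (l * m)%C.
Proof.
  intros Hf Hp eps He. assert (Hl := Cmod_ge_0 l). assert (Hm := Cmod_ge_0 m).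
  destruct (Hf (eps / (2 * (1 + Cmod m)))) as [d [Hd H1]]; [apply Rdiv_lt_0_compat; lra|].
  destruct (Hp (Rmin 1 (eps / (2 * (1 + Cmod l))))) as [e [He' H2]].
  { apply Rmin_pos; [lra|apply Rdiv_lt_0_compat; lra]. }
  exists (Rmin e (d / (1 + Cmod m))).
  split; [apply Rmin_pos; [exact He'|apply Rdiv_lt_0_compat; lra]|]. intros s Hs.
  specialize (H2 s (lt_Rmin_l _ _ _ Hs)).
  assert (Hs2 := lt_Rmin_r _ _ _ Hs).
  assert (Hr := Rabs_pos (s - t)).
  assert (H2a : Cmod (p s - p t - m * RtoC (s - t)) <= 1 * Rabs (s - t)).
  { eapply Rle_trans; [exact H2|]. apply Rmult_le_compat_r; [exact Hr|apply Rmin_l]. }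
  assert (H2b : Cmod (p s - p t - m * RtoC (s - t)) <= eps / (2 * (1 + Cmod l)) * Rabs (s - t)).
  { eapply Rle_trans; [exact H2|]. apply Rmult_le_compat_r; [exact Hr|apply Rmin_r]. }
  assert (Hps : Cmod (p s - p t) <= (1 + Cmod m) * Rabs (s - t)).
  { assert (H3 := Cmod_triangle_minus (p s - p t) (m * RtoC (s - t))).
    rewrite Cmod_mult, Cmod_R in H3. lra. }
  assert (Hlt : (1 + Cmod m) * Rabs (s - t) < d).
  { apply Rmult_lt_compat_l with (r := 1 + Cmod m) in Hs2; [|lra].
    replace ((1 + Cmod m) * (d / (1 + Cmod m))) with d in Hs2 by (field; lra). exact Hs2. }
  specialize (H1 (p s) (Rle_lt_trans _ _ _ Hps Hlt)).
  replace (f (p s) - f (p t) - l * m * RtoC (s - t))%C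
    with ((f (p s) - f (p t) - l * (p s - p t)) + l * (p s - p t - m * RtoC (s - t)))%C by ring.
  eapply Rle_trans; [apply Cmod_triangle|]. rewrite Cmod_mult.
  apply Rle_trans with (eps / (2 * (1 + Cmod m)) * ((1 + Cmod m) * Rabs (s - t))
    + Cmod l * (eps / (2 * (1 + Cmod l)) * Rabs (s - t))).
  { apply Rplus_le_compat.
    - eapply Rle_trans; [exact H1|]. apply Rmult_le_compat_l; [|exact Hps].
      apply Rlt_le, Rdiv_lt_0_compat; lra.
    - now apply Rmult_le_compat_l. }
  replace (eps / (2 * (1 + Cmod m)) * ((1 + Cmod m) * Rabs (s - t)))
    with (eps / 2 * Rabs (s - t)) by (field; lra).
  assert (Cmod l * (eps / (2 * (1 + Cmod l)) * Rabs (s - t)) <= eps / 2 * Rabs (s - t)).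
  { replace (eps / 2 * Rabs (s - t)) with ((1 + Cmod l) * (eps / (2 * (1 + Cmod l)) * Rabs (s - t)))
      by (field; lra).
    apply Rmult_le_compat_r; [|lra].
    apply Rmult_le_pos; [apply Rlt_le, Rdiv_lt_0_compat; lra|exact Hr]. }
  lra.
Qed.

Lemma rderiv_scal (c : C) (p : R -> C) (t : R) (l : C) :
  rderiv p t l -> rderiv (fun s => c * p s)%C t (c * l)%C.
Proof.
  intros H. replace (c * l)%C with (c * 1 * l)%C by ring.
  exact (rderiv_comp _ p t _ l (cderiv_scal c _ _ _ (cderiv_id (p t))) H).
Qed.

(** Since [Im c = Re (- Ci * c)], this is the statement on real parts for the curve [- Ci * p]. *)
Lemma rderiv_Im (p : R -> C) (t : R) (l : C) :
  rderiv p t l -> is_derive (fun s => Im (p s)) t (Im l).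
Proof.
  intros H. apply (rderiv_scal (-Ci)%C), rderiv_Re in H.
  replace (Im l) with (Re (- Ci * l)%C) by (destruct l; simpl; ring).
  eapply is_derive_ext; [|exact H]. intros s. simpl. destruct (p s); simpl. ring.
Qed.

Lemma rderiv_segment (w z : C) (t : R) :
  rderiv (fun s => w + RtoC s * (z - w))%C t (z - w)%C.
Proof.
  intros eps He. exists 1. split; [lra|]. intros s _.
  replace (w + RtoC s * (z - w) - (w + RtoC t * (z - w)) - (z - w) * RtoC (s - t))%C with (RtoC 0).
  - rewrite Cmod_0. apply Rmult_le_pos; [lra|apply Rabs_pos].
  - rewrite RtoC_minus. ring.
Qed.

Lemma Cmod_segment (w z : C) (t r : R) :
  0 <= t <= 1 -> Cmod w <= r -> Cmod z <= r -> Cmod (w + RtoC t * (z - w)) <= r.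
Proof.
  intros Ht Hw Hz.
  replace (w + RtoC t * (z - w))%C with (RtoC (1 - t) * w + RtoC t * z)%C
    by (rewrite RtoC_minus; ring).
  eapply Rle_trans; [apply Cmod_triangle|].
  rewrite !Cmod_mult, !Cmod_R, !Rabs_pos_eq by lra. nra.
Qed.

Lemma disc_segment (w z : C) (t : R) :
  0 <= t <= 1 -> disc w -> disc z -> disc (w + RtoC t * (z - w))%C.
Proof.
  intros Ht Hw Hz. eapply Rle_lt_trans; [|exact (Rmax_lub_lt _ _ _ Hw Hz)].
  apply Cmod_segment; [exact Ht|apply Rmax_l|apply Rmax_r].
Qed.

(** Testing against [Cconj (f z - f w)] reduces to the real mean value theorem. *)
Lemma mean_value_bound (f f' : C -> C) (w z : C) (M : R) :
  (forall t, 0 <= t <= 1 -> cderiv f (w + RtoC t * (z - w))%C (f' (w + RtoC t * (z - w))%C)) ->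
  (forall t, 0 <= t <= 1 -> Cmod (f' (w + RtoC t * (z - w))%C) <= M) ->
  Cmod (f z - f w) <= M * Cmod (z - w).
Proof.
  intros Hd HM.
  set (p := fun s : R => (w + RtoC s * (z - w))%C).
  set (c := Cconj (f z - f w)).
  destruct (MVT_gen (fun s => Re (c * f (p s))%C) 0 1 (fun s => Re (c * (f' (p s) * (z - w)))%C))
    as [s [Hs Heq]].
  - intros x Hx. rewrite Rmin_left, Rmax_right in Hx by lra.
    apply rderiv_Re, rderiv_scal, rderiv_comp; [apply Hd; lra|apply rderiv_segment].
  - intros x Hx. rewrite Rmin_left, Rmax_right in Hx by lra.
    apply derivable_continuous_pt. eexists. apply is_derive_Reals.
    apply rderiv_Re, rderiv_scal, rderiv_comp; [apply Hd; lra|apply rderiv_segment].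
  - rewrite Rmin_left, Rmax_right in Hs by lra.
    assert (E1 : p 1 = z) by (unfold p; ring).
    assert (E0 : p 0 = w) by (unfold p; ring).
    rewrite E1, E0, Rminus_0_r, Rmult_1_r, <- Re_minus in Heq.
    replace (c * f z - c * f w)%C with (c * (f z - f w))%C in Heq by ring.
    assert (H2 : Re (c * (f z - f w))%C = Cmod (f z - f w) ^ 2).
    { rewrite Cmult_comm. unfold c. rewrite <- Cmod2_conj. reflexivity. }
    rewrite H2 in Heq.
    assert (H3 : Cmod (f z - f w) ^ 2 <= Cmod (f z - f w) * (M * Cmod (z - w))).
    { rewrite Heq. eapply Rle_trans; [apply Rle_abs|].
      eapply Rle_trans; [apply re_le_Cmod|]. rewrite !Cmod_mult. unfold c. rewrite Cmod_conj.
      apply Rmult_le_compat_l; [apply Cmod_ge_0|].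
      apply Rmult_le_compat_r; [apply Cmod_ge_0|]. now apply HM. }
    assert (H4 := Cmod_ge_0 (f z - f w)).
    destruct (Req_dec (Cmod (f z - f w)) 0) as [E|Hne].
    + rewrite E. apply Rmult_le_pos; [|apply Cmod_ge_0].
      eapply Rle_trans; [apply Cmod_ge_0|apply (HM 0); lra].
    + apply Rmult_le_reg_l with (Cmod (f z - f w)); [lra|]. simpl in H3. lra.
Qed.

Lemma cderiv_lipschitz (f f' : C -> C) (M : R) (w z : C) :
  (forall v, disc v -> cderiv f v (f' v)) -> (forall v, disc v -> Cmod (f' v) <= M) ->
  disc w -> disc z -> Cmod (f z - f w) <= M * Cmod (z - w).
Proof.
  intros Hd HM Hw Hz. apply (mean_value_bound f f'); intros t Ht;
    [apply Hd|apply HM]; now apply disc_segment.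
Qed.

(** The fundamental theorem of calculus for each component; [F'] serves to make the integrand
    continuous. *)
Lemma path_int_primitive (F F' P : C -> C) (z : C) :
  (forall t, 0 <= t <= 1 -> cderiv P (RtoC t * z)%C (F (RtoC t * z)%C)) ->
  (forall t, 0 <= t <= 1 -> cderiv F (RtoC t * z)%C (F' (RtoC t * z)%C)) ->
  path_int F z = (P z - P 0)%C.
Proof.
  intros HP HF. unfold path_int.
  destruct (Ceq_dec z 0) as [->|Hz].
  { rewrite Cmult_0_l. ring. }
  assert (Hline : forall t, rderiv (fun s => RtoC s * z)%C t z).
  { intros t. assert (H := rderiv_segment 0 z t). replace (z - 0)%C with z in H by ring.
    intros eps He. destruct (H eps He) as [d [Hd Hs]]. exists d. split; [exact Hd|].
    intros s Hsd. rewrite <- (Cplus_0_l (RtoC s * z)), <- (Cplus_0_l (RtoC t * z)). now apply Hs. }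
  (* The segment has speed [z], so it is [P / z] that has derivative [F] along it; this is why
     [z = 0] was split off. *)
  assert (Hd : forall t, 0 <= t <= 1 -> rderiv (fun s => / z * P (RtoC s * z))%C t (F (RtoC t * z)%C)).
  { intros t Ht. replace (F (RtoC t * z)%C) with (/ z * (F (RtoC t * z)%C * z))%C by now field.
    apply rderiv_scal, (rderiv_comp P (fun s => RtoC s * z)%C); auto. }
  assert (Hc : forall t, 0 <= t <= 1 -> rderiv (fun s => F (RtoC s * z)%C) t (F' (RtoC t * z) * z)%C).
  { intros t Ht. apply (rderiv_comp F (fun s => RtoC s * z)%C); auto. }
  assert (HI : is_RInt (V := C_R_NormedModule) (fun t => F (RtoC t * z)%C) 0 1
     (/ z * P (RtoC 1 * z) - / z * P (RtoC 0 * z))%C).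
  { apply (is_RInt_fct_extend_pair (U := R_NormedModule) (V := R_NormedModule)).
    - apply (is_RInt_derive (V := R_CompleteNormedModule)
        (fun s => Re (/ z * P (RtoC s * z))%C) (fun t => Re (F (RtoC t * z)%C)));
        intros t Ht; rewrite Rmin_left, Rmax_right in Ht by lra.
      + now apply rderiv_Re, Hd.
      + apply (ex_derive_continuous (K := R_AbsRing) (V := R_NormedModule)).
        eexists. now apply rderiv_Re, Hc.
    - apply (is_RInt_derive (V := R_CompleteNormedModule)
        (fun s => Im (/ z * P (RtoC s * z))%C) (fun t => Im (F (RtoC t * z)%C)));
        intros t Ht; rewrite Rmin_left, Rmax_right in Ht by lra.
      + now apply rderiv_Im, Hd.
      + apply (ex_derive_continuous (K := R_AbsRing) (V := R_NormedModule)).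
        eexists. now apply rderiv_Im, Hc. }
  rewrite (is_RInt_unique (V := C_R_CompleteNormedModule) _ _ _ _ HI), Cmult_1_l, Cmult_0_l.
  now field.
Qed.

(** * Complex power series *)

Local Notation csum_n := (sum_n (G := C_AbelianMonoid)).

Definition cser (u : nat -> C) (l : C) : Prop :=
  is_series (K := C_AbsRing) (V := C_NormedModule) u l.

Definition psum (a : nat -> C) (z l : C) : Prop := cser (fun n => a n * z ^ n)%C l.

Lemma cser_eps (u : nat -> C) (l : C) :
  cser u l <-> forall eps, 0 < eps -> exists N, forall n, (N <= n)%nat ->
    Cmod (csum_n u n - l) < eps.
Proof.
  unfold cser, is_series. rewrite (filterlim_Cmod eventually). reflexivity.
Qed.

Lemma cser_unique (u : nat -> C) (l m : C) : cser u l -> cser u m -> l = m.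
Proof.
  intros Hl Hm. apply Cmod_le_eps. intros eps He.
  rewrite cser_eps in Hl, Hm.
  destruct (Hl (eps / 2)) as [N H1]; [lra|]. destruct (Hm (eps / 2)) as [N' H2]; [lra|].
  specialize (H1 (N + N')%nat ltac:(lia)). specialize (H2 (N + N')%nat ltac:(lia)).
  rewrite Cmod_minus_sym in H1. generalize (Cmod_dist (csum_n u (N + N')) l m). lra.
Qed.

Lemma cser_ext (u v : nat -> C) (l : C) : (forall n, u n = v n) -> cser u l -> cser v l.
Proof. intros E. apply (is_series_ext (K := C_AbsRing) (V := C_NormedModule)). exact E. Qed.

Lemma cser_scal (c : C) (u : nat -> C) (l : C) :
  cser u l -> cser (fun n => c * u n)%C (c * l)%C.
Proof. apply (is_series_scal (K := C_AbsRing) (V := C_NormedModule)). Qed.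

Lemma cser_minus (u v : nat -> C) (l m : C) :
  cser u l -> cser v m -> cser (fun n => u n - v n)%C (l - m)%C.
Proof. apply (is_series_minus (K := C_AbsRing) (V := C_NormedModule)). Qed.

Lemma cser_shift (u : nat -> C) (l : C) :
  cser (fun n => u (S n)) l <-> cser u (l + u 0%nat)%C.
Proof.
  split.
  - intros H. apply (is_series_decr_1 (K := C_AbsRing) (V := C_NormedModule)).
    change (cser (fun n => u (S n)) (l + u 0%nat + - u 0%nat)%C).
    replace (l + u 0%nat + - u 0%nat)%C with l by ring. exact H.
  - apply (is_series_incr_1 (K := C_AbsRing) (V := C_NormedModule)).
Qed.

Lemma cser_single (u : nat -> C) (k : nat) : (forall n, n <> k -> u n = 0) -> cser u (u k).
Proof.
  revert u. induction k as [|k IH]; intros u H.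
  - apply cser_eps. intros eps He. exists 0%nat. intros n _.
    replace (csum_n u n) with (u 0%nat).
    { now rewrite Cmod_minus_diag. }
    symmetry. induction n as [|n IHn]; [apply sum_O|].
    rewrite sum_Sn, IHn, (H (S n)) by lia. apply Cplus_0_r.
  - specialize (IH (fun n => u (S n))). cbv beta in IH.
    assert (H0 : u 0%nat = 0) by (apply H; lia).
    apply (proj1 (cser_shift u _)) in IH; [|intros n Hn; apply H; lia].
    rewrite H0, Cplus_0_r in IH. exact IH.
Qed.

Lemma cser_zero : cser (fun _ => RtoC 0) 0.
Proof. apply (cser_single (fun _ => RtoC 0) 0). reflexivity. Qed.

Lemma Cmod_sum_n_le (u : nat -> C) (v : nat -> R) (n : nat) :
  (forall k, Cmod (u k) <= v k) ->
  Cmod (csum_n u n) <= sum_n v n.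
Proof.
  intros H. induction n as [|n IH].
  - rewrite !sum_O. apply H.
  - rewrite !sum_Sn. eapply Rle_trans; [apply Cmod_triangle|]. now apply Rplus_le_compat.
Qed.

Lemma cser_norm_le (u : nat -> C) (l : C) (v : nat -> R) (s : R) :
  (forall n, Cmod (u n) <= v n) -> is_series v s -> cser u l -> Cmod l <= s.
Proof.
  intros H Hv Hu. apply le_epsilon. intros eps He. rewrite cser_eps in Hu.
  destruct (Hu eps He) as [N HN]. specialize (HN N (le_n _)).
  assert (Hs : sum_n v N <= s).
  { assert (Hp : forall k, 0 <= v k) by (intros k; eapply Rle_trans; [apply Cmod_ge_0|apply H]).
    assert (Hlim : is_lim_seq (sum_n v) s) by exact Hv.
    apply (is_lim_seq_incr_compare (sum_n v) s Hlim).
    intros n. rewrite sum_Sn. unfold plus; simpl. specialize (Hp (S n)). lra. }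
  assert (H2 := Cmod_sum_n_le u v N H).
  assert (H3 := Cmod_triangle_minus l (csum_n u N)).
  rewrite (Cmod_minus_sym l) in H3. lra.
Qed.

Lemma ex_cser_le (u : nat -> C) (v : nat -> R) :
  (forall n, Cmod (u n) <= v n) -> ex_series v -> exists l, cser u l.
Proof.
  intros H Hv.
  exact (ex_series_le (K := C_AbsRing) (V := C_CompleteNormedModule) u v H Hv).
Qed.

Definition csum (u : nat -> C) : C := epsilon (inhabits (RtoC 0)) (cser u).

Lemma csum_correct (u : nat -> C) : (exists l, cser u l) -> cser u (csum u).
Proof. apply epsilon_spec. Qed.

Lemma cser_bounded (u : nat -> C) (l : C) : cser u l -> exists M, forall n, Cmod (u n) <= M.
Proof.
  intros H. destruct (filterlim_bounded (V := C_NormedModule) (csum_n u)) as [M HM]; [now exists l|].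
  exists (M + M). intros [|n]; assert (H0 := HM 0%nat).
  - rewrite sum_O in H0. change (Cmod (u 0%nat) <= M) in H0. generalize (Cmod_ge_0 (u 0%nat)). lra.
  - assert (H1 := HM n). assert (H2 := HM (S n)). rewrite sum_Sn in H2.
    change (Cmod (csum_n u n) <= M) in H1. change (Cmod (csum_n u n + u (S n)) <= M) in H2.
    replace (u (S n)) with (csum_n u n + u (S n) - csum_n u n)%C by ring.
    eapply Rle_trans; [apply Cmod_sub_le|lra].
Qed.

Lemma psum_is_pseries (a : nat -> C) (z l : C) :
  psum a z l <-> is_pseries (K := C_AbsRing) (V := C_NormedModule) a z l.
Proof.
  assert (E : forall n, (a n * z ^ n)%C = scal (K := C_AbsRing) (V := C_NormedModule) (pow_n z n) (a n)).
  { intros n. rewrite Cmult_comm. reflexivity. }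
  split; apply cser_ext; intros n; [apply E|symmetry; apply E].
Qed.

(** Radius of convergence at least [R0], in the form delivered by Cauchy's estimates; it passes
    easily to differentiated and integrated series. *)
Definition coef_bd (a : nat -> C) (R0 : R) : Prop :=
  forall r, 0 <= r < R0 -> exists M, forall n, Cmod (a n) * r ^ n <= M.

Lemma psum_coef_bd (a : nat -> C) (R0 : R) :
  (forall z, Cmod z < R0 -> exists l, psum a z l) -> coef_bd a R0.
Proof.
  intros H r Hr. destruct (H (RtoC r)) as [l Hl].
  { rewrite Cmod_R, Rabs_pos_eq; lra. }
  destruct (cser_bounded _ _ Hl) as [M HM]. exists M. intros n. specialize (HM n).
  rewrite Cmod_mult, Cmod_pow, Cmod_R, Rabs_pos_eq in HM by lra. exact HM.
Qed.

(** Boundedness at a radius [s] midway between [r] and [R0] gives a geometric majorant of ratio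
    [r / s]. *)
Lemma coef_bd_ex_series (a : nat -> C) (R0 r : R) :
  coef_bd a R0 -> 0 <= r < R0 -> ex_series (fun n => Cmod (a n) * r ^ n).
Proof.
  intros Ha Hr. set (s := (r + R0) / 2). destruct (Ha s) as [M HM]; [unfold s; lra|].
  assert (Hs : 0 < s) by (unfold s; lra).
  assert (Hq : 0 <= r / s < 1).
  { split; [apply Rle_div_r; lra|]. apply Rlt_div_l; unfold s in *; lra. }
  apply (ex_series_le (K := R_AbsRing) (V := R_CompleteNormedModule) _
    (fun n => M * (r / s) ^ n)).
  - intros n. change (Rabs (Cmod (a n) * r ^ n) <= M * (r / s) ^ n).
    rewrite Rabs_pos_eq by (apply Rmult_le_pos; [apply Cmod_ge_0|apply pow_le; lra]).
    replace (r ^ n) with (s ^ n * (r / s) ^ n)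
      by (rewrite <- Rpow_mult_distr; f_equal; field; lra).
    rewrite <- Rmult_assoc. apply Rmult_le_compat_r; [apply pow_le; lra|apply HM].
  - apply (ex_series_scal (K := R_AbsRing) (V := R_NormedModule) M).
    exists (/ (1 - r / s)). apply is_series_geom. rewrite Rabs_pos_eq; lra.
Qed.

Lemma coef_bd_psum (a : nat -> C) (R0 : R) (z : C) :
  coef_bd a R0 -> Cmod z < R0 -> exists l, psum a z l.
Proof.
  intros Ha Hz. apply ex_cser_le with (fun n => Cmod (a n) * Cmod z ^ n).
  - intros n. rewrite Cmod_mult, Cmod_pow. apply Rle_refl.
  - apply coef_bd_ex_series with R0; [exact Ha|]. split; [apply Cmod_ge_0|exact Hz].
Qed.

(** Bernoulli's inequality [1 + n x <= (1 + x)^n] with [1 + x = / q]. *)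
Lemma INR_mult_pow_le (q : R) (n : nat) : 0 < q < 1 -> INR n * q ^ n <= / (/ q - 1).
Proof.
  intros Hq. assert (Hi : 1 < / q) by (rewrite <- Rinv_1; apply Rinv_lt_contravar; lra).
  assert (Hx : 0 < / q - 1) by lra.
  assert (H := poly n (/ q - 1) Hx). replace (1 + (/ q - 1)) with (/ q) in H by ring.
  rewrite pow_inv in H. assert (Hp : 0 < q ^ n) by (apply pow_lt; lra).
  apply Rmult_le_reg_r with (/ q - 1); [exact Hx|]. rewrite Rinv_l by lra.
  apply Rmult_le_compat_l with (r := q ^ n) in H; [|lra].
  rewrite Rinv_r in H by lra. lra.
Qed.

Lemma coef_bd_INR (a : nat -> C) (R0 : R) :
  coef_bd a R0 -> coef_bd (fun n => RtoC (INR n) * a n)%C R0.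
Proof.
  intros Ha r Hr. set (s := (r + R0) / 2). destruct (Ha s) as [M HM]; [unfold s; lra|].
  assert (Hs : r < s) by (unfold s; lra).
  destruct (Rle_lt_or_eq_dec 0 r) as [Hr0|<-]; [lra| |].
  - assert (Hq : 0 < r / s < 1).
    { split; [apply Rdiv_lt_0_compat; lra|]. apply Rlt_div_l; lra. }
    exists (M * / (/ (r / s) - 1)). intros n.
    rewrite Cmod_mult, Cmod_R, Rabs_pos_eq by apply pos_INR.
    replace (r ^ n) with (s ^ n * (r / s) ^ n)
      by (rewrite <- Rpow_mult_distr; f_equal; field; lra).
    replace (INR n * Cmod (a n) * (s ^ n * (r / s) ^ n))
      with (Cmod (a n) * s ^ n * (INR n * (r / s) ^ n)) by ring.
    apply Rmult_le_compat.
    + apply Rmult_le_pos; [apply Cmod_ge_0|apply pow_le; lra].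
    + apply Rmult_le_pos; [apply pos_INR|apply pow_le; lra].
    + apply HM.
    + now apply INR_mult_pow_le.
  - exists 0. intros [|n].
    + simpl. rewrite Cmult_0_l, Cmod_0. lra.
    + simpl. lra.
Qed.

(** Coefficients of the termwise derivative of a power series. *)
Definition dco (a : nat -> C) (n : nat) : C := (RtoC (INR (S n)) * a (S n))%C.

Lemma coef_bd_dco (a : nat -> C) (R0 : R) : coef_bd a R0 -> coef_bd (dco a) R0.
Proof.
  intros Ha r Hr. apply coef_bd_INR in Ha. set (s := (r + R0) / 2).
  assert (Hs : 0 < s /\ r < s) by (unfold s; lra).
  destruct (Ha s) as [M HM]; [unfold s; lra|].
  exists (M / s). intros n. specialize (HM (S n)). unfold dco.
  apply (proj1 (Rle_div_r _ _ s (proj1 Hs))). eapply Rle_trans; [|exact HM]. simpl pow.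
  set (c := Cmod _). replace (c * (s * s ^ n)) with (c * s ^ n * s) by ring.
  apply Rmult_le_compat_r; [lra|]. apply Rmult_le_compat_l; [apply Cmod_ge_0|].
  apply pow_incr. lra.
Qed.

(** The remainders [D_n] satisfy [D_(n+1) = w D_n + n z^(n-1) (w - z)^2], which drives the
    induction. The factor [r ^ 2] on the left avoids the exponent [n - 2] on the right. *)
Lemma Cpow_second_order (z w : C) (r : R) (n : nat) :
  0 <= r -> Cmod z <= r -> Cmod w <= r ->
  r ^ 2 * Cmod (w ^ n - z ^ n - RtoC (INR n) * z ^ (pred n) * (w - z))
    <= INR n ^ 2 * r ^ n * Cmod (w - z) ^ 2.
Proof.
  intros Hr Hz Hw. induction n as [|n IH].
  - simpl. replace (1 - 1 - 0 * 1 * (w - z))%C with (RtoC 0) by ring.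
    rewrite Cmod_0. right. ring.
  - set (D := (w ^ n - z ^ n - RtoC (INR n) * z ^ (pred n) * (w - z))%C) in *.
    assert (E : (w ^ S n - z ^ S n - RtoC (INR (S n)) * z ^ (pred (S n)) * (w - z))%C
      = (w * D + RtoC (INR n) * z ^ (pred n) * (w - z) * (w - z))%C).
    { unfold D. destruct n as [|n]; simpl pred.
      - simpl. ring.
      - rewrite (S_INR (S n)), RtoC_plus. simpl Cpow. ring. }
    rewrite E. set (q := Cmod (w - z)) in *. assert (Hq : 0 <= q) by apply Cmod_ge_0.
    assert (Hn := pos_INR n).
    assert (H2 : r ^ 2 * (INR n * Cmod z ^ pred n) <= INR n * r ^ S n).
    { destruct n as [|n]; [simpl; lra|]. simpl pred.
      apply Rle_trans with (r ^ 2 * (INR (S n) * r ^ n)).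
      - apply Rmult_le_compat_l; [apply pow_le; lra|].
        apply Rmult_le_compat_l; [exact Hn|]. apply pow_incr. split; [apply Cmod_ge_0|lra].
      - right. simpl. ring. }
    apply Rle_trans with (r ^ 2 * (Cmod (w * D) + INR n * Cmod z ^ pred n * q * q)).
    { apply Rmult_le_compat_l; [apply pow_le; lra|].
      eapply Rle_trans; [apply Cmod_triangle|].
      rewrite !(Cmod_mult _ (w - z)), (Cmod_mult (RtoC _)), Cmod_pow, Cmod_R, (Rabs_pos_eq (INR n)) by exact Hn.
      apply Rle_refl. }
    rewrite Cmod_mult, Rmult_plus_distr_l.
    assert (H3 : r ^ 2 * (Cmod w * Cmod D) <= r * (INR n ^ 2 * r ^ n * q ^ 2)).
    { apply Rle_trans with (r * (r ^ 2 * Cmod D)).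
      - replace (r ^ 2 * (Cmod w * Cmod D)) with (Cmod w * (r ^ 2 * Cmod D)) by ring.
        apply Rmult_le_compat_r; [|exact Hw]. apply Rmult_le_pos; [apply pow_le; lra|apply Cmod_ge_0].
      - now apply Rmult_le_compat_l. }
    assert (H4 : r ^ 2 * (INR n * Cmod z ^ pred n * q * q) <= INR n * r ^ S n * q ^ 2).
    { replace (r ^ 2 * (INR n * Cmod z ^ pred n * q * q))
        with (r ^ 2 * (INR n * Cmod z ^ pred n) * q ^ 2) by ring.
      apply Rmult_le_compat_r; [apply pow_le; lra|exact H2]. }
    apply Rle_trans with (r * (INR n ^ 2 * r ^ n * q ^ 2) + INR n * r ^ S n * q ^ 2); [lra|].
    rewrite S_INR. simpl (r ^ S n).
    assert (0 <= r * r ^ n * q ^ 2).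
    { apply Rmult_le_pos; [|apply pow_le; lra]. apply Rmult_le_pos; [lra|apply pow_le; lra]. }
    nra.
Qed.

(** The quadratic remainders of the powers are summed with weights [n^2 |a_n| r^n], which converge
    since [r < R0]. This gives an error [O(|w - z|^2)] with a constant valid for all [|w| < r]. *)
Lemma psum_deriv (a : nat -> C) (f f' : C -> C) (R0 : R) :
  (forall z, Cmod z < R0 -> psum a z (f z)) ->
  (forall z, Cmod z < R0 -> psum (dco a) z (f' z)) ->
  forall z, Cmod z < R0 -> cderiv f z (f' z).
Proof.
  intros Hf Hf' z Hz. assert (Hz0 := Cmod_ge_0 z).
  set (r := (Cmod z + R0) / 2). assert (Hr : Cmod z < r < R0) by (unfold r; lra).
  assert (Ha : coef_bd a R0) by (apply psum_coef_bd; intros w Hw; eauto).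
  destruct (coef_bd_ex_series _ _ r (coef_bd_INR _ _ (coef_bd_INR _ _ Ha))) as [s Hs]; [lra|].
  assert (Hd : cser (fun n => RtoC (INR n) * a n * z ^ pred n)%C (f' z)).
  { specialize (Hf' z Hz). unfold psum in Hf'.
    apply (proj1 (cser_shift (fun n => RtoC (INR n) * a n * z ^ pred n)%C _)) in Hf'.
    replace (f' z) with (f' z + RtoC (INR 0) * a 0%nat * z ^ pred 0)%C by (simpl; ring).
    exact Hf'. }
  assert (Hmain : forall w, Cmod w < r ->
    r ^ 2 * Cmod (f w - f z - f' z * (w - z)) <= s * Cmod (w - z) ^ 2).
  { intros w Hw.
    assert (HS := cser_minus _ _ _ _ (cser_minus _ _ _ _ (Hf w ltac:(lra)) (Hf z Hz))
      (cser_scal (w - z)%C _ _ Hd)).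
    apply (cser_scal (RtoC (r ^ 2))) in HS.
    apply (cser_norm_le _ _ (fun n => s * 0 + Cmod (RtoC (INR n) * (RtoC (INR n) * a n)) * r ^ n * Cmod (w - z) ^ 2)
             (s * Cmod (w - z) ^ 2)) in HS.
    - rewrite Cmod_mult, Cmod_R, Rabs_pos_eq in HS by (apply pow_le; lra).
      rewrite (Cmult_comm (f' z)). exact HS.
    - intros n.
      replace (RtoC (r ^ 2) * (a n * w ^ n - a n * z ^ n - (w - z) * (RtoC (INR n) * a n * z ^ pred n)))%C
        with (a n * (RtoC (r ^ 2) * (w ^ n - z ^ n - RtoC (INR n) * z ^ pred n * (w - z))))%C by ring.
      rewrite !Cmod_mult, !Cmod_R, (Rabs_pos_eq (r ^ 2)) by (apply pow_le; lra).
      rewrite (Rabs_pos_eq (INR n)) by apply pos_INR.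
      assert (H := Cpow_second_order z w r n ltac:(lra) ltac:(lra) ltac:(lra)).
      apply Rmult_le_compat_l with (r := Cmod (a n)) in H; [|apply Cmod_ge_0].
      eapply Rle_trans; [exact H|]. right. ring.
    - apply (is_series_scal_r (Cmod (w - z) ^ 2)) in Hs.
      eapply is_series_ext; [|exact Hs]. intros n. simpl. ring. }
  assert (Hs0 : 0 <= s).
  { apply (cser_norm_le (fun _ => RtoC 0) 0 _ s) in Hs.
    - rewrite Cmod_0 in Hs. exact Hs.
    - intros n. rewrite Cmod_0. apply Rmult_le_pos; [apply Cmod_ge_0|apply pow_le; lra].
    - exact cser_zero. }
  intros eps He. assert (Hr2 : 0 < r ^ 2) by (apply pow_lt; lra).
  (* The first bound keeps [w] inside radius [r]; the second makes [s |w - z|] at most [eps r^2]. *)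
  exists (Rmin (r - Cmod z) (eps * r ^ 2 / (1 + s))). split.
  { apply Rmin_pos; [lra|]. apply Rdiv_lt_0_compat; [nra|lra]. }
  intros w Hw. assert (Hw1 := lt_Rmin_l _ _ _ Hw).
  assert (Hw2 := lt_Rmin_r _ _ _ Hw).
  assert (Hwr : Cmod w < r) by (generalize (Cmod_triangle_minus w z); lra).
  specialize (Hmain w Hwr). set (q := Cmod (w - z)) in *.
  assert (Hq : 0 <= q) by apply Cmod_ge_0.
  apply Rlt_div_r in Hw2; [|lra].
  apply Rmult_le_reg_l with (r ^ 2); [exact Hr2|]. eapply Rle_trans; [exact Hmain|].
  replace (r ^ 2 * (eps * q)) with (eps * r ^ 2 * q) by ring.
  replace (s * q ^ 2) with (q * s * q) by ring.
  apply Rmult_le_compat_r; [exact Hq|]. nra.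
Qed.

Lemma psum_C_derive (a : nat -> C) (f : C -> C) (R0 : R) :
  (forall z, Cmod z < R0 -> psum a z (f z)) ->
  forall z, Cmod z < R0 -> cderiv f z (C_derive f z) /\ psum (dco a) z (C_derive f z).
Proof.
  intros Hf z Hz.
  assert (Ha : coef_bd (dco a) R0).
  { apply coef_bd_dco, psum_coef_bd. intros w Hw; eauto. }
  assert (H := psum_deriv a f (fun z => csum (fun n => dco a n * z ^ n)%C) R0 Hf
    (fun w Hw => csum_correct _ (coef_bd_psum _ _ _ Ha Hw)) z Hz).
  rewrite (cderiv_C_derive _ _ _ H). split; [exact H|].
  exact (csum_correct _ (coef_bd_psum _ _ _ Ha Hz)).
Qed.

Lemma psum_at_0 (a : nat -> C) (l : C) : psum a 0 l -> l = a 0%nat.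
Proof.
  intros H. apply (cser_unique _ _ _ H).
  replace (a 0%nat) with (a 0%nat * 0 ^ 0)%C by (simpl; ring).
  apply (cser_single (fun n => a n * 0 ^ n)%C 0). intros [|n] Hn; [easy|]. simpl. ring.
Qed.

(** Cross-multiplied factorials keep the induction free of division; [k = 0] is the case wanted, but
    the induction shifts [k]. *)
Lemma iter_dco (a : nat -> C) (n k : nat) :
  (RtoC (INR (fact k)) * Nat.iter n dco a k = RtoC (INR (fact (k + n))) * a (k + n)%nat)%C.
Proof.
  revert k. induction n as [|n IH]; intros k.
  - simpl. now rewrite Nat.add_0_r.
  - simpl Nat.iter. unfold dco at 1. specialize (IH (S k)).
    rewrite <- (Nat.add_succ_comm k n), <- IH. change (fact (S k)) with (S k * fact k)%nat.
    rewrite mult_INR, RtoC_mult. ring.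
Qed.

(** Each iterated derivative is again a power series on the same disc, so its value at [0] is its
    constant coefficient. This is the uniqueness principle by which all coefficients are identified
    below. *)
Lemma psum_taylor (a : nat -> C) (f : C -> C) (R0 : R) (n : nat) :
  0 < R0 -> (forall z, Cmod z < R0 -> psum a z (f z)) -> taylor_coef f n = a n.
Proof.
  intros HR Hf. unfold taylor_coef.
  assert (H : forall k z, Cmod z < R0 -> psum (Nat.iter k dco a) z (Nat.iter k C_derive f z)).
  { induction k as [|k IH]; [exact Hf|]. intros z Hz. simpl.
    exact (proj2 (psum_C_derive _ _ R0 IH z Hz)). }
  specialize (H n 0). rewrite Cmod_0 in H. apply psum_at_0 in H; [|exact HR].
  rewrite H. assert (E := iter_dco a n 0). simpl in E. rewrite Cmult_1_l in E. rewrite E.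
  field. intros E0. apply RtoC_inj in E0. revert E0. apply INR_fact_neq_0.
Qed.

(** * Cauchy's integral formula *)

Lemma cderiv_inv (u : C) : u <> 0 -> cderiv (fun w => / w)%C u (- / (u * u))%C.
Proof.
  intros Hu eps He. assert (Hp : 0 < Cmod u) by now apply Cmod_gt_0.
  set (m := Cmod u) in *.
  (* [m / 2] keeps [|w| >= m / 2], so the denominator [|w| |u|^2] is at least [m^3 / 2], which the
     second bound cancels. *)
  exists (Rmin (m / 2) (eps * m ^ 3 / 2)). split.
  { apply Rmin_pos; [lra|]. assert (0 < m ^ 3) by now apply pow_lt. nra. }
  intros w Hw. assert (H1 := lt_Rmin_l _ _ _ Hw).
  assert (H2 := lt_Rmin_r _ _ _ Hw).
  assert (Hwm : m / 2 <= Cmod w).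
  { generalize (Cmod_triangle_minus u w). rewrite Cmod_minus_sym. fold m. lra. }
  assert (Hw0 : w <> 0) by (apply Cmod_gt_0; lra).
  replace (/ w - / u - - / (u * u) * (w - u))%C
    with ((w - u) * (w - u) / (w * (u * u)))%C by (field; now split).
  rewrite Cmod_div, !Cmod_mult.
  2:{ apply Cmod_gt_0. rewrite !Cmod_mult. fold m.
      repeat apply Rmult_lt_0_compat; lra. }
  fold m. set (q := Cmod (w - u)) in *. assert (Hq : 0 <= q) by apply Cmod_ge_0.
  assert (Hm2 : 0 < m * m) by nra.
  apply Rle_div_l; [apply Rmult_lt_0_compat; lra|].
  apply Rle_trans with (eps * q * (m / 2 * (m * m))).
  - replace (eps * q * (m / 2 * (m * m))) with (q * (eps * m ^ 3 / 2)) by (simpl; field).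
    apply Rmult_le_compat_l; lra.
  - apply Rmult_le_compat_l; [apply Rmult_le_pos; lra|]. apply Rmult_le_compat_r; lra.
Qed.

Lemma cderiv_pow (n : nat) (z : C) :
  cderiv (fun w => w ^ n)%C z (RtoC (INR n) * z ^ pred n)%C.
Proof.
  induction n as [|n IH].
  - apply (cderiv_ext (fun _ => 1%C) _ z 0); [reflexivity|simpl; ring|apply cderiv_const].
  - apply (cderiv_ext (fun w => w * w ^ n)%C _ z (1 * z ^ n + z * (RtoC (INR n) * z ^ pred n))%C).
    + reflexivity.
    + rewrite S_INR, RtoC_plus. destruct n as [|n]; simpl; ring.
    + apply cderiv_mult; [apply cderiv_id|exact IH].
Qed.

Definition hcont (h : R -> C) : Prop :=
  forall t, continuous (fun s => Re (h s)) t /\ continuous (fun s => Im (h s)) t.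

Lemma hcont_Re (h : R -> C) : hcont h -> forall t, continuous (fun s => Re (h s)) t.
Proof. intros H t. exact (proj1 (H t)). Qed.

Lemma hcont_Im (h : R -> C) : hcont h -> forall t, continuous (fun s => Im (h s)) t.
Proof. intros H t. exact (proj2 (H t)). Qed.

Lemma rderiv_hcont (h h' : R -> C) : (forall t, rderiv h t (h' t)) -> hcont h.
Proof.
  intros H t. split; apply (ex_derive_continuous (K := R_AbsRing) (V := R_NormedModule)).
  - eexists. apply rderiv_Re, H.
  - eexists. apply rderiv_Im, H.
Qed.

Lemma hcont_mult (h k : R -> C) : hcont h -> hcont k -> hcont (fun t => h t * k t)%C.
Proof.
  intros Hh Hk t. destruct (Hh t) as [A B], (Hk t) as [A' B'].
  split; simpl.
  - apply (continuous_minus (V := R_NormedModule)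
      (fun s => Re (h s) * Re (k s)) (fun s => Im (h s) * Im (k s)));
    apply (continuous_mult (K := R_AbsRing)); assumption.
  - apply (continuous_plus (V := R_NormedModule)
      (fun s => Re (h s) * Im (k s)) (fun s => Im (h s) * Re (k s)));
    apply (continuous_mult (K := R_AbsRing)); assumption.
Qed.

Lemma hcont_const (c : C) : hcont (fun _ => c).
Proof. intros t. split; apply continuous_const. Qed.

Lemma hcont_pow (h : R -> C) (n : nat) : hcont h -> hcont (fun t => h t ^ n)%C.
Proof.
  intros H. induction n as [|n IH]; [apply (hcont_const 1)|]. apply (hcont_mult _ _ H IH).
Qed.

Lemma continuous_ex_RInt (u : R -> R) (a b : R) :
  (forall t, continuous u t) -> ex_RInt u a b.
Proof.
  intros H. apply (ex_RInt_continuous (V := R_CompleteNormedModule)). intros t _. apply H.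
Qed.

(** For [h t = F (circ r t)] this is the contour integral of [F w / w] over the circle, divided by
    [2 PI i]. *)
Definition cmean (h : R -> C) : C :=
  (RInt (fun t => Re (h t)) 0 (2 * PI) / (2 * PI),
   RInt (fun t => Im (h t)) 0 (2 * PI) / (2 * PI)).

Lemma cmean_ext (h k : R -> C) : (forall t, h t = k t) -> cmean h = cmean k.
Proof.
  intros E. unfold cmean. f_equal; f_equal; apply RInt_ext; intros t _; now rewrite E.
Qed.

Lemma cmean_minus (h k : R -> C) :
  hcont h -> hcont k -> cmean (fun t => h t - k t)%C = (cmean h - cmean k)%C.
Proof.
  intros Hh Hk. assert (P := PI_RGT_0).
  unfold cmean, Cminus, Cplus, Copp; simpl.
  f_equal; rewrite <- Rdiv_opp_l, <- Rdiv_plus_distr; f_equal.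
  - apply (RInt_minus (V := R_CompleteNormedModule) (fun t => Re (h t)) (fun t => Re (k t)));
    apply continuous_ex_RInt; apply hcont_Re; assumption.
  - apply (RInt_minus (V := R_CompleteNormedModule) (fun t => Im (h t)) (fun t => Im (k t)));
    apply continuous_ex_RInt; apply hcont_Im; assumption.
Qed.

Lemma cmean_scal (c : C) (h : R -> C) :
  hcont h -> cmean (fun t => c * h t)%C = (c * cmean h)%C.
Proof.
  intros Hh. assert (P := PI_RGT_0).
  assert (E1 := continuous_ex_RInt (fun t => Re (h t)) 0 (2 * PI) (fun t => proj1 (Hh t))).
  assert (E2 := continuous_ex_RInt (fun t => Im (h t)) 0 (2 * PI) (fun t => proj2 (Hh t))).
  apply (RInt_correct (V := R_CompleteNormedModule)) in E1, E2. destruct c as [x y].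
  unfold cmean, Cmult; simpl. f_equal.
  - match goal with |- _ = ?x * (?A / ?d) - ?y * (?B / ?d) =>
      replace (x * (A / d) - y * (B / d)) with ((x * A - y * B) / d) by (field; lra) end.
    f_equal. apply is_RInt_unique.
    apply (is_RInt_minus (V := R_NormedModule) (fun t => x * Re (h t)) (fun t => y * Im (h t)));
    apply (is_RInt_scal (V := R_NormedModule)); assumption.
  - match goal with |- _ = ?x * (?A / ?d) + ?y * (?B / ?d) =>
      replace (x * (A / d) + y * (B / d)) with ((x * A + y * B) / d) by (field; lra) end.
    f_equal. apply is_RInt_unique.
    apply (is_RInt_plus (V := R_NormedModule) (fun t => x * Im (h t)) (fun t => y * Re (h t)));
    apply (is_RInt_scal (V := R_NormedModule)); assumption.
Qed.

Lemma cmean_const (c : C) : cmean (fun _ => c) = c.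
Proof.
  assert (P := PI_RGT_0). destruct c as [x y]. unfold cmean; simpl.
  rewrite !RInt_const. unfold scal; simpl; unfold mult; simpl. f_equal; field; lra.
Qed.

(** Testing against the conjugate of the mean reduces to one real integral and keeps the constant
    [1]; bounding the two components separately would lose a factor. *)
Lemma cmean_bound (h : R -> C) (M : R) :
  hcont h -> (forall t, 0 <= t <= 2 * PI -> Cmod (h t) <= M) -> Cmod (cmean h) <= M.
Proof.
  intros Hh HM. assert (P := PI_RGT_0). set (m := cmean h).
  assert (Hc : hcont (fun t => Cconj m * h t)%C) by now apply hcont_mult, Hh; apply hcont_const.
  assert (E : Re (cmean (fun t => Cconj m * h t)%C) = Cmod m ^ 2).
  { rewrite cmean_scal by exact Hh. fold m. rewrite Cmult_comm, <- Cmod2_conj. reflexivity. }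
  assert (H : Cmod m ^ 2 <= Cmod m * M).
  { rewrite <- E. unfold cmean at 1. unfold Re at 1. unfold fst at 1. apply Rle_div_l; [lra|].
    replace (Cmod m * M * (2 * PI)) with (RInt (fun _ => Cmod m * M) 0 (2 * PI)).
    - apply RInt_le; [lra| | |].
      + apply continuous_ex_RInt. exact (hcont_Re _ Hc).
      + apply continuous_ex_RInt. intros t. apply continuous_const.
      + intros t Ht. eapply Rle_trans; [apply Rle_abs|]. eapply Rle_trans; [apply re_le_Cmod|].
        rewrite Cmod_mult, Cmod_conj. apply Rmult_le_compat_l; [apply Cmod_ge_0|].
        apply HM. lra.
    - rewrite RInt_const. unfold scal; simpl; unfold mult; simpl. ring. }
  assert (H0 := Cmod_ge_0 m). destruct (Req_dec (Cmod m) 0) as [E0|Hne].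
  - rewrite E0. eapply Rle_trans; [apply Cmod_ge_0|apply (HM 0); lra].
  - apply Rmult_le_reg_l with (Cmod m); [lra|]. simpl in H. lra.
Qed.

Lemma RInt_Re_periodic (p p' : R -> C) (a b : R) :
  (forall t, rderiv p t (p' t)) -> (forall t, continuous (fun s => Re (p' s)) t) ->
  p a = p b -> RInt (fun t => Re (p' t)) a b = 0.
Proof.
  intros Hd Hc E. apply is_RInt_unique.
  assert (H : is_RInt (fun t => Re (p' t)) a b (minus (Re (p b)) (Re (p a)))).
  { apply (is_RInt_derive (V := R_CompleteNormedModule) (fun t => Re (p t))).
    - intros t _. apply rderiv_Re, Hd.
    - intros t _. apply Hc. }
  rewrite E in H. change (is_RInt (fun t => Re (p' t)) a b (Re (p b) - Re (p b))) in H.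
  rewrite Rminus_diag in H. exact H.
Qed.

Lemma Im_Re_Ci (c : C) : Im c = Re (- Ci * c)%C.
Proof. destruct c; simpl; ring. Qed.

Lemma cmean_derivative (p p' : R -> C) :
  (forall t, rderiv p t (p' t)) -> hcont p' -> p 0 = p (2 * PI) -> cmean p' = 0.
Proof.
  intros Hd Hc E. unfold cmean.
  assert (H1 : RInt (fun t => Re (p' t)) 0 (2 * PI) = 0).
  { apply (RInt_Re_periodic p); [exact Hd| |exact E]. exact (hcont_Re _ Hc). }
  assert (H2 : RInt (fun t => Im (p' t)) 0 (2 * PI) = 0).
  { transitivity (RInt (fun t => Re (- Ci * p' t)%C) 0 (2 * PI)).
    { apply RInt_ext. intros t _. apply Im_Re_Ci. }
    apply (RInt_Re_periodic (fun t => - Ci * p t)%C (fun t => - Ci * p' t)%C).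
    - intros t. apply rderiv_scal, Hd.
    - exact (hcont_Re _ (hcont_mult (fun _ => - Ci)%C p' (hcont_const _) Hc)).
    - now rewrite E. }
  rewrite H1, H2, Rdiv_0_l. reflexivity.
Qed.

Definition circ (r t : R) : C := (r * cos t, r * sin t).

Lemma circ_rderiv (r t : R) : rderiv (circ r) t (Ci * circ r t)%C.
Proof.
  apply rderiv_of_components; unfold circ, Ci, Cmult; simpl; auto_derive; trivial; ring.
Qed.

Lemma Cmod_circ (r t : R) : 0 <= r -> Cmod (circ r t) = r.
Proof.
  intros Hr. unfold Cmod, circ; simpl.
  replace (r * cos t * (r * cos t * 1) + r * sin t * (r * sin t * 1))
    with (r ^ 2 * ((sin t)² + (cos t)²)) by (unfold Rsqr; ring).
  rewrite sin2_cos2, Rmult_1_r. now apply sqrt_pow2.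
Qed.

(** The inverse of [circ r t] for [r > 0], written as a circle run backwards so that its modulus and
    derivative are immediate. *)
Definition icirc (r t : R) : C := circ (/ r) (- t).

Lemma icirc_rderiv (r t : R) : rderiv (icirc r) t (- Ci * icirc r t)%C.
Proof.
  apply rderiv_of_components; unfold icirc, circ, Ci, Cmult, Copp; simpl;
    auto_derive; trivial; ring.
Qed.

Lemma icirc_circ (r t : R) : 0 < r -> (icirc r t * circ r t)%C = 1.
Proof.
  intros Hr. unfold icirc, circ, Cmult, RtoC; simpl. rewrite cos_neg, sin_neg. f_equal.
  - transitivity ((sin t)² + (cos t)²); [unfold Rsqr; field; lra|apply sin2_cos2].
  - field. lra.
Qed.

Lemma circ_hcont (r : R) : hcont (circ r).
Proof. apply (rderiv_hcont _ _ (circ_rderiv r)). Qed.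

Lemma icirc_hcont (r : R) : hcont (icirc r).
Proof. apply (rderiv_hcont _ _ (icirc_rderiv r)). Qed.

Lemma cmean_icirc_pow (r : R) (n : nat) : (0 < n)%nat -> cmean (fun t => icirc r t ^ n)%C = 0.
Proof.
  intros Hn. assert (Hn0 : RtoC (INR n) <> 0).
  { intros E. apply RtoC_inj in E. apply lt_INR in Hn. simpl in Hn. lra. }
  assert (HCi : (Ci * Ci = - (1))%C) by (unfold Ci, Cmult, Copp, RtoC; simpl; f_equal; ring).
  (* [icirc] has derivative [- Ci * icirc], so the factor [Ci / n] makes this function a periodic
     primitive of [icirc ^ n]. *)
  apply (cmean_derivative (fun t => Ci / RtoC (INR n) * icirc r t ^ n)%C).
  - intros t.
    replace (icirc r t ^ n)%C with
      (Ci / RtoC (INR n) * (RtoC (INR n) * icirc r t ^ pred n * (- Ci * icirc r t)))%C.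
    + apply rderiv_scal.
      apply (rderiv_comp (fun w => w ^ n)%C); [apply cderiv_pow|apply icirc_rderiv].
    + destruct n as [|n]; [lia|]. simpl pred. simpl Cpow.
      transitivity (- (Ci * Ci) * (icirc r t * icirc r t ^ n))%C; [now field|].
      rewrite HCi. ring.
  - apply hcont_pow, icirc_hcont.
  - do 2 f_equal. unfold icirc, circ.
    rewrite !cos_neg, !sin_neg, cos_2PI, sin_2PI, cos_0, sin_0. reflexivity.
Qed.

Section Cauchy.

Variables (f f' : C -> C) (R0 r : R) (z : C).
Hypothesis Hf : forall w, Cmod w < R0 -> cderiv f w (f' w).
Hypothesis Hf' : forall w, Cmod w < R0 -> ccont f' w.
Hypothesis Hr : 0 < r < R0.
Hypothesis Hz : Cmod z < r.

(** With [w = circ r t] this is [w / (w - z)]: the Cauchy kernel, written against [dt] instead of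
    [dw]. *)
Let k (t : R) : C := (/ (1 - z * icirc r t))%C.
(** The homotopy that contracts the circle ([s = 1]) to the point [z] ([s = 0]) along segments. *)
Let gam (s t : R) : C := (z + RtoC s * (circ r t - z))%C.

Local Lemma kernel_den (t : R) : 1 - Cmod z / r <= Cmod (1 - z * icirc r t).
Proof.
  assert (H := Cmod_triangle_minus 1 (z * icirc r t)%C).
  rewrite Cmod_1, Cmod_mult in H. unfold icirc in *.
  rewrite Cmod_circ in H by (apply Rlt_le, Rinv_0_lt_compat; lra). unfold Rdiv. lra.
Qed.

Local Lemma kernel_den_pos : 0 < 1 - Cmod z / r.
Proof. assert (Cmod z / r < 1) by (apply Rlt_div_l; lra). lra. Qed.

Local Lemma kernel_den_neq (t : R) : (1 - z * icirc r t)%C <> 0.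
Proof.
  apply Cmod_gt_0. eapply Rlt_le_trans; [apply kernel_den_pos|apply kernel_den].
Qed.

Local Lemma kernel_hcont : hcont k.
Proof.
  eapply rderiv_hcont. intros t.
  apply (rderiv_comp (fun w => / w)%C (fun s => 1 - z * icirc r s)%C).
  - apply cderiv_inv, kernel_den_neq.
  - assert (H := rderiv_comp (fun w => 1 + (- z) * w)%C (icirc r) t (- z * 1)%C _
      (cderiv_comp_affine (fun w => w) 1 (- z)%C _ _ (cderiv_id _)) (icirc_rderiv r t)).
    intros eps He. destruct (H eps He) as [d [Hd Hs]]. exists d. split; [exact Hd|].
    intros s Hsd. specialize (Hs s Hsd). cbv beta in Hs.
    replace (1 - z * icirc r s - (1 - z * icirc r t))%C
      with (1 + - z * icirc r s - (1 + - z * icirc r t))%C by ring. exact Hs.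
Qed.

(** Differentiating in [s] at the ends of [[0, 1]] needs parameters slightly outside it. As
    [|circ r t - z| <= 2 r], an excess below [(R0 - r) / (2 r)] moves the point by less than
    [R0 - r]. *)
Local Lemma gam_bound (s0 s t : R) :
  0 <= s0 <= 1 -> Rabs (s - s0) < (R0 - r) / (2 * r) -> Cmod (gam s t) < R0.
Proof.
  intros Hs0 Hs. assert (Hc := Cmod_circ r t ltac:(lra)).
  assert (H0 : Cmod (gam s0 t) <= r) by (apply Cmod_segment; [exact Hs0|lra|lra]).
  assert (H1 : Cmod (circ r t - z) <= 2 * r).
  { eapply Rle_trans; [apply Cmod_sub_le|]. lra. }
  replace (gam s t) with (gam s0 t + RtoC (s - s0) * (circ r t - z))%C
    by (unfold gam; rewrite RtoC_minus; ring).
  eapply Rle_lt_trans; [apply Cmod_triangle|]. rewrite Cmod_mult, Cmod_R.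
  apply Rlt_div_r in Hs; [|lra].
  assert (H2 := Rabs_pos (s - s0)). assert (H3 := Cmod_ge_0 (circ r t - z)). nra.
Qed.

Local Lemma gam_cont (s0 t0 eps : R) : 0 <= s0 <= 1 -> 0 < eps ->
  exists d, 0 < d /\ forall s t, Rabs (s - s0) < d -> Rabs (t - t0) < d ->
    Cmod (gam s t - gam s0 t0) < eps.
Proof.
  intros Hs0 He. destruct (circ_rderiv r t0 1) as [d [Hd Hc]]; [lra|].
  assert (Hq : 0 < eps / (4 * (1 + r))) by (apply Rdiv_lt_0_compat; lra).
  exists (Rmin d (eps / (4 * (1 + r)))). split; [now apply Rmin_pos|].
  intros s t Hs Ht.
  specialize (Hc t (lt_Rmin_l _ _ _ Ht)).
  apply (fun H => lt_Rmin_r _ _ _ H) in Hs.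
  apply (fun H => lt_Rmin_r _ _ _ H) in Ht.
  replace (gam s t - gam s0 t0)%C
    with (RtoC (s - s0) * (circ r t - z) + RtoC s0 * (circ r t - circ r t0))%C
    by (unfold gam; rewrite RtoC_minus; ring).
  assert (Hc1 : Cmod (circ r t - circ r t0) <= (1 + r) * Rabs (t - t0)).
  { assert (H := Cmod_triangle_minus (circ r t - circ r t0) (Ci * circ r t0 * RtoC (t - t0))).
    rewrite !Cmod_mult, Cmod_Ci, Cmod_R, Cmod_circ in H by lra. lra. }
  assert (H1 : Cmod (circ r t - z) <= 2 * (1 + r)).
  { eapply Rle_trans; [apply Cmod_sub_le|]. rewrite Cmod_circ; lra. }
  eapply Rle_lt_trans; [apply Cmod_triangle|]. rewrite !Cmod_mult, !Cmod_R, (Rabs_pos_eq s0) by lra.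
  apply Rlt_div_r in Hs; [|lra]. apply Rlt_div_r in Ht; [|lra].
  assert (H2 := Rabs_pos (s - s0)). assert (H3 := Cmod_ge_0 (circ r t - z)).
  assert (H4 := Cmod_ge_0 (circ r t - circ r t0)).
  apply Rle_lt_trans with (Rabs (s - s0) * (2 * (1 + r)) + 1 * ((1 + r) * Rabs (t - t0))); [|lra].
  apply Rplus_le_compat; [now apply Rmult_le_compat_l|]. apply Rmult_le_compat; lra.
Qed.

Local Lemma gam_in (s t : R) : 0 <= s <= 1 -> Cmod (gam s t) < R0.
Proof.
  intros Hs. apply (gam_bound s); [exact Hs|]. rewrite Rminus_diag, Rabs_R0.
  apply Rdiv_lt_0_compat; lra.
Qed.

(** Joint continuity is the condition for differentiating under the integral sign; this is where
    continuity of [f'] enters. *)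
Local Lemma integrand_2d (s0 t0 : R) : 0 <= s0 <= 1 ->
  continuity_2d_pt (fun s t => Re (f' (gam s t) * circ r t)%C) s0 t0.
Proof.
  intros Hs0.
  assert (Hc : forall eps, 0 < eps -> exists d, 0 < d /\ forall s t,
     Rabs (s - s0) < d -> Rabs (t - t0) < d -> Cmod (f' (gam s t) - f' (gam s0 t0)) < eps).
  { intros eps He. destruct (Hf' _ (gam_in s0 t0 Hs0) eps He) as [e [He' Hw]].
    destruct (gam_cont s0 t0 e Hs0 He') as [d [Hd H]]. exists d. split; [exact Hd|].
    intros s t Hs Ht. now apply Hw, H. }
  assert (Hcirc := circ_hcont r).
  simpl. apply continuity_2d_pt_minus; apply continuity_2d_pt_mult.
  - intros eps. destruct (Hc eps (cond_pos eps)) as [d [Hd H]]. exists (mkposreal d Hd).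
    intros s t Hs Ht. eapply Rle_lt_trans; [|apply (H s t Hs Ht)].
    eapply Rle_trans; [|apply re_le_Cmod]. apply Rle_refl.
  - apply (continuity_1d_2d_pt_comp (fun t => r * cos t) (fun _ t => t));
      [|apply continuity_2d_pt_id2].
    apply continuity_pt_filterlim. apply (Hcirc t0).
  - intros eps. destruct (Hc eps (cond_pos eps)) as [d [Hd H]]. exists (mkposreal d Hd).
    intros s t Hs Ht. eapply Rle_lt_trans; [|apply (H s t Hs Ht)].
    eapply Rle_trans; [|apply im_le_Cmod]. apply Rle_refl.
  - apply (continuity_1d_2d_pt_comp (fun t => r * sin t) (fun _ t => t));
      [|apply continuity_2d_pt_id2].
    apply continuity_pt_filterlim. apply (Hcirc t0).
Qed.

Local Lemma integrand_1d (s0 t0 : R) : 0 <= s0 <= 1 ->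
  continuous (fun t => Re (f' (gam s0 t) * circ r t)%C) t0.
Proof.
  intros Hs0. apply filterlim_locally. intros eps.
  destruct (integrand_2d s0 t0 Hs0 eps) as [d H]. exists d. intros t Ht.
  apply (H s0 t); [rewrite Rminus_diag, Rabs_R0; apply cond_pos|exact Ht].
Qed.

(** The velocity [circ r t - z] of the homotopy cancels the pole of the kernel, so the
    [s]-derivative of the integrand is just [f' (gam s t) * circ r t]. *)
Local Lemma kernel_mult (t : R) : (k t * (circ r t - z))%C = circ r t.
Proof.
  assert (E := icirc_circ r t (proj1 Hr)). assert (Hn := kernel_den_neq t).
  replace (circ r t - z)%C with ((1 - z * icirc r t) * circ r t)%C.
  - unfold k. now field.
  - transitivity (circ r t - z * (icirc r t * circ r t))%C; [ring|]. rewrite E. ring.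
Qed.

Local Lemma integrand_deriv (s0 s t : R) :
  0 <= s0 <= 1 -> Rabs (s - s0) < (R0 - r) / (2 * r) ->
  is_derive (fun u => Re (k t * f (gam u t))%C) s (Re (f' (gam s t) * circ r t)%C).
Proof.
  intros Hs0 Hs.
  assert (E : (f' (gam s t) * circ r t = k t * (f' (gam s t) * (circ r t - z)))%C).
  { transitivity (f' (gam s t) * (k t * (circ r t - z)))%C; [now rewrite kernel_mult|ring]. }
  rewrite E.
  apply rderiv_Re, rderiv_scal, rderiv_comp; [|apply rderiv_segment].
  apply Hf. now apply (gam_bound s0).
Qed.

Local Lemma gam_rderiv_t (s t : R) :
  rderiv (fun u => gam s u) t (RtoC s * (Ci * circ r t))%C.
Proof.
  intros eps He. destruct (rderiv_scal (RtoC s) _ _ _ (circ_rderiv r t) eps He) as [d [Hd H]].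
  exists d. split; [exact Hd|]. intros u Hu. specialize (H u Hu).
  replace (gam s u - gam s t)%C with (RtoC s * circ r u - RtoC s * circ r t)%C
    by (unfold gam; ring). exact H.
Qed.

(** Up to the factor [- Ci / s], the integrand is the [t]-derivative of the periodic function
    [f (gam s t)]. The value [s = 0] is excluded, but the mean value theorem asks for derivatives
    only inside the interval. *)
Local Lemma integrand_int0 (s : R) : 0 < s <= 1 ->
  RInt (fun t => Re (f' (gam s t) * circ r t)%C) 0 (2 * PI) = 0.
Proof.
  intros Hs. assert (Hs0 : RtoC s <> 0) by (apply RtoC_neq_0; lra).
  assert (HCi : (Ci * Ci = - (1))%C) by (unfold Ci, Cmult, Copp, RtoC; simpl; f_equal; ring).
  apply (RInt_Re_periodic (fun t => - Ci / RtoC s * f (gam s t))%C).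
  - intros t.
    replace (f' (gam s t) * circ r t)%C
      with (- Ci / RtoC s * (f' (gam s t) * (RtoC s * (Ci * circ r t))))%C.
    + apply rderiv_scal, rderiv_comp; [apply Hf, gam_in; lra|apply gam_rderiv_t].
    + transitivity (- (Ci * Ci) * (f' (gam s t) * circ r t))%C; [now field|].
      rewrite HCi. ring.
  - intros t. apply integrand_1d. lra.
  - unfold gam, circ. now rewrite cos_2PI, sin_2PI, cos_0, sin_0.
Qed.

Local Lemma gam_hcont_near (s0 s : R) : 0 <= s0 <= 1 -> Rabs (s - s0) < (R0 - r) / (2 * r) ->
  hcont (fun t => k t * f (gam s t))%C.
Proof.
  intros Hs0 Hs. apply hcont_mult; [apply kernel_hcont|].
  eapply rderiv_hcont. intros t. apply rderiv_comp; [|apply gam_rderiv_t].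
  apply Hf. now apply (gam_bound s0).
Qed.

(** The integral of [k t * f (gam s t)] does not depend on [s]: differentiating
    in [s] turns the integrand into a [t]-derivative of a periodic function. *)
Local Lemma cauchy_Re :
  RInt (fun t => Re (k t * f (circ r t))%C) 0 (2 * PI) =
  RInt (fun t => Re (k t * f z)%C) 0 (2 * PI).
Proof.
  set (F := fun s => RInt (fun t => Re (k t * f (gam s t))%C) 0 (2 * PI)).
  assert (Hd0 : 0 < (R0 - r) / (2 * r)) by (apply Rdiv_lt_0_compat; lra).
  assert (HF : forall s, 0 <= s <= 1 ->
    is_derive F s (RInt (fun t => Re (f' (gam s t) * circ r t)%C) 0 (2 * PI))).
  { intros s Hs.
    assert (E : forall t, Derive (fun u => Re (k t * f (gam u t))%C) s
      = Re (f' (gam s t) * circ r t)%C).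
    { intros t. apply is_derive_unique, (integrand_deriv s); [exact Hs|].
      now rewrite Rminus_diag, Rabs_R0. }
    rewrite <- (RInt_ext (fun t => Derive (fun u => Re (k t * f (gam u t))%C) s))
      by (intros t _; apply E).
    apply (is_derive_RInt_param (fun s t => Re (k t * f (gam s t))%C)).
    - exists (mkposreal _ Hd0). intros u Hu t _. eexists. apply (integrand_deriv s); assumption.
    - intros t _. apply (continuity_2d_pt_ext_loc (fun s t => Re (f' (gam s t) * circ r t)%C)).
      + exists (mkposreal _ Hd0). intros u v Hu _. symmetry.
        apply is_derive_unique, (integrand_deriv s); assumption.
      + now apply integrand_2d.
    - exists (mkposreal _ Hd0). intros u Hu. apply continuous_ex_RInt. intros t.
      exact (hcont_Re _ (gam_hcont_near s u Hs Hu) t). }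
  assert (E1 : F 1 = RInt (fun t => Re (k t * f (circ r t))%C) 0 (2 * PI)).
  { apply RInt_ext. intros t _. do 3 f_equal. unfold gam. ring. }
  assert (E0 : F 0 = RInt (fun t => Re (k t * f z)%C) 0 (2 * PI)).
  { apply RInt_ext. intros t _. do 3 f_equal. unfold gam. ring. }
  rewrite <- E1, <- E0.
  destruct (MVT_gen F 0 1 (fun _ => 0)) as [c [_ Hc]].
  - intros s Hs. rewrite Rmin_left, Rmax_right in Hs by lra.
    rewrite <- (integrand_int0 s) by lra. apply HF. lra.
  - intros s Hs. rewrite Rmin_left, Rmax_right in Hs by lra.
    apply derivable_continuous_pt. eexists. apply is_derive_Reals, HF, Hs.
  - lra.
Qed.

End Cauchy.

(** The identity on real parts, applied to [f] and to [- Ci * f], gives both components. *)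
Lemma cauchy_kernel (f f' : C -> C) (R0 r : R) (z : C) :
  (forall w, Cmod w < R0 -> cderiv f w (f' w)) ->
  (forall w, Cmod w < R0 -> ccont f' w) ->
  0 < r < R0 -> Cmod z < r ->
  cmean (fun t => / (1 - z * icirc r t) * f (circ r t))%C =
  cmean (fun t => / (1 - z * icirc r t) * f z)%C.
Proof.
  intros Hf Hf' Hr Hz. unfold cmean.
  rewrite (cauchy_Re f f' R0 r z Hf Hf' Hr Hz).
  assert (H := cauchy_Re (fun w => - Ci * f w)%C (fun w => - Ci * f' w)%C R0 r z).
  assert (E : forall t w, Re (/ (1 - z * icirc r t) * (- Ci * w))%C
    = Im (/ (1 - z * icirc r t) * w)%C).
  { intros t w. rewrite Im_Re_Ci. f_equal. ring. }
  f_equal. f_equal.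
  transitivity (RInt (fun t => Re (/ (1 - z * icirc r t) * (- Ci * f (circ r t)))%C) 0 (2 * PI)).
  { apply RInt_ext. intros t _. symmetry. apply E. }
  transitivity (RInt (fun t => Re (/ (1 - z * icirc r t) * (- Ci * f z))%C) 0 (2 * PI));
    [|apply RInt_ext; intros t _; apply E].
  apply H; [clear H..|exact Hr|exact Hz].
  - intros w Hw. now apply cderiv_scal, Hf.
  - intros w Hw eps He. destruct (Hf' w Hw eps He) as [d [Hd Hc]]. exists d. split; [exact Hd|].
    intros v Hv. replace (- Ci * f' v - - Ci * f' w)%C with (- Ci * (f' v - f' w))%C by ring.
    rewrite Cmod_mult, Cmod_opp, Cmod_Ci, Rmult_1_l. now apply Hc.
Qed.

(** The extreme value theorem is applied to the real function [|h|^2]; from [x^2 <= B] follows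
    [x <= 1 + B], which avoids a square root. *)
Lemma hcont_bounded (h : R -> C) (a b : R) : a <= b -> hcont h ->
  exists M, forall t, a <= t <= b -> Cmod (h t) <= M.
Proof.
  intros Hab Hh.
  assert (Hcc : hcont (fun t => Cconj (h t))).
  { intros t. split; [exact (hcont_Re _ Hh t)|].
    exact (continuous_opp (V := R_NormedModule) (fun s => Im (h s)) t (hcont_Im _ Hh t)). }
  assert (Hc := hcont_mult h _ Hh Hcc).
  destruct (continuity_ab_maj (fun t => Re (h t * Cconj (h t))%C) a b Hab) as [m [Hm _]].
  - intros t _. apply continuity_pt_filterlim. exact (hcont_Re _ Hc t).
  - set (B := Re (h m * Cconj (h m))%C) in *. exists (1 + B). intros t Ht. specialize (Hm t Ht).
    rewrite <- Cmod2_conj in Hm. change (Cmod (h t) ^ 2 <= B) in Hm.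
    assert (H0 := Cmod_ge_0 (h t)). nra.
Qed.

(** A geometric expansion with exact remainder [z^(N+1)] times the mean of [k h icirc^(N+1)]. It
    decays like [(|z| / r)^(N+1)], so no interchange of sum and integral is needed. *)
Lemma cmean_kernel_series (h : R -> C) (r : R) (z : C) :
  hcont h -> 0 < r -> Cmod z < r ->
  cser (fun n => cmean (fun t => h t * icirc r t ^ n) * z ^ n)%C
       (cmean (fun t => / (1 - z * icirc r t) * h t)%C).
Proof.
  intros Hh Hr Hz. assert (P := PI_RGT_0). assert (Hz0 := Cmod_ge_0 z).
  set (k := fun t => (/ (1 - z * icirc r t))%C).
  assert (Hk : hcont k) by (apply kernel_hcont with (R0 := r + 1); lra).
  assert (Hp : forall n, hcont (fun t => icirc r t ^ n)%C) by (intros n; apply hcont_pow, icirc_hcont).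
  assert (Hhp : forall n, hcont (fun t => h t * icirc r t ^ n)%C)
    by (intros n; exact (hcont_mult _ _ Hh (Hp n))).
  assert (Hkh : hcont (fun t => k t * h t)%C) by exact (hcont_mult _ _ Hk Hh).
  assert (Hkhp : forall n, hcont (fun t => k t * h t * icirc r t ^ n)%C)
    by (intros n; exact (hcont_mult _ _ Hkh (Hp n))).
  assert (Hn := kernel_den_neq (r + 1) r z ltac:(lra) Hz).
  assert (HR : forall N, (cmean (fun t => k t * h t)
      - csum_n (fun n => cmean (fun t => h t * icirc r t ^ n) * z ^ n) N
      = z ^ S N * cmean (fun t => k t * h t * icirc r t ^ S N))%C).
  { assert (Hterm : forall n, (cmean (fun t => h t * icirc r t ^ n) * z ^ n)%C
      = cmean (fun t => z ^ n * (h t * icirc r t ^ n))%C).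
    { intros n. rewrite cmean_scal; [apply Cmult_comm|apply Hhp]. }
    assert (Hstep : forall n, (z ^ n * cmean (fun t => k t * h t * icirc r t ^ n)
      - cmean (fun t => h t * icirc r t ^ n) * z ^ n
      = z ^ S n * cmean (fun t => k t * h t * icirc r t ^ S n))%C).
    { intros n. rewrite Hterm, <- !cmean_scal by apply Hkhp. rewrite <- cmean_minus.
      - apply cmean_ext. intros t. unfold k. simpl. specialize (Hn t). now field.
      - exact (hcont_mult _ _ (hcont_const _) (Hkhp n)).
      - exact (hcont_mult _ _ (hcont_const _) (Hhp n)). }
    induction N as [|N IH].
    - rewrite sum_O, <- Hstep. f_equal. simpl Cpow at 2. rewrite Cmult_1_l. apply cmean_ext.
      intros t. simpl. ring.
    - rewrite sum_Sn, <- Hstep, <- IH.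
      change (plus ?a ?b) with (a + b)%C. ring. }
  destruct (hcont_bounded (fun t => k t * h t)%C 0 (2 * PI)) as [M HM]; [lra|exact Hkh|].
  assert (HM0 : 0 <= M) by (eapply Rle_trans; [apply Cmod_ge_0|apply (HM 0); lra]).
  assert (Hq : 0 <= Cmod z / r < 1).
  { split; [apply Rle_div_r; lra|apply Rlt_div_l; lra]. }
  apply cser_eps. intros eps He.
  destruct (pow_lt_1_zero (Cmod z / r) ltac:(rewrite Rabs_pos_eq; lra) (eps / (1 + M)))
    as [N HN]; [apply Rdiv_lt_0_compat; lra|].
  exists N. intros n HnN. rewrite Cmod_minus_sym. fold k.
  change (Cmod (cmean (fun t => k t * h t)
      - csum_n (fun n => cmean (fun t => h t * icirc r t ^ n) * z ^ n) n)%C < eps).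
  rewrite HR, Cmod_mult, Cmod_pow.
  assert (HB : Cmod (cmean (fun t => k t * h t * icirc r t ^ S n)%C) <= M * (/ r) ^ S n).
  { apply cmean_bound.
    - apply Hkhp.
    - intros t Ht. rewrite Cmod_mult, Cmod_pow. unfold icirc.
      rewrite Cmod_circ by (apply Rlt_le, Rinv_0_lt_compat, Hr).
      apply Rmult_le_compat_r; [apply pow_le, Rlt_le, Rinv_0_lt_compat, Hr|now apply HM]. }
  specialize (HN (S n) ltac:(lia)). rewrite Rabs_pos_eq in HN by (apply pow_le; lra).
  apply Rlt_div_r in HN; [|lra].
  assert (Hq' : 0 <= (Cmod z / r) ^ S n) by (apply pow_le; lra).
  apply Rle_lt_trans with ((Cmod z / r) ^ S n * M); [|lra].
  unfold Rdiv. rewrite Rpow_mult_distr, Rmult_assoc, (Rmult_comm _ M).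
  apply Rmult_le_compat_l; [now apply pow_le|exact HB].
Qed.

(** In the kernel series of the constant [1], every term with [n > 0] has mean zero. *)
Lemma cmean_kernel (r : R) (z : C) : 0 < r -> Cmod z < r ->
  cmean (fun t => / (1 - z * icirc r t))%C = 1.
Proof.
  intros Hr Hz. assert (H := cmean_kernel_series (fun _ => 1) r z (hcont_const _) Hr Hz).
  rewrite (cmean_ext _ (fun t => / (1 - z * icirc r t))%C) in H by (intros t; ring).
  apply (cser_unique _ _ _ H).
  assert (E : (cmean (fun t => 1 * icirc r t ^ 0) * z ^ 0)%C = 1).
  { rewrite (cmean_ext _ (fun _ => 1)) by (intros t; simpl; ring). rewrite cmean_const. simpl. ring. }
  assert (HS := cser_single (fun n => cmean (fun t => 1 * icirc r t ^ n) * z ^ n)%C 0).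
  cbv beta in HS. rewrite E in HS. apply HS. intros n Hn. rewrite (cmean_ext _ (fun t => icirc r t ^ n)%C) by (intros t; ring).
  rewrite cmean_icirc_pow by lia. ring.
Qed.

(** Continuity of the derivative is part of the notion because the proof of Cauchy's formula
    differentiates under the integral. *)
Definition holo (R0 : R) (f f' : C -> C) : Prop :=
  forall w, Cmod w < R0 -> cderiv f w (f' w) /\ ccont f' w.

(** Cauchy's formula followed by the geometric expansion of its kernel; the coefficients are the
    usual integrals of [f w / w^(n+1)]. *)
Lemma holo_circle_psum (f f' : C -> C) (R0 r : R) :
  holo R0 f f' -> 0 < r < R0 ->
  hcont (fun t => f (circ r t)) /\ forall w, Cmod w < r ->
    psum (fun n => cmean (fun t => f (circ r t) * icirc r t ^ n)%C) w (f w).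
Proof.
  intros H Hr.
  assert (Hc : hcont (fun t => f (circ r t))).
  { eapply rderiv_hcont. intros t. apply rderiv_comp; [|apply circ_rderiv].
    apply H. rewrite Cmod_circ; lra. }
  split; [exact Hc|]. intros w Hw. unfold psum.
  replace (f w) with (cmean (fun t => / (1 - w * icirc r t) * f (circ r t))%C).
  - apply cmean_kernel_series; [exact Hc|lra|exact Hw].
  - rewrite (cauchy_kernel f f' R0 r w); [..|exact Hw].
    + rewrite (cmean_ext _ (fun t => f w * / (1 - w * icirc r t))%C) by (intros t; apply Cmult_comm).
      rewrite cmean_scal, cmean_kernel; [ring|lra|exact Hw|].
      apply (kernel_hcont (r + 1)); [lra|exact Hw].
    + intros v Hv. now apply H.
    + intros v Hv. now apply H.
    + exact Hr.
Qed.

(** Uniqueness of coefficients makes the expansions from different circles agree, so one series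
    serves the whole disc. *)
Lemma holo_psum (f f' : C -> C) (R0 : R) (z : C) :
  holo R0 f f' -> Cmod z < R0 -> psum (taylor_coef f) z (f z).
Proof.
  intros H Hz. assert (Hz0 := Cmod_ge_0 z). set (r := (Cmod z + R0) / 2).
  assert (Hr : 0 < r < R0) by (unfold r; lra).
  destruct (holo_circle_psum f f' R0 r H Hr) as [_ HS].
  eapply cser_ext; [|apply (HS z); unfold r; lra]. intros n. simpl.
  now rewrite (psum_taylor _ _ r n (proj1 Hr) HS).
Qed.

Lemma holo_cauchy_estimate (f f' : C -> C) (R0 r M : R) (n : nat) :
  holo R0 f f' -> 0 < r < R0 -> (forall w, Cmod w = r -> Cmod (f w) <= M) ->
  Cmod (taylor_coef f n) * r ^ n <= M.
Proof.
  intros H Hr HM. destruct (holo_circle_psum f f' R0 r H Hr) as [Hc HS].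
  rewrite (psum_taylor _ _ r n (proj1 Hr) HS).
  apply Rle_div_r; [apply Rlt_gt, pow_lt; lra|]. unfold Rdiv. rewrite <- pow_inv.
  apply cmean_bound.
  - apply hcont_mult; [exact Hc|apply hcont_pow, icirc_hcont].
  - intros t _. assert (Hi : 0 < / r) by (apply Rinv_0_lt_compat; lra).
    rewrite Cmod_mult, Cmod_pow. unfold icirc. rewrite Cmod_circ by lra.
    apply Rmult_le_compat_r; [apply pow_le; lra|]. apply HM, Cmod_circ. lra.
Qed.

(** * Analytic functions and the operator [Tg] *)

Lemma cderiv_translate (f : C -> C) (c z l : C) :
  cderiv (fun w => f (c + w)%C) (z - c)%C l -> cderiv f z l.
Proof.
  intros H.
  apply (cderiv_ext (fun w => f (c + (w - c)))%C _ z ((1 - 0) * l)%C).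
  - intros w. f_equal. ring.
  - ring.
  - apply (cderiv_comp (fun w => f (c + w)%C) (fun w => w - c)%C); [exact H|].
    apply cderiv_minus; [apply cderiv_id|apply cderiv_const].
Qed.

(** The local expansion is moved to the origin and differentiated twice; the second derivative makes
    the first one continuous, as [holo] asks. *)
Lemma analytic_C_derive (f : C -> C) (z : C) : analytic f -> disc z ->
  cderiv f z (C_derive f z) /\ exists l, cderiv (C_derive f) z l.
Proof.
  intros Hf Hz. destruct (Hf z Hz) as [r [a [Hr Ha]]]. unfold disc in *.
  set (s := Rmin r (1 - Cmod z)).
  assert (Hs : 0 < s) by (apply Rmin_pos; lra).
  assert (HF : forall w, Cmod w < s -> psum a w (f (z + w)%C)).
  { intros w Hw. apply psum_is_pseries.
    assert (H := Ha (z + w)%C). replace (z + w - z)%C with w in H by ring. apply H.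
    - eapply Rle_lt_trans; [apply Cmod_triangle|]. assert (s <= 1 - Cmod z) by apply Rmin_r. lra.
    - eapply Rlt_le_trans; [exact Hw|apply Rmin_l]. }
  set (F' := C_derive (fun w => f (z + w)%C)).
  assert (H1 : forall w, Cmod w < s -> cderiv (fun w => f (z + w)%C) w (F' w) /\ psum (dco a) w (F' w))
    by (apply psum_C_derive; exact HF).
  assert (H2 : forall w, Cmod w < s -> cderiv f (z + w)%C (F' w)).
  { intros w Hw. apply cderiv_translate with z. replace (z + w - z)%C with w by ring. now apply H1. }
  assert (H3 : forall w, Cmod w < s -> C_derive f (z + w)%C = F' w).
  { intros w Hw. now apply cderiv_C_derive, H2. }
  assert (H4 : forall w, Cmod w < s -> psum (dco a) w (C_derive f (z + w)%C)).
  { intros w Hw. rewrite H3 by exact Hw. now apply H1. }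
  rewrite <- (Cplus_0_r z).
  assert (H0 : Cmod 0 < s) by (rewrite Cmod_0; exact Hs). split.
  - rewrite H3 by exact H0. now apply H2.
  - eexists. apply cderiv_translate with z. replace (z + 0 - z)%C with (RtoC 0) by ring.
    exact (proj1 (psum_C_derive _ (fun w => C_derive f (z + w)%C) s H4 0 H0)).
Qed.

Lemma analytic_cderiv (f : C -> C) (z : C) : analytic f -> disc z -> cderiv f z (C_derive f z).
Proof. intros Hf Hz. now apply analytic_C_derive. Qed.

Lemma analytic_ccont (f : C -> C) (z : C) : analytic f -> disc z -> ccont f z.
Proof. intros Hf Hz. eapply cderiv_ccont, analytic_cderiv; assumption. Qed.

Lemma analytic_holo (f : C -> C) : analytic f -> holo 1 f (C_derive f).
Proof.
  intros Hf w Hw. destruct (analytic_C_derive f w Hf Hw) as [H [l Hl]].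
  split; [exact H|]. eapply cderiv_ccont, Hl.
Qed.

(** Cauchy's expansion in the largest disc around [z] inside the unit disc. The factor [1 *] only
    fits the shape of [cderiv_comp_affine]. *)
Lemma holo_analytic (f f' : C -> C) : holo 1 f f' -> analytic f.
Proof.
  intros Hf z Hz. unfold disc in Hz.
  exists (1 - Cmod z), (taylor_coef (fun w => f (z + 1 * w)%C)). split; [lra|].
  intros w _ Hw. apply (proj1 (psum_is_pseries _ _ _)).
  assert (HF : holo (1 - Cmod z) (fun w => f (z + 1 * w)%C) (fun w => 1 * f' (z + 1 * w))%C).
  { intros v Hv.
    assert (Hzv : Cmod (z + 1 * v)%C < 1).
    { eapply Rle_lt_trans; [apply Cmod_triangle|]. rewrite Cmult_1_l. lra. }
    split.
    - now apply cderiv_comp_affine, Hf.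
    - intros eps He. destruct (proj2 (Hf _ Hzv) eps He) as [d [Hd H]]. exists d.
      split; [exact Hd|]. intros u Hu. rewrite !Cmult_1_l. rewrite Cmult_1_l in H.
      apply H. now replace (z + u - (z + v))%C with (u - v)%C by ring. }
  assert (H := holo_psum _ _ _ (w - z)%C HF Hw). cbv beta in H.
  replace (z + 1 * (w - z))%C with w in H by ring. exact H.
Qed.

(** With this criterion the closure properties of analytic functions follow from the rules of
    differentiation. *)
Lemma cderiv2_analytic (f f' : C -> C) :
  (forall z, disc z -> cderiv f z (f' z)) -> (forall z, disc z -> exists l, cderiv f' z l) ->
  analytic f.
Proof.
  intros H H'. apply (holo_analytic f f'). intros w Hw. split; [now apply H|].
  destruct (H' w Hw) as [l Hl]. eapply cderiv_ccont, Hl.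
Qed.

(** Here the local definition of analyticity becomes one expansion at [0], valid in the whole
    disc. *)
Lemma analytic_taylor (f : C -> C) (z : C) :
  analytic f -> disc z -> psum (taylor_coef f) z (f z).
Proof. intros Hf Hz. eapply holo_psum; [now apply analytic_holo|exact Hz]. Qed.

Lemma psum_analytic (a : nat -> C) (f : C -> C) :
  (forall z, disc z -> psum a z (f z)) -> analytic f.
Proof.
  intros H. assert (H1 := psum_C_derive a f 1 H).
  apply (cderiv2_analytic f (C_derive f)).
  - intros z Hz. now apply H1.
  - intros z Hz. eexists.
    apply (psum_C_derive (dco a) (C_derive f) 1 (fun w Hw => proj2 (H1 w Hw)) z Hz).
Qed.

Lemma analytic_deriv (f : C -> C) : analytic f -> analytic (C_derive f).
Proof.
  intros Hf. apply (psum_analytic (dco (taylor_coef f))). intros z Hz.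
  apply (psum_C_derive _ f 1); [|exact Hz]. intros w Hw. now apply analytic_taylor.
Qed.

Lemma analytic_taylor_bd (f : C -> C) : analytic f -> coef_bd (taylor_coef f) 1.
Proof.
  intros Hf. apply psum_coef_bd. intros z Hz. eexists. now apply analytic_taylor.
Qed.

Lemma cderiv_eq_disc (f h : C -> C) (z l : C) :
  eq_disc f h -> disc z -> cderiv f z l -> cderiv h z l.
Proof.
  intros E Hz. unfold disc in Hz. apply cderiv_ext_loc with (1 - Cmod z); [lra|].
  intros w Hw. apply E. unfold disc. generalize (Cmod_triangle_minus w z). lra.
Qed.

Lemma eq_disc_sym (f h : C -> C) : eq_disc f h -> eq_disc h f.
Proof. intros H z Hz. symmetry. now apply H. Qed.

Lemma analytic_ext (f h : C -> C) : eq_disc f h -> analytic f -> analytic h.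
Proof.
  intros E Hf. apply (cderiv2_analytic h (C_derive f)).
  - intros z Hz. apply (cderiv_eq_disc f); [exact E|exact Hz|now apply analytic_cderiv].
  - intros z Hz. now apply analytic_C_derive.
Qed.

Lemma analytic_mult (f h : C -> C) :
  analytic f -> analytic h -> analytic (fun z => f z * h z)%C.
Proof.
  intros Hf Hh. apply (cderiv2_analytic _ (fun z => C_derive f z * h z + f z * C_derive h z)%C).
  - intros z Hz. apply cderiv_mult; now apply analytic_cderiv.
  - intros z Hz. destruct (analytic_C_derive f z Hf Hz) as [H1 [l1 H1']].
    destruct (analytic_C_derive h z Hh Hz) as [H2 [l2 H2']].
    eexists. apply cderiv_plus; apply cderiv_mult; eassumption.
Qed.

Lemma analytic_const (c : C) : analytic (fun _ => c).
Proof.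
  apply (cderiv2_analytic _ (fun _ => 0%C)).
  - intros z _. apply cderiv_const.
  - intros z _. eexists. apply cderiv_const.
Qed.

Lemma analytic_plus (f h : C -> C) : analytic f -> analytic h -> analytic (fun z => f z + h z)%C.
Proof.
  intros Hf Hh. apply (cderiv2_analytic _ (fun z => C_derive f z + C_derive h z)%C).
  - intros z Hz. apply cderiv_plus; now apply analytic_cderiv.
  - intros z Hz. destruct (analytic_C_derive f z Hf Hz) as [_ [l1 H1]].
    destruct (analytic_C_derive h z Hh Hz) as [_ [l2 H2]].
    eexists. apply cderiv_plus; eassumption.
Qed.

Lemma analytic_scal (c : C) (f : C -> C) : analytic f -> analytic (fun z => c * f z)%C.
Proof. intros Hf. exact (analytic_mult (fun _ => c) f (analytic_const c) Hf). Qed.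

Lemma analytic_minus (f h : C -> C) : analytic f -> analytic h -> analytic (fun z => f z - h z)%C.
Proof.
  intros Hf Hh. apply (analytic_ext (fun z => f z + (-(1)) * h z)%C).
  - intros z _. ring.
  - apply analytic_plus; [exact Hf|now apply analytic_scal].
Qed.

Lemma analytic_pow (n : nat) : analytic (fun z => z ^ n)%C.
Proof.
  apply (cderiv2_analytic _ (fun z => RtoC (INR n) * z ^ pred n)%C).
  - intros z _. apply cderiv_pow.
  - intros z _. eexists. apply cderiv_scal, cderiv_pow.
Qed.

Lemma Cmod_dilate (r : R) (z : C) : 0 <= r <= 1 -> Cmod (RtoC r * z) <= Cmod z.
Proof.
  intros Hr. rewrite Cmod_scal_pos by lra. assert (H := Cmod_ge_0 z). nra.
Qed.

Lemma disc_dilate (r : R) (z : C) : 0 <= r <= 1 -> disc z -> disc (RtoC r * z)%C.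
Proof. intros Hr Hz. eapply Rle_lt_trans; [now apply Cmod_dilate|exact Hz]. Qed.

Lemma dilate_cderiv (f : C -> C) (r : R) (z : C) :
  analytic f -> 0 <= r <= 1 -> disc z ->
  cderiv (dilate r f) z (RtoC r * C_derive f (RtoC r * z))%C.
Proof.
  intros Hf Hr Hz. unfold dilate. rewrite <- (Cmult_1_r (RtoC r)) at 1.
  apply (cderiv_comp f (fun w => RtoC r * w)%C); [|apply cderiv_scal, cderiv_id].
  now apply analytic_cderiv, disc_dilate.
Qed.

Lemma analytic_bounded (f : C -> C) (r : R) : analytic f -> r < 1 ->
  exists M, 0 <= M /\ forall z, Cmod z <= r -> Cmod (f z) <= M.
Proof.
  intros Hf Hr. destruct (Rlt_le_dec r 0) as [Hr0|Hr0].
  { exists 0. split; [lra|]. intros z Hz. generalize (Cmod_ge_0 z). lra. }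
  destruct (coef_bd_ex_series _ _ r (analytic_taylor_bd f Hf)) as [M HM]; [lra|].
  assert (H : forall z, Cmod z <= r -> Cmod (f z) <= M).
  { intros z Hz. assert (Hd : disc z) by (unfold disc; lra).
    refine (cser_norm_le _ _ _ _ _ HM (analytic_taylor f z Hf Hd)). intros n.
    rewrite Cmod_mult, Cmod_pow. apply Rmult_le_compat_l; [apply Cmod_ge_0|].
    apply pow_incr. split; [apply Cmod_ge_0|exact Hz]. }
  exists M. split; [|exact H]. eapply Rle_trans; [apply Cmod_ge_0|apply (H 0)].
  rewrite Cmod_0. exact Hr0.
Qed.

Lemma analytic_primitive (F : C -> C) : analytic F ->
  exists P, forall z, disc z -> cderiv P z (F z).
Proof.
  intros HF.
  set (b := fun n => match n with O => RtoC 0 | S m => (taylor_coef F m / RtoC (INR (S m)))%C end).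
  assert (HS : forall m, RtoC (INR (S m)) <> 0).
  { intros m E. apply RtoC_inj in E. revert E. apply not_0_INR. lia. }
  assert (Hb : coef_bd b 1).
  { intros r Hr. destruct (analytic_taylor_bd F HF r Hr) as [M HM].
    assert (HM0 : 0 <= M).
    { eapply Rle_trans; [|apply (HM 0%nat)]. simpl. rewrite Rmult_1_r. apply Cmod_ge_0. }
    exists M. intros [|m].
    - simpl. rewrite Cmod_0. lra.
    - eapply Rle_trans; [|apply (HM m)]. unfold b. rewrite Cmod_div by apply HS.
      rewrite Cmod_R, Rabs_pos_eq by apply pos_INR.
      assert (H1 : 1 <= INR (S m)) by (apply (le_INR 1); lia).
      assert (Hc := Cmod_ge_0 (taylor_coef F m)). assert (Hp := pow_le r m (proj1 Hr)).
      apply Rmult_le_compat.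
      + apply Rdiv_le_0_compat; lra.
      + apply pow_le; lra.
      + apply Rle_div_l; [lra|]. nra.
      + simpl. nra. }
  exists (fun z => csum (fun n => b n * z ^ n)%C).
  apply (psum_deriv b).
  - intros z Hz. apply csum_correct. exact (coef_bd_psum _ _ _ Hb Hz).
  - intros z Hz. apply (cser_ext (fun n => taylor_coef F n * z ^ n)%C).
    + intros n. unfold dco, b. f_equal. specialize (HS n). now field.
    + now apply analytic_taylor.
Qed.

Lemma disc_0 : disc 0.
Proof. unfold disc. rewrite Cmod_0. lra. Qed.

(** This pair of properties characterises [Tg g f], and most later facts rest on it rather than on
    the integral. *)
Lemma Tg_cderiv (g f : C -> C) : analytic g -> analytic f ->
  Tg g f 0 = 0 /\ forall z, disc z -> cderiv (Tg g f) z (f z * C_derive g z)%C.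
Proof.
  intros Hg Hf. set (F := fun z => (f z * C_derive g z)%C).
  assert (HF : analytic F) by (apply analytic_mult; [exact Hf|now apply analytic_deriv]).
  destruct (analytic_primitive F HF) as [P HP].
  assert (E : forall z, disc z -> Tg g f z = (P z - P 0)%C).
  { intros z Hz. apply (path_int_primitive F (C_derive F)); intros t Ht.
    - now apply HP, disc_dilate.
    - now apply analytic_cderiv, disc_dilate. }
  split.
  - rewrite E by apply disc_0. ring.
  - intros z Hz. apply (cderiv_eq_disc (fun z => P z - P 0)%C); [|exact Hz|].
    + intros w Hw. now rewrite E.
    + apply (cderiv_ext (fun z => P z - P 0)%C _ z (F z - 0)%C).
      * reflexivity.
      * unfold F. ring.
      * apply cderiv_minus; [apply (HP z Hz)|apply cderiv_const].
Qed.

Lemma eq_disc_of_cderiv (f h f' : C -> C) :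
  (forall z, disc z -> cderiv f z (f' z)) -> (forall z, disc z -> cderiv h z (f' z)) ->
  f 0 = h 0 -> eq_disc f h.
Proof.
  intros Hf Hh E z Hz.
  assert (H : Cmod (f z - h z - (f 0 - h 0)) <= 0 * Cmod (z - 0)).
  { apply (cderiv_lipschitz (fun w => f w - h w)%C (fun w => f' w - f' w)%C);
      [| |exact disc_0|exact Hz]; intros v Hv.
    - apply cderiv_minus; auto.
    - rewrite Cmod_minus_diag. lra. }
  apply Cmod_zero_minus, Rle_antisym; [|apply Cmod_ge_0].
  replace (f z - h z)%C with (f z - h z - (f 0 - h 0))%C by (rewrite E; ring). lra.
Qed.

Lemma Tg_analytic (g f : C -> C) : analytic g -> analytic f -> analytic (Tg g f).
Proof.
  intros Hg Hf. destruct (Tg_cderiv g f Hg Hf) as [_ H].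
  apply (cderiv2_analytic _ _ H). intros z Hz. eexists.
  apply (analytic_cderiv (fun z => f z * C_derive g z)%C); [|exact Hz].
  apply analytic_mult; [exact Hf|now apply analytic_deriv].
Qed.

(** Linearity of [Tg], and its independence of values outside the disc, are read off from this
    uniqueness. *)
Lemma Tg_unique (g f P : C -> C) : analytic g -> analytic f ->
  (forall z, disc z -> cderiv P z (f z * C_derive g z)%C) -> P 0 = 0 ->
  eq_disc P (Tg g f).
Proof.
  intros Hg Hf HP H0. destruct (Tg_cderiv g f Hg Hf) as [E H].
  apply (eq_disc_of_cderiv _ _ _ HP H). now rewrite H0, E.
Qed.

Lemma Tg_ext (g f h : C -> C) : analytic g -> analytic f -> eq_disc f h ->
  eq_disc (Tg g f) (Tg g h).
Proof.
  intros Hg Hf E. destruct (Tg_cderiv g f Hg Hf) as [E0 H].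
  apply Tg_unique; [exact Hg|now apply (analytic_ext f)| |exact E0].
  intros z Hz. rewrite <- E by exact Hz. now apply H.
Qed.

Lemma Tg_add (g f h : C -> C) : analytic g -> analytic f -> analytic h ->
  eq_disc (fadd (Tg g f) (Tg g h)) (Tg g (fadd f h)).
Proof.
  intros Hg Hf Hh. destruct (Tg_cderiv g f Hg Hf) as [E1 H1].
  destruct (Tg_cderiv g h Hg Hh) as [E2 H2].
  apply Tg_unique; [exact Hg|now apply analytic_plus| |].
  - intros z Hz. apply (cderiv_ext (fadd (Tg g f) (Tg g h)) _ z
      (f z * C_derive g z + h z * C_derive g z)%C).
    + reflexivity.
    + unfold fadd. ring.
    + apply cderiv_plus; [now apply H1|now apply H2].
  - unfold fadd. rewrite E1, E2. ring.
Qed.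

Lemma Tg_scal (g f : C -> C) (c : C) : analytic g -> analytic f ->
  eq_disc (fscal c (Tg g f)) (Tg g (fscal c f)).
Proof.
  intros Hg Hf. destruct (Tg_cderiv g f Hg Hf) as [E1 H1].
  apply Tg_unique; [exact Hg|now apply analytic_scal| |].
  - intros z Hz. apply (cderiv_ext (fscal c (Tg g f)) _ z (c * (f z * C_derive g z))%C).
    + reflexivity.
    + unfold fscal. ring.
    + now apply cderiv_scal, H1.
  - unfold fscal. rewrite E1. ring.
Qed.

Lemma Tg_sub (g f h : C -> C) : analytic g -> analytic f -> analytic h ->
  eq_disc (fsub (Tg g f) (Tg g h)) (Tg g (fsub f h)).
Proof.
  intros Hg Hf Hh. destruct (Tg_cderiv g f Hg Hf) as [E1 H1].
  destruct (Tg_cderiv g h Hg Hh) as [E2 H2].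
  apply Tg_unique; [exact Hg|now apply analytic_minus| |].
  - intros z Hz. apply (cderiv_ext (fsub (Tg g f) (Tg g h)) _ z
      (f z * C_derive g z - h z * C_derive g z)%C).
    + reflexivity.
    + unfold fsub. ring.
    + apply cderiv_minus; [now apply H1|now apply H2].
  - unfold fsub. rewrite E1, E2. ring.
Qed.

(** A local estimate: sizes on [|w| <= r] suffice, so locally uniform smallness of [f] passes to
    [Tg g f] pointwise even if [g'] is unbounded near the circle. *)
Lemma Tg_bound (g f : C -> C) (r A B : R) (z : C) : analytic g -> analytic f ->
  r < 1 -> Cmod z <= r ->
  (forall w, Cmod w <= r -> Cmod (f w) <= A) ->
  (forall w, Cmod w <= r -> Cmod (C_derive g w) <= B) ->
  Cmod (Tg g f z) <= A * B.
Proof.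
  intros Hg Hf Hr Hz HA HB. destruct (Tg_cderiv g f Hg Hf) as [E H].
  assert (Hz0 := Cmod_ge_0 z).
  assert (Hin : forall t : R, 0 <= t <= 1 -> Cmod (0 + RtoC t * (z - 0))%C <= r).
  { intros t Ht. apply Cmod_segment; [exact Ht|rewrite Cmod_0; lra|exact Hz]. }
  assert (HA0 : 0 <= A) by (eapply Rle_trans; [apply Cmod_ge_0|apply (HA z Hz)]).
  assert (HB0 : 0 <= B) by (eapply Rle_trans; [apply Cmod_ge_0|apply (HB z Hz)]).
  replace (Tg g f z) with (Tg g f z - Tg g f 0)%C by (rewrite E; ring).
  eapply Rle_trans; [apply (mean_value_bound _ (fun z => f z * C_derive g z)%C 0 z (A * B))|].
  - intros t Ht. apply H. eapply Rle_lt_trans; [now apply Hin|exact Hr].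
  - intros t Ht. rewrite Cmod_mult. apply Rmult_le_compat; try apply Cmod_ge_0.
    + now apply HA, Hin.
    + now apply HB, Hin.
  - replace (z - 0)%C with z by ring. assert (0 <= A * B) by now apply Rmult_le_pos. nra.
Qed.

Definition taylor_poly (f : C -> C) (N : nat) (z : C) : C :=
  csum_n (fun n => taylor_coef f n * z ^ n)%C N.

Lemma taylor_poly_S (f : C -> C) (N : nat) (z : C) :
  taylor_poly f (S N) z = (taylor_poly f N z + taylor_coef f (S N) * z ^ S N)%C.
Proof. unfold taylor_poly. now rewrite sum_Sn. Qed.

Lemma taylor_poly_0 (f : C -> C) (z : C) : taylor_poly f 0 z = (taylor_coef f 0 * z ^ 0)%C.
Proof. unfold taylor_poly. now rewrite sum_O. Qed.

Lemma analytic_taylor_poly (f : C -> C) (N : nat) : analytic (taylor_poly f N).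
Proof.
  induction N as [|N IH].
  - apply (analytic_ext (fun z => taylor_coef f 0 * z ^ 0)%C).
    + intros z _. now rewrite taylor_poly_0.
    + apply analytic_scal, (analytic_pow 0).
  - apply (analytic_ext (fun z => taylor_poly f N z + taylor_coef f (S N) * z ^ S N)%C).
    + intros z _. now rewrite taylor_poly_S.
    + apply analytic_plus; [exact IH|apply analytic_scal, (analytic_pow (S N))].
Qed.

Lemma Tg_taylor_poly (g f : C -> C) (N : nat) (z : C) : analytic g -> disc z ->
  Tg g (taylor_poly f N) z =
  csum_n (fun n => taylor_coef f n * Tg g (fun z => z ^ n)%C z)%C N.
Proof.
  intros Hg Hz. induction N as [|N IH].
  - rewrite sum_O.
    transitivity (fscal (taylor_coef f 0) (Tg g (fun z => z ^ 0)%C) z); [|reflexivity].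
    rewrite (Tg_scal g _ _ Hg (analytic_pow 0) z Hz).
    apply Tg_ext; [exact Hg|apply analytic_taylor_poly| |exact Hz].
    intros w _. apply taylor_poly_0.
  - rewrite sum_Sn, <- IH.
    transitivity (fadd (Tg g (taylor_poly f N))
      (fscal (taylor_coef f (S N)) (Tg g (fun z => z ^ S N)%C)) z); [|reflexivity].
    unfold fadd at 1. rewrite (Tg_scal g _ _ Hg (analytic_pow (S N)) z Hz).
    transitivity (fadd (Tg g (taylor_poly f N))
      (Tg g (fscal (taylor_coef f (S N)) (fun z => z ^ S N)%C)) z); [|reflexivity].
    assert (Hs : analytic (fscal (taylor_coef f (S N)) (fun z => z ^ S N)%C))
      by apply analytic_scal, analytic_pow.
    rewrite (Tg_add g _ _ Hg (analytic_taylor_poly f N) Hs z Hz).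
    apply Tg_ext; [exact Hg|apply analytic_taylor_poly| |exact Hz].
    intros w _. apply taylor_poly_S.
Qed.

Lemma taylor_poly_uniform (f : C -> C) (r eps : R) : analytic f -> 0 <= r < 1 -> 0 < eps ->
  exists N, forall n z, (N <= n)%nat -> Cmod z <= r ->
    Cmod (f z - taylor_poly f n z) <= eps.
Proof.
  intros Hf Hr He.
  assert (HE := coef_bd_ex_series _ _ r (analytic_taylor_bd f Hf) Hr).
  set (v := fun n => Cmod (taylor_coef f n) * r ^ n) in *.
  destruct HE as [s Hs].
  assert (Hs' : is_lim_seq (sum_n v) s) by exact Hs.
  apply is_lim_seq_spec in Hs'. destruct (Hs' (mkposreal eps He)) as [N HN]. simpl in HN.
  exists N. intros n z Hn Hz. specialize (HN n Hn).
  assert (Hd : disc z) by (unfold disc; lra).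
  assert (HT : cser (fun k => taylor_coef f (S n + k) * z ^ (S n + k))%C
     (f z - taylor_poly f n z)%C).
  { apply (is_series_incr_n (K := C_AbsRing) (V := C_NormedModule)
      (fun k => taylor_coef f k * z ^ k)%C (S n)); [lia|].
    change (cser (fun k => taylor_coef f k * z ^ k)%C (f z - taylor_poly f n z + taylor_poly f n z)%C).
    replace (f z - taylor_poly f n z + taylor_poly f n z)%C with (f z) by ring.
    now apply analytic_taylor. }
  assert (HV : is_series (fun k => v (S n + k)%nat) (s - sum_n v n)).
  { apply (is_series_incr_n (K := R_AbsRing) (V := R_NormedModule) v (S n)); [lia|].
    change (is_series v (s - sum_n v n + sum_n v n)).
    assert (E : forall x y : R, x - y + y = x) by (intros; ring). rewrite E. exact Hs. }
  apply Rle_trans with (s - sum_n v n).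
  - refine (cser_norm_le _ _ _ _ _ HV HT). intros k. unfold v.
    rewrite Cmod_mult, Cmod_pow. apply Rmult_le_compat_l; [apply Cmod_ge_0|].
    apply pow_incr. split; [apply Cmod_ge_0|exact Hz].
  - rewrite Rabs_minus_sym in HN. generalize (Rle_abs (s - sum_n v n)). lra.
Qed.

(** Taylor polynomials converge uniformly on [|w| <= |z|], and [Tg] is linear on them. Thus
    evaluation of [Tg g f] at [z] is determined by the monomials, which is the source of the series
    of [G]. *)
Lemma Tg_series (g f : C -> C) (z : C) : analytic g -> analytic f -> disc z ->
  cser (fun n => taylor_coef f n * Tg g (fun w => w ^ n)%C z)%C (Tg g f z).
Proof.
  intros Hg Hf Hz. unfold disc in Hz. assert (Hz0 := Cmod_ge_0 z).
  destruct (analytic_bounded (C_derive g) (Cmod z) (analytic_deriv g Hg) Hz) as [B [HB0 HB]].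
  apply cser_eps. intros eps He.
  destruct (taylor_poly_uniform f (Cmod z) (eps / (1 + B)) Hf) as [N HN];
    [lra|apply Rdiv_lt_0_compat; lra|].
  exists N. intros n Hn. rewrite <- Tg_taylor_poly, Cmod_minus_sym by assumption.
  assert (Hp := analytic_taylor_poly f n).
  change (Cmod (fsub (Tg g f) (Tg g (taylor_poly f n)) z) < eps).
  rewrite (Tg_sub g f _ Hg Hf Hp z Hz).
  apply Rle_lt_trans with (eps / (1 + B) * B).
  - apply (Tg_bound g (fsub f (taylor_poly f n)) (Cmod z)); try assumption; try lra.
    + now apply analytic_minus.
    + intros w Hw. now apply HN.
  - replace eps with (eps / (1 + B) * (1 + B)) at 2 by (field; lra).
    apply Rmult_lt_compat_l; [apply Rdiv_lt_0_compat; lra|lra].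
Qed.

Lemma Tg_pow_bound (g : C -> C) (z : C) (n : nat) (B : R) : analytic g -> disc z ->
  (forall w, Cmod w <= Cmod z -> Cmod (C_derive g w) <= B) ->
  Cmod (Tg g (fun w => w ^ n)%C z) <= Cmod z ^ n * B.
Proof.
  intros Hg Hz HB. apply (Tg_bound g _ (Cmod z)); [exact Hg|apply analytic_pow|exact Hz|lra| |exact HB].
  intros w Hw. rewrite Cmod_pow. apply pow_incr. split; [apply Cmod_ge_0|exact Hw].
Qed.

(** * Total boundedness and the closed graph theorem *)

Section Banach.

Variable X : fspace.
Hypothesis HX : banach X.

Lemma banach_eq_mem (f h : C -> C) : eq_disc f h -> mem X f -> mem X h.
Proof. intros E Hf. exact (proj1 (banach_ext X HX f h E Hf)). Qed.

Lemma banach_eq_nrm (f h : C -> C) : eq_disc f h -> mem X f -> nrm X h = nrm X f.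
Proof. intros E Hf. exact (proj2 (banach_ext X HX f h E Hf)). Qed.

Lemma banach_sub_scal (f h : C -> C) : eq_disc (fadd f (fscal (-(1)) h)) (fsub f h).
Proof. intros z _. unfold fadd, fscal, fsub. ring. Qed.

Lemma banach_sub (f h : C -> C) : mem X f -> mem X h -> mem X (fsub f h).
Proof.
  intros Hf Hh. apply (banach_eq_mem _ _ (banach_sub_scal f h)).
  apply banach_add; [exact HX|exact Hf|now apply banach_scal].
Qed.

Lemma nrm_fzero : nrm X fzero = 0.
Proof.
  assert (Hz := banach_zero X HX).
  rewrite (banach_eq_nrm (fscal 0 fzero) fzero).
  - rewrite banach_norm_scal by assumption. rewrite Cmod_0. ring.
  - intros z _. unfold fscal, fzero. ring.
  - now apply banach_scal.
Qed.

Lemma nrm_scal_pos (c : R) (f : C -> C) : 0 <= c -> mem X f ->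
  nrm X (fscal (RtoC c) f) = c * nrm X f.
Proof. intros Hc Hf. now rewrite banach_norm_scal, Cmod_R, Rabs_pos_eq. Qed.

Lemma nrm_null (f : C -> C) : eq_disc f fzero -> nrm X f = 0.
Proof.
  intros E. rewrite <- nrm_fzero. apply banach_eq_nrm; [now apply eq_disc_sym|].
  now apply banach_zero.
Qed.

Lemma nrm_sub_sym (f h : C -> C) : mem X f -> mem X h -> nrm X (fsub f h) = nrm X (fsub h f).
Proof.
  intros Hf Hh. rewrite (banach_eq_nrm (fscal (-(1)) (fsub h f)) (fsub f h)).
  - rewrite banach_norm_scal by (auto using banach_sub). rewrite Cmod_opp, Cmod_1. ring.
  - intros z _. unfold fscal, fsub. ring.
  - apply banach_scal; auto using banach_sub.
Qed.

Lemma nrm_sub_triangle (f k h : C -> C) : mem X f -> mem X k -> mem X h ->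
  nrm X (fsub f h) <= nrm X (fsub f k) + nrm X (fsub k h).
Proof.
  intros Hf Hk Hh. rewrite (banach_eq_nrm (fadd (fsub f k) (fsub k h)) (fsub f h)).
  - apply banach_triangle; auto using banach_sub.
  - intros z _. unfold fadd, fsub. ring.
  - apply banach_add; auto using banach_sub.
Qed.

Lemma nrm_sub_self (f : C -> C) : nrm X (fsub f f) = 0.
Proof. apply nrm_null. intros z _. unfold fsub, fzero. ring. Qed.

Lemma nrm_sub_zero (f : C -> C) : mem X f -> nrm X (fsub f fzero) = nrm X f.
Proof.
  intros Hf. apply banach_eq_nrm; [|exact Hf]. intros z _. unfold fsub, fzero. ring.
Qed.

Lemma nrm_triangle_minus (f h : C -> C) : mem X f -> mem X h ->
  nrm X f <= nrm X (fsub f h) + nrm X h.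
Proof.
  intros Hf Hh. rewrite <- (nrm_sub_zero f Hf), <- (nrm_sub_zero h Hh).
  apply nrm_sub_triangle; auto using banach_zero.
Qed.

Lemma nrm_ge_0 (f : C -> C) : mem X f -> 0 <= nrm X f.
Proof.
  intros Hf. assert (H := nrm_sub_triangle f fzero f Hf (banach_zero X HX) Hf).
  rewrite nrm_sub_self, (nrm_sub_sym fzero f (banach_zero X HX) Hf), nrm_sub_zero in H by exact Hf.
  lra.
Qed.

Lemma nrm_sub_le (f h : C -> C) : mem X f -> mem X h ->
  nrm X (fsub f h) <= nrm X f + nrm X h.
Proof.
  intros Hf Hh. rewrite <- (nrm_sub_zero f Hf), <- (nrm_sub_zero h Hh).
  rewrite (nrm_sub_sym h fzero Hh (banach_zero X HX)).
  apply nrm_sub_triangle; auto using banach_zero.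
Qed.

Lemma is_lim_seq_0_eps (u : nat -> R) (eps : R) : is_lim_seq u 0 -> 0 < eps ->
  exists N, forall n, (N <= n)%nat -> u n < eps.
Proof.
  intros H He. apply is_lim_seq_spec in H. destruct (H (mkposreal eps He)) as [N HN].
  exists N. intros n Hn. specialize (HN n Hn). simpl in HN. rewrite Rminus_0_r in HN.
  eapply Rle_lt_trans; [apply Rle_abs|exact HN].
Qed.

Lemma half_pow_lt (eps : R) : 0 < eps -> exists N, forall n, (N <= n)%nat -> (/ 2) ^ n < eps.
Proof.
  intros He. apply is_lim_seq_0_eps; [|exact He].
  apply is_lim_seq_geom. rewrite Rabs_pos_eq; lra.
Qed.

(** The centres belong to [E] itself; hence a net remains one when [E] is viewed in another space
    with the same norm. *)
Definition totally_bounded (E : (C -> C) -> Prop) : Prop :=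
  forall eps, 0 < eps -> exists l, (forall h, In h l -> E h) /\
    forall f, E f -> exists h, In h l /\ nrm X (fsub f h) < eps.

Lemma relatively_compact_totally_bounded (E : (C -> C) -> Prop) :
  relatively_compact X E -> totally_bounded E.
Proof.
  intros [Hm Hc] eps He.
  set (P := fun (U : (C -> C) -> Prop) h =>
    E h /\ U = (fun f => mem X f -> nrm X (fsub f h) < eps)).
  destruct (Hc (fun U => exists h, P U h)) as [l [Hl Hcov]].
  - intros U [h [Hh ->]] f Hf Hfh. specialize (Hfh Hf).
    exists (eps - nrm X (fsub f h)). split; [lra|]. intros k Hk Hkf _.
    assert (H := nrm_sub_triangle k f h Hk Hf (Hm h Hh)). lra.
  - intros f [Hf Hcl]. destruct (Hcl eps He) as [h [Hh Hhf]]. eexists. split.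
    + exists h. split; [exact Hh|reflexivity].
    + intros _. rewrite nrm_sub_sym; auto.
  (* A subcover is a list of sets, so a centre has to be recovered from each of them by choice. *)
  - set (c := fun U => epsilon (inhabits fzero) (P U)).
    assert (Hc' : forall U, In U l -> P U (c U))
      by (intros U HU; exact (epsilon_spec (inhabits fzero) (P U) (Hl U HU))).
    exists (map c l). split.
    + intros h Hh. apply in_map_iff in Hh. destruct Hh as [U [<- HU]]. apply (Hc' U HU).
    + intros f Hf. destruct (Hcov f) as [U [HU HUf]].
      * split; [now apply Hm|]. intros e He'. exists f. rewrite nrm_sub_self. now split.
      * exists (c U). split; [now apply in_map|].
        rewrite (proj2 (Hc' U HU)) in HUf. apply HUf, Hm, Hf.
Qed.

(** * Totally bounded sets are relatively compact *)

Section FiniteSubcover.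

Variables (E : (C -> C) -> Prop) (F : ((C -> C) -> Prop) -> Prop).
Hypothesis Hm : forall f, E f -> mem X f.
Hypothesis Htb : totally_bounded E.
Hypothesis HF : forall U, F U -> open_in X U.
Hypothesis Hcov : forall f, closure_in X E f -> exists U, F U /\ U f.

Let K := closure_in X E.

Let bad (S : (C -> C) -> Prop) : Prop :=
  ~ exists l, (forall U, In U l -> F U) /\ forall f, K f -> S f -> exists U, In U l /\ U f.

(** An [eps / 2]-net of [E] is an [eps]-net of its closure. If no ball of the net were bad, the
    finitely many finite subcovers could be concatenated. *)
Local Lemma bad_ball (S : (C -> C) -> Prop) (eps : R) : 0 < eps -> bad S ->
  exists h, mem X h /\ bad (fun f => S f /\ nrm X (fsub f h) < eps).
Proof.
  intros He Hbad. apply NNPP. intros Hno. apply Hbad.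
  destruct (Htb (eps / 2)) as [l [Hl Hlc]]; [lra|].
  assert (H : exists l', (forall U, In U l' -> F U) /\ forall f, K f -> S f ->
     (exists h, In h l /\ nrm X (fsub f h) < eps) -> exists U, In U l' /\ U f).
  { clear Hlc. induction l as [|h l IH].
    - exists nil. split; [intros _ []|]. intros f _ _ [h [[] _]].
    - destruct IH as [l1 [A1 B1]]; [intros k Hk; apply Hl; now right|].
      assert (Hh : ~ bad (fun f => S f /\ nrm X (fsub f h) < eps)).
      { intros Hb. apply Hno. exists h. split; [apply Hm, Hl; now left|exact Hb]. }
      apply NNPP in Hh. destruct Hh as [l2 [A2 B2]]. exists (l2 ++ l1). split.
      + intros U HU. apply in_app_or in HU. destruct HU; auto.
      + intros f Hf HS [k [[<-|Hk] Hfk]].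
        * destruct (B2 f Hf (conj HS Hfk)) as [U [HU HUf]]. exists U.
          split; [apply in_or_app; now left|exact HUf].
        * destruct (B1 f Hf HS) as [U [HU HUf]]; [now exists k|]. exists U.
          split; [apply in_or_app; now right|exact HUf]. }
  destruct H as [l' [A B]]. exists l'. split; [exact A|]. intros f Hf HS. apply (B f Hf HS).
  destruct Hf as [Hfm Hfc]. destruct (Hfc (eps / 2)) as [k [Hk Hkf]]; [lra|].
  destruct (Hlc k Hk) as [h [Hh Hkh]]. exists h. split; [exact Hh|].
  assert (H := nrm_sub_triangle f k h Hfm (Hm k Hk) (Hm h (Hl h Hh))).
  rewrite (nrm_sub_sym f k) in H by auto. lra.
Qed.

Let next (n : nat) (S : (C -> C) -> Prop) (h f : C -> C) : Prop :=
  S f /\ nrm X (fsub f h) < (/ 2) ^ n.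

Let center (n : nat) (S : (C -> C) -> Prop) : C -> C :=
  epsilon (inhabits fzero) (fun h => mem X h /\ bad (next n S h)).

(** The set is cut down by balls of radius [(/ 2) ^ n]; the centres come from [epsilon] and are
    meaningful because each set is proved bad in turn. *)
Fixpoint nested (n : nat) : (C -> C) -> Prop :=
  match n with
  | O => fun _ => True
  | S m => next m (nested m) (center m (nested m))
  end.

Let point (n : nat) : C -> C := epsilon (inhabits fzero) (fun f => K f /\ nested n f).

(** Points picked in the nested bad sets form a Cauchy sequence. Its limit lies in the closure, and
    a single open set around that limit swallows a late bad set. *)
Local Lemma finite_subcover :
  exists l, (forall U, In U l -> F U) /\ forall f, K f -> exists U, In U l /\ U f.
Proof.
  apply NNPP. intros Hno.
  assert (Hp : forall n, 0 < (/ 2) ^ n) by (intros n; apply pow_lt; lra).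
  assert (Hb : forall n, bad (nested n)).
  { induction n as [|n IH].
    - intros [l [A B]]. apply Hno. exists l. split; [exact A|]. intros f Hf. now apply B.
    - exact (proj2 (epsilon_spec (inhabits fzero) _ (bad_ball (nested n) _ (Hp n) IH))). }
  assert (Hc : forall n, mem X (center n (nested n))).
  { intros n. exact (proj1 (epsilon_spec (inhabits fzero) _ (bad_ball (nested n) _ (Hp n) (Hb n)))). }
  assert (Hx : forall n, K (point n) /\ nested n (point n)).
  { intros n. apply epsilon_spec. apply NNPP. intros Hne. apply (Hb n). exists nil.
    split; [intros _ []|]. intros f Hf Hn. exfalso. apply Hne. now exists f. }
  assert (Hdec : forall n m f, (n <= m)%nat -> nested m f -> nested n f).
  { intros n m f Hle. induction Hle as [|m Hle IH]; [auto|]. intros [H _]. auto. }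
  assert (Hdiam : forall n f h, mem X f -> mem X h -> nested (S n) f -> nested (S n) h ->
     nrm X (fsub f h) < 2 * (/ 2) ^ n).
  { intros n f h Hf Hh [_ H1] [_ H2].
    assert (H := nrm_sub_triangle f _ h Hf (Hc n) Hh).
    rewrite (nrm_sub_sym _ h (Hc n) Hh) in H. lra. }
  assert (Hsmall : forall eps, 0 < eps -> exists n, 2 * (/ 2) ^ n < eps).
  { intros eps He. destruct (half_pow_lt (eps / 2)) as [N HN]; [lra|].
    exists N. specialize (HN N (le_n _)). lra. }
  assert (Hmx : forall n, mem X (point n)) by (intros n; apply Hx).
  destruct (banach_complete X HX point Hmx) as [f [Hf Hlim]].
  { intros eps He. destruct (Hsmall eps He) as [n Hn]. exists (S n). intros i j Hi Hj.
    eapply Rlt_trans; [|exact Hn]. apply Hdiam; auto.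
    - exact (Hdec _ _ _ Hi (proj2 (Hx i))).
    - exact (Hdec _ _ _ Hj (proj2 (Hx j))). }
  assert (Hlim' := fun eps => is_lim_seq_0_eps _ eps Hlim).
  assert (HK : K f).
  { split; [exact Hf|]. intros eps He. destruct (Hlim' (eps / 2)) as [N HN]; [lra|].
    destruct (Hx N) as [[_ Hcl] _]. destruct (Hcl (eps / 2)) as [h [Hh Hhx]]; [lra|].
    exists h. split; [exact Hh|]. specialize (HN N (le_n _)).
    assert (H := nrm_sub_triangle h (point N) f (Hm h Hh) (Hmx N) Hf). lra. }
  destruct (Hcov f HK) as [U [HFU HUf]]. destruct (HF U HFU f Hf HUf) as [eps [He Hball]].
  destruct (Hsmall (eps / 2)) as [n Hn]; [lra|]. destruct (Hlim' (eps / 2)) as [N HN]; [lra|].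
  apply (Hb (S n)). exists (U :: nil). split.
  { intros V [<-|[]]. exact HFU. }
  intros y [Hy _] Hny. exists U. split; [now left|]. apply Hball; [exact Hy|].
  set (m := (S n + N)%nat). specialize (HN m ltac:(unfold m; lia)).
  assert (Hnm : nested (S n) (point m)) by (apply (Hdec _ m); [unfold m; lia|apply Hx]).
  assert (H1 := Hdiam n y (point m) Hy (Hmx m) Hny Hnm).
  assert (H := nrm_sub_triangle y (point m) f Hy (Hmx m) Hf). lra.
Qed.

End FiniteSubcover.

Lemma totally_bounded_relatively_compact (E : (C -> C) -> Prop) :
  (forall f, E f -> mem X f) -> totally_bounded E -> relatively_compact X E.
Proof.
  intros Hm Htb. split; [exact Hm|]. intros F HF Hcov.
  exact (finite_subcover E F Hm Htb HF Hcov).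
Qed.

End Banach.

(** What the closed graph argument takes from P3: norm convergence forces pointwise convergence, so
    limits in two spaces can be identified. *)
Definition eval_bounded (X : fspace) : Prop :=
  forall z, disc z -> exists M, forall f, mem X f -> Cmod (f z) <= M * nrm X f.

(** * Automatic continuity of inclusions *)

Section ClosedGraph.

Variables V X : fspace.
Hypotheses (HV : banach V) (HX : banach X).
Hypotheses (HeV : eval_bounded V) (HeX : eval_bounded X).
Hypothesis HVX : subspace V X.

(** Membership in the [V]-closure of [{nrm X <= N}]; Baire's theorem gives such a closure an
    interior point. *)
Let dense_near (N : R) (f : C -> C) : Prop :=
  forall eps, 0 < eps -> exists h, mem V h /\ nrm V (fsub h f) < eps /\ nrm X h <= N.

(** Pairs are centre and radius. The closed ball [q] lies inside the ball [p], has at most half its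
    radius, and misses [{nrm X <= N}]. *)
Let shrunk (N : R) (p q : (C -> C) * R) : Prop :=
  mem V (fst q) /\ 0 < snd q <= snd p / 2 /\ nrm V (fsub (fst q) (fst p)) < snd p / 2 /\
  forall h, mem V h -> nrm V (fsub h (fst q)) <= snd q -> N < nrm X h.

Let nextb (N : R) (p : (C -> C) * R) : (C -> C) * R :=
  epsilon (inhabits (fzero, 0)) (shrunk N p).

Fixpoint balls (n : nat) : (C -> C) * R :=
  match n with
  | O => (fzero, 1)
  | S m => nextb (INR m) (balls m)
  end.

(** Otherwise nested balls avoiding [{nrm X <= n}] for all [n] shrink to a point of [V] whose
    [X]-norm exceeds every integer. *)
Local Lemma baire : exists N f0 r, 0 < r /\ mem V f0 /\
  forall f, mem V f -> nrm V (fsub f f0) < r -> dense_near N f.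
Proof.
  apply NNPP. intros Hno.
  assert (Hstep : forall N p, mem V (fst p) -> 0 < snd p -> shrunk N p (nextb N p)).
  { intros N [f0 r] Hf0 Hr. simpl in Hf0, Hr. apply epsilon_spec.
    apply NNPP. intros Hne. apply Hno. exists N, f0, (r / 2). split; [lra|]. split; [exact Hf0|].
    intros f Hf Hff0 eps He. apply NNPP. intros Hnh. apply Hne.
    exists (f, Rmin (r / 2) (eps / 2)). unfold shrunk; simpl. split; [exact Hf|]. split; [split|split].
    - apply Rmin_pos; lra.
    - apply Rmin_l.
    - exact Hff0.
    - intros h Hh Hhf. apply Rnot_le_lt. intros Hle. apply Hnh. exists h.
      split; [exact Hh|]. split; [|exact Hle].
      assert (Rmin (r / 2) (eps / 2) <= eps / 2) by apply Rmin_r. lra. }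
  assert (Hb : forall n, mem V (fst (balls n)) /\ 0 < snd (balls n)).
  { induction n as [|n [IH1 IH2]]; simpl.
    - split; [now apply banach_zero|lra].
    - destruct (Hstep (INR n) _ IH1 IH2) as [H1 [H2 _]]. split; [exact H1|apply H2]. }
  assert (Hs : forall n, shrunk (INR n) (balls n) (balls (S n)))
    by (intros n; apply Hstep; apply Hb).
  assert (Hin : forall n k, nrm V (fsub (fst (balls (n + k))) (fst (balls n))) + snd (balls (n + k))
      <= snd (balls n)).
  { intros n k. induction k as [|k IH].
    - rewrite Nat.add_0_r, (nrm_sub_self V HV). lra.
    - rewrite Nat.add_succ_r. destruct (Hs (n + k)%nat) as [H1 [H2 [H3 _]]].
      assert (H := nrm_sub_triangle V HV _ _ _ H1 (proj1 (Hb (n + k)%nat)) (proj1 (Hb n))). lra. }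
  assert (Hr : forall n, snd (balls n) <= (/ 2) ^ n).
  { induction n as [|n IH]; [simpl; lra|]. destruct (Hs n) as [_ [H2 _]]. simpl pow. lra. }
  assert (Hpair : forall n i, (n <= i)%nat ->
    nrm V (fsub (fst (balls i)) (fst (balls n))) <= snd (balls n)).
  { intros n i Hi. assert (H := Hin n (i - n)%nat).
    replace (n + (i - n))%nat with i in H by lia. destruct (Hb i). lra. }
  destruct (banach_complete V HV (fun n => fst (balls n)) (fun n => proj1 (Hb n))) as [f [Hf Hlim]].
  { intros eps He.
    destruct (half_pow_lt (eps / 2)) as [N HN]; [lra|].
    exists N. intros i j Hi Hj. specialize (HN N (le_n _)). specialize (Hr N).
    assert (H1 := Hpair N i Hi). assert (H2 := Hpair N j Hj).
    assert (H := nrm_sub_triangle V HV _ _ _ (proj1 (Hb i)) (proj1 (Hb N)) (proj1 (Hb j))).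
    rewrite (nrm_sub_sym V HV (fst (balls N))) in H by apply Hb. lra. }
  assert (Hfb : forall n, nrm V (fsub f (fst (balls n))) <= snd (balls n)).
  { intros n. apply le_epsilon. intros eps He.
    destruct (is_lim_seq_0_eps _ eps Hlim He) as [N HN]. specialize (HN (n + N)%nat ltac:(lia)).
    assert (H1 := Hpair n (n + N)%nat ltac:(lia)).
    assert (H := nrm_sub_triangle V HV f _ _ Hf (proj1 (Hb (n + N)%nat)) (proj1 (Hb n))).
    rewrite (nrm_sub_sym V HV f (fst (balls (n + N)))) in H by (try apply Hb; exact Hf).
    lra. }
  destruct (INR_unbounded (nrm X f)) as [n Hn].
  destruct (Hs n) as [_ [_ [_ H]]]. specialize (H f Hf (Hfb (S n))). lra.
Qed.

Section Telescope.

Variables (N r : R) (f : C -> C).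
Hypothesis Happ : forall f t eps, mem V f -> 0 < t -> nrm V f < r * t -> 0 < eps ->
  exists h, mem V h /\ nrm V (fsub h f) < eps /\ nrm X h <= N * t.
Hypothesis Hr : 0 < r.
Hypothesis Hf : mem V f.
Hypothesis Hfr : nrm V f < r.

Let approx (k : nat) (u : C -> C) : C -> C :=
  epsilon (inhabits fzero) (fun h => mem V h /\
    nrm V (fsub h u) < r * (/ 2) ^ S k /\ nrm X h <= N * (/ 2) ^ k).

Fixpoint remainder (k : nat) : C -> C :=
  match k with
  | O => f
  | S j => fsub (remainder j) (approx j (remainder j))
  end.

(** Each subtraction of an approximant halves the bound on the [V]-norm of the remainder, while the
    approximants cost at most [N * (/ 2) ^ k] in [X], hence [2 N] altogether. Their sum converges in
    [X], and point evaluations identify it with [f]. *)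
Local Lemma telescope : nrm X f <= 2 * N.
Proof.
  assert (Hp : forall n, 0 < (/ 2) ^ n) by (intros n; apply pow_lt; lra).
  assert (Ha : forall k u, mem V u -> nrm V u < r * (/ 2) ^ k ->
    mem V (approx k u) /\ nrm V (fsub (approx k u) u) < r * (/ 2) ^ S k /\
    nrm X (approx k u) <= N * (/ 2) ^ k).
  { intros k u Hu Hur. apply epsilon_spec. apply Happ; try assumption; [apply Hp|].
    apply Rmult_lt_0_compat; [exact Hr|apply Hp]. }
  assert (Hrem : forall k, mem V (remainder k) /\ nrm V (remainder k) < r * (/ 2) ^ k).
  { induction k as [|k [H1 H2]].
    - simpl. split; [exact Hf|lra].
    - destruct (Ha k _ H1 H2) as [A1 [A2 _]]. simpl remainder. split.
      + now apply banach_sub.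
      + rewrite (nrm_sub_sym V HV); auto. }
  set (s := fun k => fsub f (remainder k)).
  assert (Hs : forall k, mem X (s k)).
  { intros k. apply HVX, banach_sub; [exact HV|exact Hf|apply Hrem]. }
  assert (Hstep : forall k, nrm X (fsub (s (S k)) (s k)) <= N * (/ 2) ^ k).
  { intros k. destruct (Hrem k) as [H1 H2]. destruct (Ha k _ H1 H2) as [A1 [_ A3]].
    rewrite (banach_eq_nrm X HX (approx k (remainder k))); [exact A3| |now apply HVX].
    intros z _. unfold s, fsub. simpl remainder. unfold fsub. ring. }
  assert (Hsum : forall k j, nrm X (fsub (s (k + j)%nat) (s k))
    <= 2 * N * ((/ 2) ^ k - (/ 2) ^ (k + j))).
  { intros k j. induction j as [|j IH].
    - rewrite Nat.add_0_r, (nrm_sub_self X HX). lra.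
    - rewrite Nat.add_succ_r. assert (H := nrm_sub_triangle X HX _ _ _ (Hs (S (k + j))) (Hs (k + j)%nat) (Hs k)).
      specialize (Hstep (k + j)%nat). simpl pow. lra. }
  assert (HN : 0 <= N).
  { specialize (Hstep 0%nat). simpl in Hstep.
    assert (H := nrm_ge_0 X HX _ (banach_sub X HX _ _ (Hs 1%nat) (Hs 0%nat))). lra. }
  assert (Hcau : forall k i, (k <= i)%nat -> nrm X (fsub (s i) (s k)) <= 2 * N * (/ 2) ^ k).
  { intros k i Hi. assert (H := Hsum k (i - k)%nat).
    replace (k + (i - k))%nat with i in H by lia. specialize (Hp i). nra. }
  destruct (banach_complete X HX s Hs) as [L [HL Hlim]].
  { intros eps He. assert (Hq : 0 < eps / (4 * N + 1)) by (apply Rdiv_lt_0_compat; lra).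
    destruct (half_pow_lt _ Hq) as [n Hn].
    exists n. intros i j Hi Hj. specialize (Hn n (le_n _)). apply Rlt_div_r in Hn; [|lra].
    assert (H := nrm_sub_triangle X HX _ _ _ (Hs i) (Hs n) (Hs j)).
    rewrite (nrm_sub_sym X HX (s n) (s j)) in H by apply Hs.
    assert (H1 := Hcau n i Hi). assert (H2 := Hcau n j Hj). specialize (Hp n). lra. }
  assert (Hlim' := fun eps => is_lim_seq_0_eps _ eps Hlim).
  assert (E : eq_disc L f).
  { intros z Hz. destruct (HeX z Hz) as [M HM]. destruct (HeV z Hz) as [M' HM'].
    apply Cmod_le_eps. intros eps He.
    assert (HMa := Rabs_pos M). assert (HMa' := Rabs_pos M').
    set (q := eps / (1 + Rabs M + Rabs M')). assert (Hq : 0 < q) by (apply Rdiv_lt_0_compat; lra).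
    destruct (Hlim' q Hq) as [n1 H1].
    destruct (half_pow_lt (q / r)) as [n2 H2]; [now apply Rdiv_lt_0_compat|].
    set (n := (n1 + n2)%nat). specialize (H1 n ltac:(unfold n; lia)).
    specialize (H2 n ltac:(unfold n; lia)). apply Rlt_div_r in H2; [|lra].
    destruct (Hrem n) as [R1 R2].
    replace eps with (q * (1 + Rabs M + Rabs M')) by (unfold q; field; lra).
    replace (L z - f z)%C with (- (s n z - L z) - remainder n z)%C by (unfold s, fsub; ring).
    unfold Cminus at 1. eapply Rle_trans; [apply Cmod_triangle|]. rewrite !Cmod_opp.
    specialize (HM (fsub (s n) L) (banach_sub X HX _ _ (Hs n) HL)).
    specialize (HM' _ R1). unfold fsub in HM at 1.
    assert (HA := nrm_ge_0 X HX _ (banach_sub X HX _ _ (Hs n) HL)).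
    assert (HA' := nrm_ge_0 V HV _ R1).
    assert (G1 := Rle_abs M). assert (G2 := Rle_abs M'). nra. }
  rewrite (banach_eq_nrm X HX L f E HL).
  apply le_epsilon. intros eps He. destruct (Hlim' eps He) as [n Hn].
  specialize (Hn n (le_n _)).
  assert (H := nrm_triangle_minus X HX L (s n) HL (Hs n)).
  rewrite (nrm_sub_sym X HX L (s n) HL (Hs n)) in H.
  assert (H0 := nrm_triangle_minus X HX (s n) (s 0%nat) (Hs n) (Hs 0%nat)).
  assert (E0 : nrm X (s 0%nat) = 0) by apply (nrm_sub_self X HX).
  assert (H1 := Hcau 0%nat n ltac:(lia)). simpl in H1. lra.
Qed.

End Telescope.

(** The closed graph theorem for an inclusion of function spaces: Baire's argument in
    [V], followed by summing successive approximations in [X]. *)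
Lemma subspace_norm_bound : exists M, 0 <= M /\ forall f, mem V f -> nrm X f <= M * nrm V f.
Proof.
  destruct baire as [N [f0 [r [Hr [Hf0 Hd]]]]].
  (* The ball is moved to the origin by subtracting an approximant of [f0] from one of [f0 + f]:
     hence [2 * N] and the tolerances [eps / 2]. *)
  assert (H1 : forall f eps, mem V f -> nrm V f < r -> 0 < eps ->
    exists h, mem V h /\ nrm V (fsub h f) < eps /\ nrm X h <= 2 * N).
  { intros f eps Hf Hfr He.
    destruct (Hd (fadd f0 f)) with (eps := eps / 2) as [h1 [A1 [B1 C1]]]; [|..|lra|].
    - now apply banach_add.
    - rewrite (banach_eq_nrm V HV f); [exact Hfr| |exact Hf].
      intros z _. unfold fsub, fadd. ring.
    - destruct (Hd f0 Hf0) with (eps := eps / 2) as [h2 [A2 [B2 C2]]]; [|lra|].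
      + rewrite (nrm_sub_self V HV). exact Hr.
      + exists (fsub h1 h2). split; [now apply banach_sub|]. split.
        * rewrite (banach_eq_nrm V HV (fsub (fsub h1 (fadd f0 f)) (fsub h2 f0))).
          -- eapply Rle_lt_trans; [apply nrm_sub_le|]; [exact HV| | |lra].
             ++ apply banach_sub; [exact HV|exact A1|now apply banach_add].
             ++ now apply banach_sub.
          -- intros z _. unfold fsub, fadd. ring.
          -- apply banach_sub; [exact HV| |now apply banach_sub].
             apply banach_sub; [exact HV|exact A1|now apply banach_add].
        * eapply Rle_trans; [apply nrm_sub_le|]; [exact HX|now apply HVX|now apply HVX|lra]. }
  assert (H2 : forall f t eps, mem V f -> 0 < t -> nrm V f < r * t -> 0 < eps ->
    exists h, mem V h /\ nrm V (fsub h f) < eps /\ nrm X h <= 2 * N * t).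
  { intros f t eps Hf Ht Hft He. assert (Ht0 : RtoC t <> 0) by (apply RtoC_neq_0; lra).
    assert (Hti : 0 < / t) by now apply Rinv_0_lt_compat.
    destruct (H1 (fscal (RtoC (/ t)) f) (eps / t)) as [h [A [B C]]].
    - now apply banach_scal.
    - rewrite nrm_scal_pos by (try assumption; lra).
      apply Rmult_lt_reg_l with t; [exact Ht|]. rewrite <- Rmult_assoc, Rinv_r by lra. lra.
    - now apply Rdiv_lt_0_compat.
    - exists (fscal (RtoC t) h). split; [now apply banach_scal|]. split.
      + rewrite (banach_eq_nrm V HV (fscal (RtoC t) (fsub h (fscal (RtoC (/ t)) f)))).
        * rewrite nrm_scal_pos; [apply Rlt_div_r in B; lra|exact HV|lra|].
          apply banach_sub; [exact HV|exact A|now apply banach_scal].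
        * intros z _. unfold fscal, fsub. rewrite RtoC_inv by lra. now field.
        * apply banach_scal; [exact HV|].
          apply banach_sub; [exact HV|exact A|now apply banach_scal].
      + rewrite nrm_scal_pos; [|exact HX|lra|now apply HVX]. rewrite Rmult_comm. now apply Rmult_le_compat_r; [lra|]. }
  assert (H3 : forall f, mem V f -> nrm V f < r -> nrm X f <= 2 * (2 * N)).
  { intros f Hf Hfr. exact (telescope (2 * N) r f H2 Hr Hf Hfr). }
  assert (HN : 0 <= 2 * (2 * N)).
  { rewrite <- (nrm_fzero X HX). apply H3; [now apply banach_zero|]. now rewrite (nrm_fzero V HV). }
  (* On the ball of radius [r] the bound is [2 * (2 * N)]; scaling [f] to [V]-norm [r / 2] gives the
     factor [2 / r]. *)
  exists (2 * (2 * N) * 2 / r). split; [apply Rdiv_le_0_compat; lra|]. intros f Hf.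
  destruct (Rle_lt_or_eq_dec 0 (nrm V f) (nrm_ge_0 V HV f Hf)) as [Hpos|Hzero].
  - set (c := r / (2 * nrm V f)). assert (Hc : 0 < c) by (apply Rdiv_lt_0_compat; lra).
    assert (H := H3 (fscal (RtoC c) f) (banach_scal V HV _ _ Hf)).
    rewrite !nrm_scal_pos in H by (try assumption; try lra; now apply HVX).
    assert (Hcr : c * nrm V f < r).
    { unfold c. replace (r / (2 * nrm V f) * nrm V f) with (r / 2) by (field; lra). lra. }
    specialize (H Hcr). apply Rmult_le_reg_l with c; [exact Hc|].
    eapply Rle_trans; [exact H|]. right. unfold c. field. lra.
  - rewrite <- Hzero, Rmult_0_r. right. apply (nrm_null X HX).
    apply banach_norm_eq0 with V; auto.
Qed.

End ClosedGraph.

(** * [Hinfty] and the disc algebra are Banach spaces *)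

Definition clim (u : nat -> C) (l : C) : Prop :=
  forall eps, 0 < eps -> exists N, forall n, (N <= n)%nat -> Cmod (u n - l) <= eps.

Lemma clim_cauchy (u : nat -> C) :
  (forall eps, 0 < eps -> exists N, forall n m, (N <= n)%nat -> (N <= m)%nat ->
     Cmod (u n - u m) <= eps) -> exists l, clim u l.
Proof.
  intros H.
  destruct (proj1 (filterlim_locally_cauchy (U := C_CompleteNormedModule) (F := eventually) u))
    as [l Hl].
  - intros eps. assert (He := cond_pos eps). destruct (H (eps / 2)) as [N HN]; [lra|].
    exists (fun n => (N <= n)%nat). split; [now exists N|]. intros n m Hn Hm.
    apply C_NormedModule_mixin_compat1. eapply Rle_lt_trans; [now apply HN|lra].
  - exists l. intros eps He.
    destruct (proj1 (filterlim_Cmod eventually u l) Hl eps He) as [N HN].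
    exists N. intros n Hn. now apply Rlt_le, HN.
Qed.

Lemma clim_le (u : nat -> C) (l c : C) (M : R) (N : nat) :
  clim u l -> (forall n, (N <= n)%nat -> Cmod (u n - c) <= M) -> Cmod (l - c) <= M.
Proof.
  intros Hl H. apply le_epsilon. intros eps He. destruct (Hl eps He) as [N' HN'].
  specialize (H (N + N')%nat ltac:(lia)). specialize (HN' (N + N')%nat ltac:(lia)).
  rewrite Cmod_minus_sym in HN'. generalize (Cmod_dist (u (N + N')%nat) l c). lra.
Qed.

Lemma taylor_coef_sub (f h : C -> C) (n : nat) : analytic f -> analytic h ->
  taylor_coef (fsub f h) n = (taylor_coef f n - taylor_coef h n)%C.
Proof.
  intros Hf Hh. apply (psum_taylor (fun n => taylor_coef f n - taylor_coef h n)%C _ 1); [lra|].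
  intros z Hz. eapply cser_ext; [|apply cser_minus; [apply (analytic_taylor f z Hf Hz)|
    apply (analytic_taylor h z Hh Hz)]]. intros n0. simpl. ring.
Qed.

(** Cauchy's estimate on the circle of radius [1 - s], with [s] so small that [(1 - s) ^ n] is
    nearly [1]. *)
Lemma taylor_coef_bound (f : C -> C) (M : R) (n : nat) : analytic f ->
  (forall z, disc z -> Cmod (f z) <= M) -> Cmod (taylor_coef f n) <= M.
Proof.
  intros Hf HM. set (c := Cmod (taylor_coef f n)). assert (Hc : 0 <= c) by apply Cmod_ge_0.
  apply le_epsilon. intros eps He.
  destruct (cderiv_ccont _ _ _ (cderiv_pow n 1) (eps / (1 + c))) as [d [Hd H1]];
    [apply Rdiv_lt_0_compat; lra|].
  set (s := Rmin (/ 2) (d / 2)). assert (Hs : 0 < s) by (apply Rmin_pos; lra).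
  assert (Hs1 : s <= / 2) by apply Rmin_l. assert (Hs2 : s <= d / 2) by apply Rmin_r.
  assert (H : c * (1 - s) ^ n <= M).
  { apply (holo_cauchy_estimate f (C_derive f) 1); [now apply analytic_holo|lra|].
    intros w Hw. apply HM. unfold disc. lra. }
  specialize (H1 (RtoC (1 - s))). rewrite Cpow_1_l, <- RtoC_pow, <- !RtoC_minus, !Cmod_R in H1.
  specialize (H1 ltac:(apply Rabs_def1; lra)). apply Rabs_def2 in H1.
  replace eps with ((1 + c) * (eps / (1 + c))) by (field; lra).
  assert (Hq : 0 < eps / (1 + c)) by (apply Rdiv_lt_0_compat; lra). nra.
Qed.

(** Coefficients are bounded by suprema over the disc, so those of [u n] converge uniformly in their
    index. The limits are the coefficients of a power series, which is then compared with [f]. *)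
Lemma uniform_limit_analytic (u : nat -> C -> C) (f : C -> C) :
  (forall n, analytic (u n)) ->
  (forall eps, 0 < eps -> exists N, forall n z, (N <= n)%nat -> disc z ->
     Cmod (u n z - f z) <= eps) -> analytic f.
Proof.
  intros Hu Hlim.
  assert (Hcau : forall eps, 0 < eps -> exists N, forall k n m, (N <= n)%nat -> (N <= m)%nat ->
    Cmod (taylor_coef (u n) k - taylor_coef (u m) k) <= eps).
  { intros eps He. destruct (Hlim (eps / 2)) as [N HN]; [lra|]. exists N. intros k n m Hn Hm.
    rewrite <- taylor_coef_sub by apply Hu.
    apply taylor_coef_bound; [apply analytic_minus; apply Hu|].
    intros z Hz. assert (H1 := HN n z Hn Hz). assert (H2 := HN m z Hm Hz).
    rewrite Cmod_minus_sym in H2. generalize (Cmod_dist (f z) (u n z) (u m z)). unfold fsub. lra. }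
  assert (Ha : forall k, exists l, clim (fun n => taylor_coef (u n) k) l).
  { intros k. apply clim_cauchy. intros eps He. destruct (Hcau eps He) as [N HN]. exists N.
    intros n m. apply HN. }
  set (a := fun k => epsilon (inhabits (RtoC 0)) (clim (fun n => taylor_coef (u n) k))).
  assert (Hau : forall eps, 0 < eps -> exists N, forall k n, (N <= n)%nat ->
    Cmod (a k - taylor_coef (u n) k) <= eps).
  { intros eps He. destruct (Hcau eps He) as [N HN]. exists N. intros k n Hn.
    apply (clim_le _ _ _ _ N (epsilon_spec (inhabits (RtoC 0)) _ (Ha k))).
    intros m Hm. now apply HN. }
  assert (Hbd : coef_bd a 1).
  { destruct (Hau 1 Rlt_0_1) as [N HN]. intros r Hr.
    destruct (analytic_taylor_bd (u N) (Hu N) r Hr) as [M HM]. exists (1 + M). intros k.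
    specialize (HM k). specialize (HN k N (le_n _)).
    assert (Hp := pow_le r k (proj1 Hr)). assert (Hp1 := pow_incr r 1 k ltac:(lra)).
    rewrite pow1 in Hp1.
    assert (Ht := Cmod_triangle_minus (a k) (taylor_coef (u N) k)). nra. }
  apply (psum_analytic a). intros z Hz. destruct (coef_bd_psum a 1 z Hbd Hz) as [A HA].
  replace (f z) with A; [exact HA|].
  unfold disc in Hz. assert (Hz0 := Cmod_ge_0 z). apply Cmod_le_eps. intros eps He.
  (* Chosen so that the geometric series of ratio [|z|] with factor [e] sums to [eps / 2]. *)
  set (e := eps * (1 - Cmod z) / 2). assert (He0 : 0 < e) by (unfold e; nra).
  destruct (Hau e He0) as [N1 H1]. destruct (Hlim (eps / 2)) as [N2 H2]; [lra|].
  set (n := (N1 + N2)%nat). specialize (H2 n z ltac:(unfold n; lia) Hz).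
  assert (HT := cser_minus _ _ _ _ HA (analytic_taylor (u n) z (Hu n) Hz)).
  apply (cser_norm_le _ _ (fun j => Cmod z ^ j * e) (/ (1 - Cmod z) * e)) in HT.
  - replace (/ (1 - Cmod z) * e) with (eps / 2) in HT by (unfold e; field; lra).
    generalize (Cmod_dist (u n z) A (f z)). lra.
  - intros j. replace (a j * z ^ j - taylor_coef (u n) j * z ^ j)%C
      with (z ^ j * (a j - taylor_coef (u n) j))%C by ring.
    rewrite Cmod_mult, Cmod_pow. apply Rmult_le_compat_l; [apply pow_le; lra|].
    apply H1. unfold n. lia.
  - apply is_series_scal_r, is_series_geom. rewrite Rabs_pos_eq; lra.
Qed.

Definition bounded_disc (f : C -> C) : Prop := exists M, forall z, disc z -> Cmod (f z) <= M.

(** [real] sends an infinite supremum to [0]; boundedness is what makes [sup_norm] the true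
    supremum. *)
Lemma sup_norm_finite (f : C -> C) : bounded_disc f ->
  Lub_Rbar (fun x => exists z, disc z /\ x = Cmod (f z)) = Finite (sup_norm f).
Proof.
  intros [M HM]. unfold sup_norm.
  destruct (Lub_Rbar_correct (fun x => exists z, disc z /\ x = Cmod (f z))) as [H1 H2].
  assert (HA := H1 (Cmod (f 0)) (ex_intro _ _ (conj disc_0 eq_refl))).
  assert (HB : Rbar_le (Lub_Rbar (fun x => exists z, disc z /\ x = Cmod (f z))) M).
  { apply H2. intros x [z [Hz ->]]. now apply HM. }
  destruct (Lub_Rbar _); simpl in *; easy.
Qed.

Lemma sup_norm_ub (f : C -> C) (z : C) : bounded_disc f -> disc z -> Cmod (f z) <= sup_norm f.
Proof.
  intros Hf Hz.
  destruct (Lub_Rbar_correct (fun x => exists z, disc z /\ x = Cmod (f z))) as [H _].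
  rewrite (sup_norm_finite f Hf) in H. apply (H (Cmod (f z))). now exists z.
Qed.

Lemma sup_norm_le (f : C -> C) (M : R) :
  (forall z, disc z -> Cmod (f z) <= M) -> sup_norm f <= M.
Proof.
  intros HM.
  destruct (Lub_Rbar_correct (fun x => exists z, disc z /\ x = Cmod (f z))) as [_ H].
  rewrite (sup_norm_finite f (ex_intro _ M HM)) in H. apply (H (Finite M)).
  intros x [z [Hz ->]]. now apply HM.
Qed.

Lemma bounded_disc_ext (f h : C -> C) : eq_disc f h -> bounded_disc f -> bounded_disc h.
Proof. intros E [M HM]. exists M. intros z Hz. rewrite <- E by exact Hz. now apply HM. Qed.

Lemma sup_norm_ext (f h : C -> C) : eq_disc f h -> bounded_disc f -> sup_norm h = sup_norm f.
Proof.
  intros E Hf. apply Rle_antisym; apply sup_norm_le; intros z Hz.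
  - rewrite <- E by exact Hz. now apply sup_norm_ub.
  - rewrite E by exact Hz. apply sup_norm_ub; [|exact Hz]. now apply (bounded_disc_ext f).
Qed.

Lemma sup_norm_ge_0 (f : C -> C) : bounded_disc f -> 0 <= sup_norm f.
Proof. intros Hf. eapply Rle_trans; [apply Cmod_ge_0|apply (sup_norm_ub f 0 Hf disc_0)]. Qed.

Lemma bounded_disc_add (f h : C -> C) : bounded_disc f -> bounded_disc h -> bounded_disc (fadd f h).
Proof.
  intros [M HM] [M' HM']. exists (M + M'). intros z Hz.
  eapply Rle_trans; [apply Cmod_triangle|]. apply Rplus_le_compat; auto.
Qed.

Lemma bounded_disc_scal (c : C) (f : C -> C) : bounded_disc f -> bounded_disc (fscal c f).
Proof.
  intros [M HM]. exists (Cmod c * M). intros z Hz. unfold fscal. rewrite Cmod_mult.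
  apply Rmult_le_compat_l; [apply Cmod_ge_0|auto].
Qed.

Lemma bounded_disc_sub (f h : C -> C) : bounded_disc f -> bounded_disc h -> bounded_disc (fsub f h).
Proof.
  intros Hf Hh. apply (bounded_disc_ext (fadd f (fscal (-(1)) h))).
  - intros z _. unfold fadd, fscal, fsub. ring.
  - now apply bounded_disc_add, bounded_disc_scal.
Qed.

Lemma sup_norm_scal (c : C) (f : C -> C) : bounded_disc f ->
  sup_norm (fscal c f) = Cmod c * sup_norm f.
Proof.
  intros Hf. assert (Hc := Cmod_ge_0 c). apply Rle_antisym.
  - apply sup_norm_le. intros z Hz. unfold fscal. rewrite Cmod_mult.
    apply Rmult_le_compat_l; [exact Hc|now apply sup_norm_ub].
  - assert (Hb := bounded_disc_scal c f Hf).
    destruct (Rle_lt_or_eq_dec 0 (Cmod c) Hc) as [Hp|<-].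
    + rewrite Rmult_comm. apply Rle_div_r; [lra|]. apply sup_norm_le. intros z Hz.
      apply Rle_div_r; [lra|]. rewrite Rmult_comm, <- Cmod_mult.
      apply (sup_norm_ub (fscal c f) z Hb Hz).
    + rewrite Rmult_0_l. now apply sup_norm_ge_0.
Qed.

Lemma sup_norm_triangle (f h : C -> C) : bounded_disc f -> bounded_disc h ->
  sup_norm (fadd f h) <= sup_norm f + sup_norm h.
Proof.
  intros Hf Hh. apply sup_norm_le. intros z Hz. eapply Rle_trans; [apply Cmod_triangle|].
  apply Rplus_le_compat; now apply sup_norm_ub.
Qed.

(** Serves both spaces: the last conjunct lets boundary continuity pass to the limit. *)
Lemma sup_norm_complete (u : nat -> C -> C) :
  (forall n, analytic (u n) /\ bounded_disc (u n)) ->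
  (forall eps, 0 < eps -> exists N, forall n m, (N <= n)%nat -> (N <= m)%nat ->
     sup_norm (fsub (u n) (u m)) < eps) ->
  exists f, analytic f /\ bounded_disc f /\
    is_lim_seq (fun n => sup_norm (fsub (u n) f)) 0 /\
    (forall eps, 0 < eps -> exists n, forall z, disc z -> Cmod (u n z - f z) <= eps).
Proof.
  intros Hu Hc.
  assert (Hb : forall n m, bounded_disc (fsub (u n) (u m)))
    by (intros n m; apply bounded_disc_sub; apply Hu).
  assert (Hpt : forall eps, 0 < eps -> exists N, forall n m z, (N <= n)%nat -> (N <= m)%nat ->
    disc z -> Cmod (u n z - u m z) <= eps).
  { intros eps He. destruct (Hc eps He) as [N HN]. exists N. intros n m z Hn Hm Hz.
    specialize (HN n m Hn Hm). generalize (sup_norm_ub _ z (Hb n m) Hz). unfold fsub at 1. lra. }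
  set (f := fun z => epsilon (inhabits (RtoC 0)) (clim (fun n => u n z))).
  assert (Hf : forall z, disc z -> clim (fun n => u n z) (f z)).
  { intros z Hz. apply (epsilon_spec (inhabits (RtoC 0)) (clim (fun n => u n z))).
    apply clim_cauchy. intros eps He.
    destruct (Hpt eps He) as [N HN]. exists N. intros n m Hn Hm. now apply HN. }
  assert (Hunif : forall eps, 0 < eps -> exists N, forall n z, (N <= n)%nat -> disc z ->
    Cmod (u n z - f z) <= eps).
  { intros eps He. destruct (Hpt eps He) as [N HN]. exists N. intros n z Hn Hz.
    rewrite Cmod_minus_sym. apply (clim_le _ _ _ _ N (Hf z Hz)). intros m Hm. now apply HN. }
  assert (Hbf : bounded_disc f).
  { destruct (Hunif 1) as [N HN]; [lra|]. destruct (proj2 (Hu N)) as [M HM].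
    exists (M + 1). intros z Hz. specialize (HN N z (le_n _) Hz). rewrite Cmod_minus_sym in HN.
    specialize (HM z Hz). generalize (Cmod_triangle_minus (f z) (u N z)). lra. }
  exists f. split; [|split; [exact Hbf|split]].
  - apply (uniform_limit_analytic u); [intros n; apply Hu|exact Hunif].
  - apply is_lim_seq_spec. intros eps. destruct (Hunif (eps / 2)) as [N HN].
    { generalize (cond_pos eps). lra. }
    exists N. intros n Hn. rewrite Rminus_0_r, Rabs_pos_eq.
    + apply Rle_lt_trans with (eps / 2); [|generalize (cond_pos eps); lra].
      apply sup_norm_le. intros z Hz. now apply HN.
    + apply sup_norm_ge_0, bounded_disc_sub; [apply Hu|exact Hbf].
  - intros eps He. destruct (Hunif eps He) as [N HN]. exists N. intros z Hz. now apply HN.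
Qed.

Lemma banach_Hinfty : banach Hinfty.
Proof.
  constructor; simpl.
  - intros f [Hf _]. exact Hf.
  - intros f h E [Hf Hb]. split; [split|].
    + now apply (analytic_ext f).
    + now apply (bounded_disc_ext f).
    + now apply sup_norm_ext.
  - split; [apply analytic_const|]. exists 0. intros z _. unfold fzero. rewrite Cmod_0. lra.
  - intros f h [Hf Hbf] [Hh Hbh]. split; [now apply analytic_plus|now apply bounded_disc_add].
  - intros c f [Hf Hbf]. split; [now apply analytic_scal|now apply bounded_disc_scal].
  - intros f [_ Hb] E z Hz. apply Cmod_eq_0. apply Rle_antisym; [|apply Cmod_ge_0].
    rewrite <- E. now apply sup_norm_ub.
  - intros c f [_ Hb]. now apply sup_norm_scal.
  - intros f h [_ Hf] [_ Hh]. now apply sup_norm_triangle.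
  - intros u Hu Hc. destruct (sup_norm_complete u Hu Hc) as [f [H1 [H2 [H3 _]]]].
    exists f. split; [now split|exact H3].
Qed.

(** A Cauchy criterion inside the disc at each boundary point. It replaces the extension [F] of
    [disc_algebra], so sums, products and uniform limits require no choice of extension. *)
Definition bdry_cont (f : C -> C) : Prop :=
  forall zeta, Cmod zeta = 1 -> forall eps, 0 < eps -> exists d, 0 < d /\
    forall z w, disc z -> disc w -> Cmod (z - zeta) < d -> Cmod (w - zeta) < d ->
      Cmod (f z - f w) <= eps.

Lemma disc_near (zeta : C) (d : R) : Cmod zeta <= 1 -> 0 < d ->
  exists z, disc z /\ Cmod (z - zeta) < d.
Proof.
  intros Hz Hd. set (s := Rmin (/ 2) (d / 2)).
  assert (Hs : 0 < s) by (apply Rmin_pos; lra).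
  assert (Hs1 : s <= / 2) by apply Rmin_l. assert (Hs2 : s <= d / 2) by apply Rmin_r.
  assert (H0 := Cmod_ge_0 zeta). exists (RtoC (1 - s) * zeta)%C. split.
  - unfold disc. rewrite Cmod_scal_pos by lra. nra.
  - replace (RtoC (1 - s) * zeta - zeta)%C with (RtoC (- s) * zeta)%C
      by (rewrite RtoC_minus, RtoC_opp; ring).
    rewrite Cmod_mult, Cmod_R, Rabs_Ropp, Rabs_pos_eq by lra. nra.
Qed.

Definition disc_lim (f : C -> C) (zeta l : C) : Prop :=
  forall eps, 0 < eps -> exists d, 0 < d /\
    forall z, disc z -> Cmod (z - zeta) < d -> Cmod (f z - l) <= eps.

Lemma bdry_cont_lim (f : C -> C) (zeta : C) : analytic f -> bdry_cont f -> Cmod zeta <= 1 ->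
  exists l, disc_lim f zeta l.
Proof.
  intros Ha Hf Hz. destruct (Rle_lt_or_eq_dec _ _ Hz) as [Hlt|Heq].
  - exists (f zeta). intros eps He. destruct (analytic_ccont f zeta Ha Hlt eps He) as [d [Hd H]].
    exists d. split; [exact Hd|]. intros z _ Hzd. now apply Rlt_le, H.
  - assert (Hp : forall n, 0 < / (INR n + 1)) by (intros n; apply Rinv_0_lt_compat; generalize (pos_INR n); lra).
    set (p := fun n => epsilon (inhabits (RtoC 0)) (fun z => disc z /\ Cmod (z - zeta) < / (INR n + 1))).
    assert (Hps : forall n, disc (p n) /\ Cmod (p n - zeta) < / (INR n + 1)).
    { intros n. exact (epsilon_spec (inhabits (RtoC 0)) _ (disc_near zeta _ Hz (Hp n))). }
    assert (Hpd : forall d, 0 < d -> exists N, forall n, (N <= n)%nat -> Cmod (p n - zeta) < d).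
    { intros d Hd. destruct (INR_unbounded (/ d)) as [N HN]. exists N. intros n Hn.
      eapply Rlt_trans; [apply Hps|]. rewrite <- (Rinv_inv d).
      assert (Hi : 0 < / d) by now apply Rinv_0_lt_compat. apply le_INR in Hn.
      apply Rinv_lt_contravar; [apply Rmult_lt_0_compat|]; lra. }
    destruct (clim_cauchy (fun n => f (p n))) as [l Hl].
    { intros eps He. destruct (Hf zeta Heq eps He) as [d [Hd H]].
      destruct (Hpd d Hd) as [N HN]. exists N. intros n m Hn Hm. apply H; try apply Hps; auto. }
    exists l. intros eps He. destruct (Hf zeta Heq eps He) as [d [Hd H]]. exists d.
    split; [exact Hd|]. intros z Hzd Hzz. destruct (Hpd d Hd) as [N HN].
    rewrite Cmod_minus_sym. apply (clim_le _ _ _ _ N Hl). intros n Hn.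
    apply H; try assumption; [apply Hps|now apply HN].
Qed.

Lemma mem_disc_algebra (f : C -> C) : mem disc_algebra f <-> analytic f /\ bdry_cont f.
Proof.
  simpl. split; intros [Ha Hf]; (split; [exact Ha|]).
  - destruct Hf as [F [E HF]]. intros zeta Hz eps He.
    specialize (HF zeta ltac:(lra)).
    assert (HF' := proj1 (filterlim_Cmod (within (fun w : C => Cmod w <= 1)
      (locally (T := C_UniformSpace) zeta)) F (F zeta)) HF (eps / 2) ltac:(lra)).
    apply locally_Cmod in HF'. destruct HF' as [d [Hd H]].
    exists d. split; [exact Hd|]. intros z w Hzd Hwd Hz1 Hw1.
    unfold disc in *. rewrite (E z), (E w) by assumption.
    assert (A := H z Hz1 ltac:(lra)). assert (B := H w Hw1 ltac:(lra)).
    rewrite Cmod_minus_sym in B. generalize (Cmod_dist (F zeta) (F z) (F w)). lra.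
  - set (F := fun zeta => epsilon (inhabits (RtoC 0)) (disc_lim f zeta)).
    assert (HF : forall zeta, Cmod zeta <= 1 -> disc_lim f zeta (F zeta)).
    { intros zeta Hz. apply epsilon_spec. now apply bdry_cont_lim. }
    exists F. split.
    + intros z Hz. apply Cmod_le_eps. intros eps He.
      destruct (HF z ltac:(unfold disc in Hz; lra) eps He) as [d [Hd H]]. apply H; [exact Hz|].
      rewrite Cmod_minus_diag. exact Hd.
    + intros zeta Hz.
      apply (proj2 (filterlim_Cmod (within (fun w : C => Cmod w <= 1)
        (locally (T := C_UniformSpace) zeta)) F (F zeta))).
      intros eps He. apply locally_Cmod.
      destruct (HF zeta Hz (eps / 3)) as [d [Hd H]]; [lra|]. exists d. split; [exact Hd|].
      intros w Hw Hw1. destruct (HF w Hw1 (eps / 3)) as [d' [Hd' H']]; [lra|].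
      (* At [w] on the circle only limits of [f] are known, so [F w] and [F zeta] are compared
         through a point [z] of the disc close to [w] and still within [d] of [zeta]. *)
      destruct (disc_near w (Rmin d' (d - Cmod (w - zeta))) Hw1) as [z [Hzd Hzw]].
      { apply Rmin_pos; lra. }
      specialize (H' z Hzd (lt_Rmin_l _ _ _ Hzw)).
      assert (Hzw' := lt_Rmin_r _ _ _ Hzw).
      assert (Hzz : Cmod (z - zeta) < d) by (generalize (Cmod_dist w z zeta); lra).
      specialize (H z Hzd Hzz). rewrite Cmod_minus_sym in H'.
      generalize (Cmod_dist (f z) (F w) (F zeta)). lra.
Qed.

(** A Lebesgue number for the unit circle, from compactness of a square. *)
Lemma bdry_cont_uniform (f : C -> C) : bdry_cont f -> exists d, 0 < d /\
  forall zeta z w, Cmod zeta = 1 -> disc z -> disc w ->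
    Cmod (z - zeta) < d -> Cmod (w - zeta) < d -> Cmod (f z - f w) <= 1.
Proof.
  intros Hf.
  (* Off the circle the gauge is too small for a circle point to be attached to [(x, y)]. On it,
     [4 * e] leaves room for the [2 * e] between round and square distance plus the final [d]. *)
  assert (Hg : forall x y : R, exists e : posreal,
    (Cmod (x, y) <> 1 -> 2 * e <= Rabs (Cmod (x, y) - 1)) /\
    (Cmod (x, y) = 1 -> forall z w, disc z -> disc w ->
       Cmod (z - (x, y)) < 4 * e -> Cmod (w - (x, y)) < 4 * e -> Cmod (f z - f w) <= 1)).
  { intros x y. destruct (Req_dec (Cmod (x, y)) 1) as [E|Hne].
    - destruct (Hf _ E 1) as [d [Hd H]]; [lra|]. assert (Hd4 : 0 < d / 4) by lra.
      exists (mkposreal _ Hd4). split; [easy|]. intros _ z w Hz Hw. simpl.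
      intros Hz' Hw'. apply H; try assumption; lra.
    - assert (Hp : 0 < Rabs (Cmod (x, y) - 1) / 2).
      { assert (0 < Rabs (Cmod (x, y) - 1)) by (apply Rabs_pos_lt; lra). lra. }
      exists (mkposreal _ Hp). split; [simpl; lra|easy]. }
  assert (pos1 : inhabited posreal) by (exact (inhabits (mkposreal 1 Rlt_0_1))).
  set (gauge := fun x y : R => epsilon pos1 (fun e : posreal =>
    (Cmod (x, y) <> 1 -> 2 * e <= Rabs (Cmod (x, y) - 1)) /\
    (Cmod (x, y) = 1 -> forall z w, disc z -> disc w ->
       Cmod (z - (x, y)) < 4 * e -> Cmod (w - (x, y)) < 4 * e -> Cmod (f z - f w) <= 1))).
  destruct (compactness_value_2d (-1) 1 (-1) 1 gauge) as [d Hd].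
  exists d. split; [apply cond_pos|]. intros zeta z w Hzeta Hz Hw Hzd Hwd.
  assert (Hre := re_le_Cmod zeta). assert (Him := im_le_Cmod zeta).
  rewrite Hzeta in Hre, Him. apply Rabs_le_between in Hre, Him.
  apply NNPP. intros Hno. apply (Hd (Re zeta) (Im zeta) Hre Him).
  intros [u [v [_ [_ [Hu [Hv Hduv]]]]]]. apply Hno. clear Hno Hd.
  destruct (epsilon_spec pos1 _ (Hg u v)) as [H1 H2]. fold (gauge u v) in H1, H2.
  assert (Hdist : Cmod (zeta - (u, v)) < 2 * gauge u v).
  { eapply Rle_lt_trans; [apply Cmod_le_re_im|]. rewrite Re_minus, Im_minus. simpl Re at 2. simpl Im at 2.
    lra. }
  destruct (Req_dec (Cmod (u, v)) 1) as [E|Hne].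
  - apply (H2 E); try assumption.
    + generalize (cond_pos (gauge u v)) (Cmod_dist zeta z (u, v)). lra.
    + generalize (cond_pos (gauge u v)) (Cmod_dist zeta w (u, v)). lra.
  - exfalso. specialize (H1 Hne).
    assert (A := Cmod_triangle_minus zeta (u, v)). assert (B := Cmod_triangle_minus (u, v) zeta).
    rewrite (Cmod_minus_sym (u, v) zeta) in B. rewrite Hzeta in A, B.
    revert H1. unfold Rabs. destruct (Rcase_abs _); lra.
Qed.

(** A point of the thin outer annulus is compared with the point of modulus [1 - s] on the same ray;
    both are close to the same [zeta], so the values differ by at most [1]. *)
Lemma bdry_cont_bounded (f : C -> C) : analytic f -> bdry_cont f -> bounded_disc f.
Proof.
  intros Ha Hf. destruct (bdry_cont_uniform f Hf) as [d [Hd H]].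
  set (s := Rmin (/ 2) (d / 2)).
  assert (Hs : 0 < s) by (apply Rmin_pos; lra).
  assert (Hs1 : s <= / 2) by apply Rmin_l. assert (Hs2 : s <= d / 2) by apply Rmin_r.
  destruct (analytic_bounded f (1 - s) Ha) as [M [HM0 HM]]; [lra|].
  exists (M + 1). intros z Hz. unfold disc in Hz.
  destruct (Rle_lt_dec (Cmod z) (1 - s)) as [Hle|Hlt]; [specialize (HM z Hle); lra|].
  set (m := Cmod z) in *. assert (Hm0 : RtoC m <> 0) by (apply RtoC_neq_0; lra).
  set (zeta := (RtoC (/ m) * z)%C).
  assert (Hzeta : Cmod zeta = 1).
  { unfold zeta. rewrite Cmod_mult, Cmod_R, Rabs_pos_eq by (apply Rlt_le, Rinv_0_lt_compat; lra).
    fold m. field. lra. }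
  assert (Hzd : Cmod (z - zeta) < d).
  { replace (z - zeta)%C with (RtoC (m - 1) * zeta)%C.
    - rewrite Cmod_mult, Hzeta, Cmod_R, Rabs_left by lra. lra.
    - unfold zeta. rewrite RtoC_minus, RtoC_inv by lra. now field. }
  assert (Hwz : Cmod (RtoC (1 - s) * zeta) = 1 - s).
  { rewrite Cmod_mult, Hzeta, Cmod_R, Rabs_pos_eq by lra. ring. }
  assert (Hwd : Cmod (RtoC (1 - s) * zeta - zeta) < d).
  { replace (RtoC (1 - s) * zeta - zeta)%C with (RtoC (- s) * zeta)%C
      by (rewrite RtoC_minus, RtoC_opp; ring).
    rewrite Cmod_mult, Hzeta, Cmod_R, Rabs_Ropp, Rabs_pos_eq by lra. lra. }
  assert (HH := H zeta z (RtoC (1 - s) * zeta)%C Hzeta Hz ltac:(unfold disc; lra) Hzd Hwd).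
  specialize (HM _ (Req_le _ _ Hwz)).
  generalize (Cmod_triangle_minus (f z) (f (RtoC (1 - s) * zeta)%C)). lra.
Qed.

Lemma disc_algebra_Hinfty (f : C -> C) : mem disc_algebra f -> mem Hinfty f.
Proof.
  intros H. apply (proj1 (mem_disc_algebra _)) in H. destruct H as [Ha Hf].
  split; [exact Ha|]. now apply bdry_cont_bounded.
Qed.

Lemma bdry_cont_uniform_limit (f : C -> C) :
  (forall eps, 0 < eps -> exists h, bdry_cont h /\ forall z, disc z -> Cmod (h z - f z) <= eps) ->
  bdry_cont f.
Proof.
  intros H zeta Hz eps He. destruct (H (eps / 3)) as [h [Hh Hhf]]; [lra|].
  destruct (Hh zeta Hz (eps / 3)) as [d [Hd Hd']]; [lra|]. exists d. split; [exact Hd|].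
  intros z w Hzd Hwd Hz1 Hw1. specialize (Hd' z w Hzd Hwd Hz1 Hw1).
  assert (A := Hhf z Hzd). assert (B := Hhf w Hwd). rewrite Cmod_minus_sym in A.
  generalize (Cmod_dist (h z) (f z) (f w)) (Cmod_dist (h w) (h z) (f w)). lra.
Qed.

Lemma bdry_cont_ext (f h : C -> C) : eq_disc f h -> bdry_cont f -> bdry_cont h.
Proof.
  intros E Hf zeta Hz eps He. destruct (Hf zeta Hz eps He) as [d [Hd H]]. exists d.
  split; [exact Hd|]. intros z w Hzd Hwd. rewrite <- !E by assumption. now apply H.
Qed.

Lemma bdry_cont_add (f h : C -> C) : bdry_cont f -> bdry_cont h -> bdry_cont (fadd f h).
Proof.
  intros Hf Hh zeta Hz eps He. destruct (Hf zeta Hz (eps / 2)) as [d [Hd H]]; [lra|].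
  destruct (Hh zeta Hz (eps / 2)) as [d' [Hd' H']]; [lra|]. exists (Rmin d d').
  split; [now apply Rmin_pos|]. intros z w Hzd Hwd Hz1 Hw1.
  assert (A := H z w Hzd Hwd (lt_Rmin_l _ _ _ Hz1) (lt_Rmin_l _ _ _ Hw1)).
  assert (B := H' z w Hzd Hwd (lt_Rmin_r _ _ _ Hz1) (lt_Rmin_r _ _ _ Hw1)).
  unfold fadd. replace (f z + h z - (f w + h w))%C with ((f z - f w) + (h z - h w))%C by ring.
  eapply Rle_trans; [apply Cmod_triangle|]. lra.
Qed.

Lemma lipschitz_bdry_cont (f : C -> C) (L : R) :
  (forall z w, disc z -> disc w -> Cmod (f z - f w) <= L * Cmod (z - w)) -> bdry_cont f.
Proof.
  intros H zeta Hz eps He. assert (HL := Rabs_pos L).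
  exists (eps / (2 * (1 + Rabs L))). split; [apply Rdiv_lt_0_compat; lra|].
  intros z w Hzd Hwd Hz1 Hw1. eapply Rle_trans; [now apply H|].
  apply Rlt_div_r in Hz1; [|lra]. apply Rlt_div_r in Hw1; [|lra].
  assert (Hzw : Cmod (z - w) <= Cmod (z - zeta) + Cmod (w - zeta)).
  { rewrite (Cmod_minus_sym w). apply Cmod_dist. }
  assert (G := Rle_abs L). assert (G0 := Cmod_ge_0 (z - w)). nra.
Qed.

Lemma bdry_cont_mult (f h : C -> C) : bounded_disc f -> bounded_disc h ->
  bdry_cont f -> bdry_cont h -> bdry_cont (fun z => f z * h z)%C.
Proof.
  intros [A HA] [B HB] Hf Hh zeta Hz eps He.
  assert (HA0 : 0 <= A) by (eapply Rle_trans; [apply Cmod_ge_0|apply (HA 0 disc_0)]).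
  assert (HB0 : 0 <= B) by (eapply Rle_trans; [apply Cmod_ge_0|apply (HB 0 disc_0)]).
  set (e := eps / (1 + A + B)). assert (He0 : 0 < e) by (apply Rdiv_lt_0_compat; lra).
  destruct (Hf zeta Hz e He0) as [d [Hd H]]. destruct (Hh zeta Hz e He0) as [d' [Hd' H']].
  exists (Rmin d d'). split; [now apply Rmin_pos|]. intros z w Hzd Hwd Hz1 Hw1.
  assert (P := H z w Hzd Hwd (lt_Rmin_l _ _ _ Hz1) (lt_Rmin_l _ _ _ Hw1)).
  assert (Q := H' z w Hzd Hwd (lt_Rmin_r _ _ _ Hz1) (lt_Rmin_r _ _ _ Hw1)).
  replace (f z * h z - f w * h w)%C with (f z * (h z - h w) + (f z - f w) * h w)%C by ring.
  eapply Rle_trans; [apply Cmod_triangle|]. rewrite !Cmod_mult.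
  apply Rle_trans with (A * e + e * B).
  - apply Rplus_le_compat; apply Rmult_le_compat; auto using Cmod_ge_0.
  - replace eps with (e * (1 + A + B)) by (unfold e; field; lra). nra.
Qed.

Lemma bdry_cont_scal (c : C) (f : C -> C) : bdry_cont f -> bdry_cont (fscal c f).
Proof.
  intros Hf zeta Hz eps He. assert (Hc := Cmod_ge_0 c).
  destruct (Hf zeta Hz (eps / (1 + Cmod c))) as [d [Hd H]]; [apply Rdiv_lt_0_compat; lra|].
  exists d. split; [exact Hd|]. intros z w Hzd Hwd Hz1 Hw1.
  specialize (H z w Hzd Hwd Hz1 Hw1). unfold fscal.
  replace (c * f z - c * f w)%C with (c * (f z - f w))%C by ring. rewrite Cmod_mult.
  replace eps with ((1 + Cmod c) * (eps / (1 + Cmod c))) by (field; lra).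
  apply Rmult_le_compat; try lra. apply Cmod_ge_0.
Qed.

Lemma banach_disc_algebra : banach disc_algebra.
Proof.
  assert (Hb : forall f, mem disc_algebra f -> bounded_disc f)
    by (intros f Hf; now apply disc_algebra_Hinfty).
  constructor.
  - intros f [Hf _]. exact Hf.
  - intros f h E Hf. split; [|now apply sup_norm_ext, Hb].
    apply (proj1 (mem_disc_algebra _)) in Hf. destruct Hf as [Ha Hc]. apply (proj2 (mem_disc_algebra _)).
    split; [now apply (analytic_ext f)|now apply (bdry_cont_ext f)].
  - apply (proj2 (mem_disc_algebra _)). split; [apply analytic_const|].
    apply (lipschitz_bdry_cont _ 0). intros z w _ _. unfold fzero, Cminus.
    rewrite Cplus_opp_r, Cmod_0. lra.
  - intros f h Hf Hh. apply (proj1 (mem_disc_algebra _)) in Hf, Hh. apply (proj2 (mem_disc_algebra _)).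
    split; [now apply analytic_plus|now apply bdry_cont_add].
  - intros c f Hf. apply (proj1 (mem_disc_algebra _)) in Hf. apply (proj2 (mem_disc_algebra _)).
    split; [now apply analytic_scal|now apply bdry_cont_scal].
  - intros f Hf E. now apply (banach_norm_eq0 Hinfty banach_Hinfty); [apply disc_algebra_Hinfty|].
  - intros c f Hf. now apply sup_norm_scal, Hb.
  - intros f h Hf Hh. apply sup_norm_triangle; now apply Hb.
  - intros u Hu Hc.
    destruct (sup_norm_complete u) as [f [H1 [_ [H3 H4]]]];
      [intros n; now apply disc_algebra_Hinfty|exact Hc|].
    exists f. split; [|exact H3]. apply (proj2 (mem_disc_algebra _)). split; [exact H1|].
    apply bdry_cont_uniform_limit. intros eps He. destruct (H4 eps He) as [n Hn].
    exists (u n). split; [|exact Hn]. exact (proj2 (proj1 (mem_disc_algebra _) (Hu n))).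
Qed.

(** * Compactness into [Hinfty] and into the disc algebra *)

Lemma pigeonhole_infinite {A : Type} (P : nat -> A -> Prop) (l : list A) :
  (forall k, exists a, In a l /\ P k a) ->
  exists a, In a l /\ forall N, exists k, (N <= k)%nat /\ P k a.
Proof.
  intros H.
  (* The induction needs the hypothesis only from some index on: discarding an element used finitely
     often raises the threshold. *)
  assert (H' : exists N0 : nat, forall k, (N0 <= k)%nat -> exists a, In a l /\ P k a)
    by (exists 0%nat; intros k _; apply H).
  clear H. induction l as [|a l IH].
  - destruct H' as [N0 H]. destruct (H N0 (le_n _)) as [a [[] _]].
  - destruct (classic (forall N, exists k, (N <= k)%nat /\ P k a)) as [Ha|Ha].
    + exists a. split; [now left|exact Ha].
    + destruct H' as [N0 H]. apply not_all_ex_not in Ha. destruct Ha as [N1 HN1].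
      destruct IH as [b [Hb HP]].
      * exists (N0 + N1)%nat. intros k Hk. destruct (H k ltac:(lia)) as [b [[<-|Hb] HP]].
        -- exfalso. apply HN1. exists k. split; [lia|exact HP].
        -- now exists b.
      * exists b. split; [now right|exact HP].
Qed.

(** Some centre [h] of a finite net is close to infinitely many [v k], hence also to the pointwise
    limit; any such [v k] is then uniformly close to [v0]. *)
Lemma totally_bounded_pointwise (E : (C -> C) -> Prop) (v : nat -> C -> C) (v0 : C -> C) (eps : R) :
  (forall f, E f -> mem Hinfty f) -> totally_bounded Hinfty E -> (forall k, E (v k)) ->
  (forall z, disc z -> clim (fun k => v k z) (v0 z)) -> 0 < eps ->
  exists k, forall z, disc z -> Cmod (v k z - v0 z) <= eps.
Proof.
  intros HE Htb Hv Hlim He. destruct (Htb (eps / 2)) as [l [Hl Hcov]]; [lra|].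
  destruct (pigeonhole_infinite (fun k h => nrm Hinfty (fsub (v k) h) < eps / 2) l) as [h [Hh Hinf]].
  { intros k. apply Hcov, Hv. }
  assert (Hpt : forall k z, disc z -> nrm Hinfty (fsub (v k) h) < eps / 2 -> Cmod (v k z - h z) <= eps / 2).
  { intros k z Hz Hk. simpl in Hk.
    assert (Hb : bounded_disc (fsub (v k) h))
      by (apply bounded_disc_sub; [apply (HE _ (Hv k))|apply (HE _ (Hl h Hh))]).
    generalize (sup_norm_ub _ z Hb Hz). unfold fsub at 1. lra. }
  destruct (Hinf 0%nat) as [k [_ Hk]]. exists k. intros z Hz.
  apply le_epsilon. intros e He'. destruct (Hlim z Hz e He') as [N HN].
  destruct (Hinf N) as [j [Hj Hjh]]. specialize (HN j Hj).
  assert (A := Hpt k z Hz Hk). assert (B := Hpt j z Hz Hjh). rewrite Cmod_minus_sym in B.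
  generalize (Cmod_dist (h z) (v k z) (v0 z)) (Cmod_dist (v j z) (h z) (v0 z)). lra.
Qed.

(** The shift by [2] keeps [1 - / (INR k + 2)] strictly between [0] and [1] even for [k = 0], as
    both peak parameters and dilation radii require. *)
Lemma inv_INR2_pos (k : nat) : 0 < / (INR k + 2) <= / 2.
Proof.
  assert (H := pos_INR k). split; [apply Rinv_0_lt_compat; lra|apply Rinv_le_contravar; lra].
Qed.

Lemma clim_inv (u : nat -> C) (l : C) (M : R) :
  (forall k, Cmod (u k - l) <= M * / (INR k + 2)) -> clim u l.
Proof.
  intros H eps He. destruct (INR_unbounded (M / eps)) as [N HN]. exists N. intros n Hn.
  eapply Rle_trans; [apply H|]. apply le_INR in Hn. assert (Hp := pos_INR n).
  apply (Rle_div_l M eps (INR n + 2)); [lra|].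
  apply (Rmult_gt_compat_l eps) in HN; [|exact He].
  replace (eps * (M / eps)) with M in HN by (field; lra). nra.
Qed.

Lemma eval_bounded_Hinfty : eval_bounded Hinfty.
Proof.
  intros z Hz. exists 1. intros f [_ Hf]. rewrite Rmult_1_l. now apply sup_norm_ub.
Qed.

Lemma admissible_eval_bounded (X : fspace) : admissible X -> eval_bounded X.
Proof. intros H z Hz. apply (admissible_P3 X H z Hz). Qed.

Lemma Tg_one (g : C -> C) : analytic g -> eq_disc (fun z => g z - g 0)%C (Tg g (fun _ => 1)).
Proof.
  intros Hg. apply Tg_unique; [exact Hg|apply analytic_const| |ring].
  intros z Hz. apply (cderiv_ext (fun z => g z - g 0)%C _ z (C_derive g z - 0)%C).
  - reflexivity.
  - ring.
  - apply cderiv_minus; [now apply analytic_cderiv|apply cderiv_const].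
Qed.

(** The derivative is [p g' - (p' g + p g') = - p' g]: the uncontrolled factor [g'] cancels. *)
Lemma Tg_minus_mult_lipschitz (g p p' : C -> C) (B L : R) (z w : C) :
  analytic g -> analytic p -> (forall z, disc z -> cderiv p z (p' z)) ->
  (forall z, disc z -> Cmod (g z) <= B) -> (forall z, disc z -> Cmod (p' z) <= L) ->
  disc z -> disc w ->
  Cmod (Tg g p z - p z * g z - (Tg g p w - p w * g w)) <= L * B * Cmod (z - w).
Proof.
  intros Hg Hp Hp' HB HL Hz Hw. destruct (Tg_cderiv g p Hg Hp) as [_ HT].
  apply (cderiv_lipschitz (fun z => Tg g p z - p z * g z)%C (fun z => - (p' z * g z))%C);
    [| |exact Hw|exact Hz]; intros v Hv.
  - apply (cderiv_ext (fun z => Tg g p z - p z * g z)%C _ v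
      (p v * C_derive g v - (p' v * g v + p v * C_derive g v))%C).
    + reflexivity.
    + ring.
    + apply cderiv_minus; [now apply HT|]. apply cderiv_mult; [now apply Hp'|now apply analytic_cderiv].
  - rewrite Cmod_opp, Cmod_mult. apply Rmult_le_compat; try apply Cmod_ge_0; auto.
Qed.

(** For [Cmod zeta = 1] this is [1] at [zeta] and small away from [zeta] when [a] is close to [1]. *)
Definition peak (a : R) (zeta z : C) : C := (RtoC (1 - a) * / (1 - RtoC a * Cconj zeta * z))%C.

Section Peak.

Variables (a : R) (zeta : C).
Hypotheses (Ha : 0 < a < 1) (Hzeta : Cmod zeta = 1).

Let b : C := (RtoC a * Cconj zeta)%C.

Local Lemma Cmod_b : Cmod b = a.
Proof. unfold b. rewrite Cmod_mult, Cmod_conj, Hzeta, Cmod_R, Rabs_pos_eq; lra. Qed.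

Lemma peak_den (z : C) : disc z ->
  1 - a <= Cmod (1 - b * z) /\ 1 - Cmod z <= Cmod (1 - b * z).
Proof.
  intros Hz. unfold disc in Hz. assert (H := Cmod_triangle_minus 1 (b * z)%C).
  rewrite Cmod_1, Cmod_mult, Cmod_b in H. assert (H0 := Cmod_ge_0 z). split; nra.
Qed.

Lemma peak_den_neq (z : C) : disc z -> (1 - b * z)%C <> 0.
Proof. intros Hz. apply Cmod_gt_0. generalize (proj1 (peak_den z Hz)). lra. Qed.

Lemma Cmod_peak (z : C) : disc z -> Cmod (peak a zeta z) = (1 - a) / Cmod (1 - b * z).
Proof.
  intros Hz. unfold peak. fold b. rewrite Cmod_mult, Cmod_inv by now apply peak_den_neq.
  rewrite Cmod_R, Rabs_pos_eq by lra. reflexivity.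
Qed.

Lemma peak_bound (z : C) : disc z -> Cmod (peak a zeta z) <= 1.
Proof.
  intros Hz. rewrite Cmod_peak by exact Hz. assert (H := proj1 (peak_den z Hz)).
  apply Rle_div_l; lra.
Qed.

Lemma peak_small (r : R) (z : C) : r < 1 -> Cmod z <= r -> Cmod (peak a zeta z) <= (1 - a) / (1 - r).
Proof.
  intros Hr Hz. assert (Hd : disc z) by (unfold disc; lra).
  rewrite Cmod_peak by exact Hd. assert (H := proj2 (peak_den z Hd)).
  apply Rmult_le_compat_l; [lra|]. apply Rinv_le_contravar; lra.
Qed.

(** As [b * zeta = a], the numerator [a - b z] of [1 - peak] equals [b (zeta - z)]. *)
Lemma peak_near (z : C) : disc z -> Cmod (1 - peak a zeta z) <= Cmod (z - zeta) / (1 - a).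
Proof.
  intros Hz. assert (Hn := peak_den_neq z Hz). assert (Hd := proj1 (peak_den z Hz)).
  assert (Hb : (b * zeta)%C = RtoC a).
  { unfold b. transitivity (RtoC a * (zeta * Cconj zeta))%C; [ring|].
    rewrite <- Cmod2_conj, Hzeta, pow1. ring. }
  replace (1 - peak a zeta z)%C with (- (b * (z - zeta)) / (1 - b * z))%C.
  - rewrite Cmod_div, Cmod_opp, Cmod_mult, Cmod_b by exact Hn.
    assert (H0 := Cmod_ge_0 (z - zeta)). apply Rmult_le_compat.
    + nra.
    + apply Rlt_le, Rinv_0_lt_compat. lra.
    + nra.
    + apply Rinv_le_contravar; lra.
  - unfold peak. fold b. replace (- (b * (z - zeta)))%C with (b * zeta - b * z)%C by ring.
    rewrite Hb, RtoC_minus. now field.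
Qed.

Local Lemma inv_cderiv (z : C) : disc z ->
  cderiv (fun w => / (1 - b * w))%C z (b * / (1 - b * z) * / (1 - b * z))%C.
Proof.
  intros Hz. assert (Hn := peak_den_neq z Hz).
  apply (cderiv_ext (fun w => / (1 + (- b) * w))%C _ z
    (- b * - / ((1 + - b * z) * (1 + - b * z)))%C).
  - intros w. f_equal. ring.
  - replace (1 + - b * z)%C with (1 - b * z)%C by ring. now field.
  - apply (cderiv_comp_affine (fun w => / w)%C), cderiv_inv.
    replace (1 + - b * z)%C with (1 - b * z)%C by ring. exact Hn.
Qed.

Lemma peak_cderiv (z : C) : disc z ->
  cderiv (peak a zeta) z (RtoC (1 - a) * (b * / (1 - b * z) * / (1 - b * z)))%C.
Proof. intros Hz. unfold peak. fold b. now apply cderiv_scal, inv_cderiv. Qed.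

Lemma analytic_peak : analytic (peak a zeta).
Proof.
  eapply cderiv2_analytic; [exact peak_cderiv|]. intros z Hz. eexists.
  apply cderiv_scal, cderiv_mult; [|now apply inv_cderiv].
  apply cderiv_scal. now apply inv_cderiv.
Qed.

(** The blow-up as [a] tends to [1] is harmless: [a] is fixed before points approach [zeta]. *)
Lemma peak_cderiv_bound (z : C) : disc z ->
  Cmod (RtoC (1 - a) * (b * / (1 - b * z) * / (1 - b * z)))%C <= / (1 - a).
Proof.
  intros Hz. assert (Hd := proj1 (peak_den z Hz)).
  rewrite !Cmod_mult, Cmod_inv, Cmod_b, Cmod_R, Rabs_pos_eq by (try apply peak_den_neq; auto; lra).
  assert (Hi : / Cmod (1 - b * z) <= / (1 - a)) by (apply Rinv_le_contravar; lra).
  assert (Hi0 : 0 < / Cmod (1 - b * z)) by (apply Rinv_0_lt_compat; lra).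
  set (x := / Cmod (1 - b * z)) in *. set (y := / (1 - a)) in *.
  assert (Hy : (1 - a) * y = 1) by (unfold y; field; lra).
  apply Rle_trans with ((1 - a) * (1 * y * y)).
  - apply Rmult_le_compat_l; [lra|]. apply Rmult_le_compat; nra.
  - replace ((1 - a) * (1 * y * y)) with ((1 - a) * y * y) by ring. rewrite Hy. lra.
Qed.

End Peak.

(** * From compactness into [Hinfty] to compactness into the disc algebra *)

Section PartOne.

Variables (g : C -> C) (X : fspace).
Hypotheses (Hg : analytic g) (HX : banach X) (Hadm : admissible X) (HHX : subspace Hinfty X).
Hypothesis HT : compact_operator X Hinfty (Tg g).

(** Scaling by [c] moves the bounded sequence into the unit ball, the only place where compactness
    of the operator speaks; [1 + Rabs M] is positive whatever the sign of [M]. *)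
Local Lemma Tg_uniform_of_pointwise (u : nat -> C -> C) (v0 : C -> C) (M eps : R) :
  (forall k, mem X (u k)) -> (forall k, nrm X (u k) <= M) ->
  (forall z, disc z -> clim (fun k => Tg g (u k) z) (v0 z)) -> 0 < eps ->
  exists k, forall z, disc z -> Cmod (Tg g (u k) z - v0 z) <= eps.
Proof.
  intros Hu HM Hlim He. set (c := / (1 + Rabs M)).
  assert (HMa := Rabs_pos M). assert (HMb := Rle_abs M).
  assert (Hc : 0 < c) by (apply Rinv_0_lt_compat; lra).
  assert (Hc1 : c * (1 + Rabs M) = 1) by (unfold c; field; lra).
  assert (Hua : forall k, analytic (u k)) by (intros k; apply (banach_analytic X HX), Hu).
  assert (E : forall k z, disc z -> (RtoC c * Tg g (u k) z)%C = Tg g (fscal (RtoC c) (u k)) z)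
    by (intros k z Hz; exact (Tg_scal g (u k) (RtoC c) Hg (Hua k) z Hz)).
  assert (Hce : forall x : C, Cmod (RtoC c * x) = c * Cmod x).
  { intros x. rewrite Cmod_scal_pos by lra. reflexivity. }
  destruct HT as [_ [Hm Hrc]].
  destruct (totally_bounded_pointwise _ (fun k => Tg g (fscal (RtoC c) (u k)))
    (fun z => RtoC c * v0 z)%C (c * eps) Hm) as [k Hk].
  - apply relatively_compact_totally_bounded; [exact banach_Hinfty|]. now split.
  - intros k. exists (fscal (RtoC c) (u k)). split; [now apply banach_scal|]. split; [|reflexivity].
    rewrite nrm_scal_pos by (try apply Hu; try assumption; lra).
    rewrite <- Hc1. apply Rmult_le_compat_l; [lra|]. specialize (HM k). lra.
  - intros z Hz e He'. destruct (Hlim z Hz (e / c)) as [N HN]; [now apply Rdiv_lt_0_compat|].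
    exists N. intros n Hn. rewrite <- E by exact Hz.
    replace (RtoC c * Tg g (u n) z - RtoC c * v0 z)%C with (RtoC c * (Tg g (u n) z - v0 z))%C by ring.
    rewrite Hce. specialize (HN n Hn). apply (Rmult_le_compat_l c) in HN; [|lra].
    replace (c * (e / c)) with e in HN by (field; lra). exact HN.
  - now apply Rmult_lt_0_compat.
  - exists k. intros z Hz. specialize (Hk z Hz). rewrite <- E in Hk by exact Hz.
    replace (RtoC c * Tg g (u k) z - RtoC c * v0 z)%C with (RtoC c * (Tg g (u k) z - v0 z))%C in Hk by ring.
    rewrite Hce in Hk. now apply Rmult_le_reg_l in Hk.
Qed.

Local Lemma symbol_bounded : bounded_disc g.
Proof.
  assert (H1 : mem X (fun _ => 1%C)).
  { apply HHX. split; [apply analytic_const|]. exists 1. intros z _. rewrite Cmod_1. lra. }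
  destruct HT as [Hm _]. destruct (Hm _ H1) as [_ [M HM]].
  exists (M + Cmod (g 0)). intros z Hz. specialize (HM z Hz).
  rewrite <- (Tg_one g Hg z Hz) in HM. generalize (Cmod_triangle_minus (g z) (g 0)). lra.
Qed.

(** Oscillation of [g] at [zeta] is detected by [Tg g p] for a peak function [p]
    at [zeta], since [Tg g p - p g] is Lipschitz. *)
Local Lemma symbol_bdry_cont : bdry_cont g.
Proof.
  intros zeta Hzeta eps He. destruct symbol_bounded as [B HB].
  assert (HB0 : 0 <= B) by (eapply Rle_trans; [apply Cmod_ge_0|apply (HB 0 disc_0)]).
  destruct (subspace_norm_bound Hinfty X banach_Hinfty HX eval_bounded_Hinfty
    (admissible_eval_bounded X Hadm) HHX) as [M [HM0 HM]].
  set (a := fun k : nat => 1 - / (INR k + 2)).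
  assert (Ha : forall k, 0 < a k < 1) by (intros k; unfold a; generalize (inv_INR2_pos k); lra).
  assert (Hpb : forall k, bounded_disc (peak (a k) zeta)).
  { intros k. exists 1. intros z Hz. now apply peak_bound. }
  assert (HpH : forall k, mem Hinfty (peak (a k) zeta)).
  { intros k. split; [now apply analytic_peak|apply Hpb]. }
  destruct (Tg_uniform_of_pointwise (fun k => peak (a k) zeta) (fun _ => 0%C) M (eps / 4)) as [k Hk].
  - intros k. apply HHX, HpH.
  - intros k. eapply Rle_trans; [apply HM, HpH|]. rewrite <- (Rmult_1_r M) at 2.
    apply Rmult_le_compat_l; [exact HM0|]. apply sup_norm_le. intros z Hz. now apply peak_bound.
  - intros z Hz.
    destruct (analytic_bounded (C_derive g) (Cmod z) (analytic_deriv g Hg) Hz) as [D [HD0 HD]].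
    apply (clim_inv _ _ (/ (1 - Cmod z) * D)). intros k.
    replace (Tg g (peak (a k) zeta) z - 0)%C with (Tg g (peak (a k) zeta) z) by ring.
    eapply Rle_trans; [apply (Tg_bound g _ (Cmod z) ((1 - a k) / (1 - Cmod z)) D)|].
    + exact Hg.
    + now apply analytic_peak.
    + exact Hz.
    + lra.
    + intros w Hw. now apply peak_small.
    + exact HD.
    + right. unfold a, Rdiv. ring.
  - lra.
  - set (c := 1 - a k) in *. assert (Hc : 0 < c) by (unfold c; generalize (Ha k); lra).
    (* The budget: [eps / 2] for the two values of [Tg g p], [eps / 4] for the Lipschitz term, and
       [eps / 8] for each term [(1 - p) g]. The peak, hence [c], is already fixed. *)
    exists (eps * c / (8 * (1 + B))). split; [apply Rdiv_lt_0_compat; nra|].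
    intros z w Hz Hw Hzd Hwd. set (p := peak (a k) zeta) in *.
    assert (HL := Tg_minus_mult_lipschitz g p _ B (/ c) z w Hg (analytic_peak _ _ (Ha k) Hzeta)
      (peak_cderiv _ _ (Ha k) Hzeta) HB (peak_cderiv_bound _ _ (Ha k) Hzeta) Hz Hw).
    assert (Nz := peak_near _ _ (Ha k) Hzeta z Hz). assert (Nw := peak_near _ _ (Ha k) Hzeta w Hw).
    fold p c in Nz, Nw.
    assert (Tz := Hk z Hz). assert (Tw := Hk w Hw).
    replace (Tg g p z - 0)%C with (Tg g p z) in Tz by ring.
    replace (Tg g p w - 0)%C with (Tg g p w) in Tw by ring.
    replace (g z - g w)%C with (Tg g p z - Tg g p w
      - (Tg g p z - p z * g z - (Tg g p w - p w * g w)) + ((1 - p z) * g z - (1 - p w) * g w))%C by ring.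
    assert (Hzw : Cmod (z - w) <= Cmod (z - zeta) + Cmod (w - zeta)).
    { rewrite (Cmod_minus_sym w). apply Cmod_dist. }
    assert (Hci : 0 < / c) by now apply Rinv_0_lt_compat.
    assert (Pz : Cmod ((1 - p z) * g z) <= / c * B * Cmod (z - zeta)).
    { rewrite Cmod_mult. replace (/ c * B * Cmod (z - zeta)) with (Cmod (z - zeta) / c * B)
        by (unfold Rdiv; ring). apply Rmult_le_compat; auto using Cmod_ge_0. }
    assert (Pw : Cmod ((1 - p w) * g w) <= / c * B * Cmod (w - zeta)).
    { rewrite Cmod_mult. replace (/ c * B * Cmod (w - zeta)) with (Cmod (w - zeta) / c * B)
        by (unfold Rdiv; ring). apply Rmult_le_compat; auto using Cmod_ge_0. }
    assert (Hcb : 0 <= / c * B) by (apply Rmult_le_pos; lra).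
    assert (Hsmall : forall x, x < eps * c / (8 * (1 + B)) -> / c * B * x <= eps / 8).
    { intros x Hx. apply Rle_trans with (/ c * B * (eps * c / (8 * (1 + B)))).
      - apply Rmult_le_compat_l; lra.
      - replace (/ c * B * (eps * c / (8 * (1 + B)))) with (eps / 8 * (B / (1 + B))) by (field; lra).
        assert (B / (1 + B) <= 1) by (apply Rle_div_l; lra). nra. }
    assert (Sz := Hsmall _ Hzd). assert (Sw := Hsmall _ Hwd).
    assert (HL' : / c * B * Cmod (z - w) <= eps / 4).
    { eapply Rle_trans; [apply Rmult_le_compat_l; [exact Hcb|exact Hzw]|]. lra. }
    eapply Rle_trans; [apply Cmod_triangle|].
    eapply Rle_trans; [apply Rplus_le_compat; apply Cmod_sub_le|].
    generalize (Cmod_sub_le (Tg g p z) (Tg g p w)). lra.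
Qed.

(** A dilate is bounded with bounded derivative, so [Tg g f_r - f_r g] is Lipschitz, and [f_r g]
    inherits boundary continuity from [g]. *)
Local Lemma Tg_dilate_bdry_cont (f : C -> C) (r : R) : analytic f -> 0 < r < 1 ->
  bdry_cont (Tg g (dilate r f)).
Proof.
  intros Hf Hr. destruct symbol_bounded as [B HB].
  assert (Hd : forall z, disc z -> cderiv (dilate r f) z (RtoC r * C_derive f (RtoC r * z))%C)
    by (intros z Hz; apply dilate_cderiv; [exact Hf|lra|exact Hz]).
  assert (Hrz : forall z, disc z -> Cmod (RtoC r * z) <= r).
  { intros z Hz. unfold disc in Hz. rewrite Cmod_scal_pos by lra. nra. }
  destruct (analytic_bounded f r Hf) as [M [HM0 HM]]; [lra|].
  destruct (analytic_bounded (C_derive f) r (analytic_deriv f Hf)) as [L [HL0 HL]]; [lra|].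
  assert (HLd : forall z, disc z -> Cmod (RtoC r * C_derive f (RtoC r * z))%C <= L).
  { intros z Hz. rewrite Cmod_scal_pos by lra.
    specialize (HL _ (Hrz z Hz)). assert (H0 := Cmod_ge_0 (C_derive f (RtoC r * z)%C)). nra. }
  assert (Ha : analytic (dilate r f)).
  { apply (cderiv2_analytic _ _ Hd). intros z Hz. eexists. apply cderiv_scal.
    apply (dilate_cderiv (C_derive f)); [now apply analytic_deriv|lra|exact Hz]. }
  apply (bdry_cont_ext (fadd (fun z => Tg g (dilate r f) z - dilate r f z * g z)%C
    (fun z => dilate r f z * g z)%C)).
  { intros z _. unfold fadd. ring. }
  apply bdry_cont_add.
  - apply (lipschitz_bdry_cont _ (L * B)). intros z w Hz Hw.
    exact (Tg_minus_mult_lipschitz g _ _ B L z w Hg Ha Hd HB HLd Hz Hw).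
  - apply bdry_cont_mult.
    + exists M. intros z Hz. apply HM, Hrz, Hz.
    + now exists B.
    + apply (lipschitz_bdry_cont _ L). intros z w Hz Hw.
      exact (cderiv_lipschitz _ _ L w z Hd HLd Hw Hz).
    + exact symbol_bdry_cont.
Qed.

(** On [|w| <= |z|] the mean value bound gives [|f (r w) - f w| <= L (1 - r)], and [Tg_bound]
    carries this to the images. *)
Local Lemma Tg_dilate_clim (f : C -> C) (z : C) : analytic f ->
  (forall k : nat, analytic (dilate (1 - / (INR k + 2)) f)) -> disc z ->
  clim (fun k => Tg g (dilate (1 - / (INR k + 2)) f) z) (Tg g f z).
Proof.
  intros Hf Hk Hz. unfold disc in Hz.
  destruct (analytic_bounded (C_derive g) (Cmod z) (analytic_deriv g Hg) Hz) as [D [HD0 HD]].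
  destruct (analytic_bounded (C_derive f) (Cmod z) (analytic_deriv f Hf) Hz) as [L [HL0 HL]].
  apply (clim_inv _ _ (L * D)). intros k. assert (Hr := inv_INR2_pos k).
  set (r := 1 - / (INR k + 2)).
  change (Cmod (fsub (Tg g (dilate r f)) (Tg g f) z) <= L * D * / (INR k + 2)).
  assert (Hka : analytic (dilate r f)) by exact (Hk k).
  rewrite (Tg_sub g _ f Hg Hka Hf z Hz).
  replace (L * D * / (INR k + 2)) with (L * / (INR k + 2) * D) by ring.
  apply (Tg_bound g _ (Cmod z)); [exact Hg|now apply analytic_minus|exact Hz|lra| |exact HD].
  intros w Hw. unfold fsub, dilate.
  assert (Hrw : Cmod (RtoC r * w) <= Cmod z).
  { eapply Rle_trans; [apply Cmod_dilate; unfold r; lra|exact Hw]. }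
  eapply Rle_trans; [apply (mean_value_bound f (C_derive f) w (RtoC r * w)%C L)|].
  - intros t Ht. apply analytic_cderiv; [exact Hf|].
    apply Rle_lt_trans with (Cmod z); [now apply Cmod_segment|exact Hz].
  - intros t Ht. now apply HL, Cmod_segment.
  - apply Rmult_le_compat_l; [exact HL0|].
    replace (RtoC r * w - w)%C with (RtoC (- / (INR k + 2)) * w)%C
      by (unfold r; rewrite RtoC_minus, RtoC_opp; ring).
    rewrite Cmod_mult, Cmod_R, Rabs_Ropp, Rabs_pos_eq by lra.
    assert (H0 := Cmod_ge_0 w). nra.
Qed.

Local Lemma Tg_mem_disc_algebra (f : C -> C) : mem X f -> mem disc_algebra (Tg g f).
Proof.
  intros Hf. assert (Hfa := banach_analytic X HX f Hf).
  apply (proj2 (mem_disc_algebra _)). split; [now apply Tg_analytic|].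
  destruct (admissible_P2_norm X Hadm) as [K HK].
  assert (Hr : forall k, 0 < 1 - / (INR k + 2) < 1) by (intros k; generalize (inv_INR2_pos k); lra).
  assert (Hmem : forall k : nat, mem X (dilate (1 - / (INR k + 2)) f)).
  { intros k. apply (admissible_P2_mem X Hadm); [exact Hf|apply Hr]. }
  apply bdry_cont_uniform_limit. intros eps He.
  destruct (Tg_uniform_of_pointwise (fun k => dilate (1 - / (INR k + 2)) f) (Tg g f)
    (K * nrm X f) eps Hmem) as [k Hk].
  - intros k. apply HK; [exact Hf|apply Hr].
  - intros z Hz. apply Tg_dilate_clim; [exact Hfa| |exact Hz].
    intros k. apply (banach_analytic X HX), Hmem.
  - exact He.
  - exists (Tg g (dilate (1 - / (INR k + 2)) f)). split; [|exact Hk].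
    apply Tg_dilate_bdry_cont; [exact Hfa|apply Hr].
Qed.

(** The two spaces share their norm and the centres of a net are images under [Tg g]; once these lie
    in the disc algebra, total boundedness transfers verbatim. *)
Lemma compact_Hinfty_disc_algebra : compact_operator X disc_algebra (Tg g).
Proof.
  split; [exact Tg_mem_disc_algebra|].
  apply totally_bounded_relatively_compact; [exact banach_disc_algebra| |].
  - intros h [f [Hf [_ ->]]]. now apply Tg_mem_disc_algebra.
  - exact (relatively_compact_totally_bounded Hinfty banach_Hinfty _ (proj2 HT)).
Qed.

End PartOne.

Lemma compact_disc_algebra_Hinfty (X : fspace) (T : (C -> C) -> C -> C) :
  compact_operator X disc_algebra T -> compact_operator X Hinfty T.
Proof.
  intros [Hm Hc]. assert (Hm' : forall f, mem X f -> mem Hinfty (T f))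
    by (intros f Hf; now apply disc_algebra_Hinfty, Hm).
  split; [exact Hm'|].
  apply totally_bounded_relatively_compact; [exact banach_Hinfty| |].
  - intros h [f [Hf [_ ->]]]. now apply Hm'.
  - exact (relatively_compact_totally_bounded disc_algebra banach_disc_algebra _ Hc).
Qed.

(** * Duality *)

(** A partition into finitely many classes on which [Q] holds. Unlike nets with centres, such
    partitions combine directly under conjunction. *)
Definition colorable {T : Type} (P : T -> Prop) (Q : T -> T -> Prop) : Prop :=
  exists (N : nat) (c : T -> nat), (forall t, P t -> (c t < N)%nat) /\
    forall t t', P t -> P t' -> c t = c t' -> Q t t'.

Lemma colorable_weaken {T : Type} (P : T -> Prop) (Q Q' : T -> T -> Prop) :
  (forall t t', P t -> P t' -> Q t t' -> Q' t t') -> colorable P Q -> colorable P Q'.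
Proof. intros H [N [c [Hc HQ]]]. exists N, c. split; [exact Hc|]. auto. Qed.

Lemma colorable_and {T : Type} (P : T -> Prop) (Q Q' : T -> T -> Prop) :
  colorable P Q -> colorable P Q' -> colorable P (fun t t' => Q t t' /\ Q' t t').
Proof.
  intros [N [c [Hc HQ]]] [N' [c' [Hc' HQ']]].
  (* The number codes the pair of colours, decoded by Euclidean division. *)
  exists (N * N')%nat, (fun t => N * c' t + c t)%nat. split.
  - intros t Ht. specialize (Hc t Ht). specialize (Hc' t Ht). nia.
  - intros t t' Ht Ht' E.
    destruct (Nat.div_mod_unique N (c' t) (c' t') (c t) (c t')) as [E1 E2]; auto.
Qed.

Lemma colorable_list {T A : Type} (P : T -> Prop) (Q : A -> T -> T -> Prop) (l : list A) :
  (forall a, In a l -> colorable P (Q a)) ->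
  colorable P (fun t t' => forall a, In a l -> Q a t t').
Proof.
  induction l as [|a l IH]; intros H.
  - exists 1%nat, (fun _ => 0%nat). split; [lia|]. intros t t' _ _ _ a [].
  - apply (colorable_weaken P (fun t t' => Q a t t' /\ forall b, In b l -> Q b t t')).
    + intros t t' _ _ [H1 H2] b [<-|Hb]; auto.
    + apply colorable_and; [apply H; now left|]. apply IH. intros b Hb. apply H. now right.
Qed.

(** One representative is taken from each colour that occurs. *)
Lemma colorable_net {T : Type} (P : T -> Prop) (Q : T -> T -> Prop) : colorable P Q ->
  exists l, (forall t, In t l -> P t) /\ forall t, P t -> exists t', In t' l /\ Q t t'.
Proof.
  intros [N [c [Hc HQ]]].
  assert (H : forall n, exists l, (forall t, In t l -> P t) /\
    forall t, P t -> (c t < n)%nat -> exists t', In t' l /\ Q t t').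
  { induction n as [|n [l [H1 H2]]].
    - exists nil. split; [intros t []|]. intros t _ Ht. lia.
    - destruct (classic (exists s, P s /\ c s = n)) as [[s [Hs Hcs]]|Hno].
      + exists (s :: l). split.
        * intros t [<-|Ht]; auto.
        * intros t Ht Htn. destruct (Nat.eq_dec (c t) n) as [E|Hne].
          -- exists s. split; [now left|]. apply HQ; congruence.
          -- destruct (H2 t Ht ltac:(lia)) as [t' [Ht' HQt]]. exists t'. split; [now right|exact HQt].
      + exists l. split; [exact H1|]. intros t Ht Htn. apply H2; [exact Ht|].
        destruct (Nat.eq_dec (c t) n) as [E|Hne]; [|lia]. exfalso. apply Hno. now exists t. }
  destruct (H N) as [l [H1 H2]]. exists l. split; [exact H1|]. intros t Ht. apply H2; auto.
Qed.

(** The interval [[-M, M]] is cut into slices of length [eps]; the colour is the number of the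
    slice, given by [up]. *)
Lemma colorable_real {T : Type} (P : T -> Prop) (phi : T -> R) (M eps : R) :
  (forall t, P t -> Rabs (phi t) <= M) -> 0 < eps ->
  colorable P (fun t t' => Rabs (phi t - phi t') < eps).
Proof.
  intros HM He. set (x := fun t => (phi t + M) / eps).
  assert (Hx : forall t, P t -> 0 <= x t <= 2 * M / eps).
  { intros t Ht. specialize (HM t Ht). apply Rabs_le_between in HM. unfold x. split.
    - apply Rdiv_le_0_compat; lra.
    - apply Rmult_le_compat_r; [apply Rlt_le, Rinv_0_lt_compat; lra|lra]. }
  exists (Z.to_nat (up (2 * M / eps) + 1)), (fun t => Z.to_nat (up (x t))).
  assert (Hup : forall t, P t -> (0 <= up (x t) < up (2 * M / eps) + 1)%Z).
  { intros t Ht. specialize (Hx t Ht). destruct (archimed (x t)) as [A B].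
    destruct (archimed (2 * M / eps)) as [A' _]. split.
    - apply le_IZR. lra.
    - apply lt_IZR. rewrite plus_IZR. lra. }
  split.
  - intros t Ht. specialize (Hup t Ht). lia.
  - intros t t' Ht Ht' E. assert (A := Hup t Ht). assert (B := Hup t' Ht').
    assert (E' : up (x t) = up (x t')) by lia.
    destruct (archimed (x t)) as [A1 A2]. destruct (archimed (x t')) as [B1 B2].
    rewrite E' in A1, A2.
    replace (phi t - phi t') with ((x t - x t') * eps) by (unfold x; field; lra).
    rewrite Rabs_mult, (Rabs_pos_eq eps) by lra.
    assert (Rabs (x t - x t') < 1) by (apply Rabs_def1; lra). nra.
Qed.

Lemma colorable_C {T : Type} (P : T -> Prop) (phi : T -> C) (M eps : R) :
  (forall t, P t -> Cmod (phi t) <= M) -> 0 < eps ->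
  colorable P (fun t t' => Cmod (phi t - phi t') < eps).
Proof.
  intros HM He.
  apply (colorable_weaken P (fun t t' => Rabs (Re (phi t) - Re (phi t')) < eps / 2 /\
    Rabs (Im (phi t) - Im (phi t')) < eps / 2)).
  - intros t t' _ _ [H1 H2]. eapply Rle_lt_trans; [apply Cmod_le_re_im|].
    rewrite Re_minus, Im_minus. lra.
  - apply colorable_and; apply (colorable_real _ _ M); try lra; intros t Ht.
    + eapply Rle_trans; [apply re_le_Cmod|auto].
    + eapply Rle_trans; [apply im_le_Cmod|auto].
Qed.

Lemma list_bound {A : Type} (v : A -> R) (l : list A) : exists M, forall a, In a l -> v a <= M.
Proof.
  induction l as [|a l [M IH]].
  - exists 0. intros a [].
  - exists (Rmax (v a) M). intros b [<-|Hb]; [apply Rmax_l|].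
    eapply Rle_trans; [now apply IH|apply Rmax_r].
Qed.

Lemma cser_conj (u : nat -> C) (l : C) : cser u l -> cser (fun n => Cconj (u n)) (Cconj l).
Proof.
  rewrite !cser_eps. intros H eps He. destruct (H eps He) as [N HN]. exists N. intros n Hn.
  replace (csum_n (fun n => Cconj (u n)) n)
    with (Cconj (csum_n u n)).
  - rewrite <- Cminus_conj, Cmod_conj. now apply HN.
  - clear. induction n as [|n IH]; [now rewrite !sum_O|]. rewrite !sum_Sn, <- IH. apply Cplus_conj.
Qed.

Lemma Cconj_RtoC (x : R) : Cconj (RtoC x) = RtoC x.
Proof. unfold Cconj, RtoC; simpl. f_equal. ring. Qed.

Lemma at_left_eps (x : R) (P : R -> Prop) :
  at_left x P <-> exists d, 0 < d /\ forall r, x - d < r < x -> P r.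
Proof.
  split.
  - intros [d Hd]. exists d. split; [apply cond_pos|]. intros r Hr. apply Hd; [|lra].
    change (Rabs (r - x) < d). apply Rabs_def1; lra.
  - intros [d [Hd H]]. exists (mkposreal d Hd). intros r Hr Hrx. apply H.
    change (Rabs (r - x) < d) in Hr. apply Rabs_def2 in Hr. lra.
Qed.

(** * The pairing, the reproducing kernels and [G] *)

Section Pairing.

Variable beta : nat -> R.

Lemma is_pairing_eps (f h : C -> C) (l : C) : is_pairing beta f h l <-> exists S : R -> C,
  (forall r, 0 < r < 1 -> cser (fun n => taylor_coef f n * Cconj (taylor_coef h n)
     * RtoC (beta n) * RtoC r ^ n)%C (S r)) /\
  (forall eps, 0 < eps -> exists d, 0 < d /\ forall r, 1 - d < r < 1 -> Cmod (S r - l) < eps).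
Proof.
  split; intros [S [HS Hl]]; exists S; (split; [exact HS|]).
  - intros eps He. apply at_left_eps. now apply (filterlim_Cmod (at_left 1)).
  - apply (filterlim_Cmod (at_left 1)). intros eps He. now apply at_left_eps, Hl.
Qed.

Lemma is_pairing_unique (f h : C -> C) (l m : C) :
  is_pairing beta f h l -> is_pairing beta f h m -> l = m.
Proof.
  intros Hl Hm. apply is_pairing_eps in Hl, Hm.
  destruct Hl as [S [HS Hl]], Hm as [S' [HS' Hm]].
  apply Cmod_le_eps. intros eps He.
  destruct (Hl (eps / 2)) as [d [Hd H1]]; [lra|]. destruct (Hm (eps / 2)) as [d' [Hd' H2]]; [lra|].
  set (e := Rmin (/ 2) (Rmin (d / 2) (d' / 2))).
  assert (He0 : 0 < e) by (repeat apply Rmin_pos; lra).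
  assert (E1 : e <= / 2) by apply Rmin_l.
  assert (E23 : e <= Rmin (d / 2) (d' / 2)) by apply Rmin_r.
  assert (E2 := Rle_trans _ _ _ E23 (Rmin_l _ _)). assert (E3 := Rle_trans _ _ _ E23 (Rmin_r _ _)).
  specialize (H1 (1 - e) ltac:(lra)). specialize (H2 (1 - e) ltac:(lra)).
  rewrite <- (cser_unique _ _ _ (HS (1 - e) ltac:(lra)) (HS' (1 - e) ltac:(lra))) in H2.
  rewrite Cmod_minus_sym in H1.
  generalize (Cmod_dist (S (1 - e)%R) l m). lra.
Qed.

Lemma pairing_eq (f h : C -> C) (l : C) : is_pairing beta f h l -> pairing beta f h = l.
Proof.
  intros Hl. apply (iota_unique (V := C_CompleteNormedModule)); [|exact Hl].
  intros m Hm. exact (is_pairing_unique f h m l Hm Hl).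
Qed.

Lemma is_pairing_sub_r (f h h' : C -> C) (l l' : C) : analytic h -> analytic h' ->
  is_pairing beta f h l -> is_pairing beta f h' l' -> is_pairing beta f (fsub h h') (l - l')%C.
Proof.
  intros Hh Hh' Hl Hl'. apply is_pairing_eps in Hl, Hl'.
  destruct Hl as [S [HS Hl]], Hl' as [S' [HS' Hl']].
  apply is_pairing_eps. exists (fun r => S r - S' r)%C. split.
  - intros r Hr. eapply cser_ext; [|apply (cser_minus _ _ _ _ (HS r Hr) (HS' r Hr))].
    intros n. cbv beta. rewrite taylor_coef_sub, Cminus_conj by assumption. ring.
  - intros eps He. destruct (Hl (eps / 2)) as [d [Hd H1]]; [lra|].
    destruct (Hl' (eps / 2)) as [d' [Hd' H2]]; [lra|].
    exists (Rmin d d'). split; [now apply Rmin_pos|]. intros r Hr.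
    assert (Hm1 := Rmin_l d d'). assert (Hm2 := Rmin_r d d').
    specialize (H1 r ltac:(lra)). specialize (H2 r ltac:(lra)).
    replace (S r - S' r - (l - l'))%C with ((S r - l) - (S' r - l'))%C by ring.
    eapply Rle_lt_trans; [apply Cmod_sub_le|]. lra.
Qed.

Lemma taylor_coef_pow (n k : nat) :
  taylor_coef (fun z => z ^ n)%C k = if Nat.eq_dec k n then 1%C else 0%C.
Proof.
  apply (psum_taylor (fun k => if Nat.eq_dec k n then 1%C else 0%C) _ 1); [lra|].
  intros z _. unfold psum.
  assert (H := cser_single (fun k => (if Nat.eq_dec k n then 1 else 0) * z ^ k)%C n).
  cbv beta in H. destruct (Nat.eq_dec n n) as [_|Hn]; [|easy]. rewrite Cmult_1_l in H.
  apply H. intros j Hj. destruct (Nat.eq_dec j n); [easy|ring].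
Qed.

(** Only one term of the series survives, so monomials read off the Taylor coefficients of [h]. *)
Lemma is_pairing_pow (n : nat) (h : C -> C) :
  is_pairing beta (fun z => z ^ n)%C h (Cconj (taylor_coef h n) * RtoC (beta n))%C.
Proof.
  set (c := (Cconj (taylor_coef h n) * RtoC (beta n))%C).
  apply is_pairing_eps. exists (fun r => c * RtoC r ^ n)%C. split.
  - intros r _.
    assert (H := cser_single (fun k => taylor_coef (fun z => z ^ n)%C k * Cconj (taylor_coef h k)
      * RtoC (beta k) * RtoC r ^ k)%C n).
    cbv beta in H. rewrite (taylor_coef_pow n n) in H.
    destruct (Nat.eq_dec n n) as [_|Hn]; [|easy]. rewrite Cmult_1_l in H. apply H.
    intros k Hk. rewrite taylor_coef_pow. destruct (Nat.eq_dec k n); [easy|ring].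
  - assert (Hc : ccont (fun w => c * w ^ n)%C 1).
    { eapply cderiv_ccont. apply cderiv_scal, cderiv_pow. }
    intros eps He. destruct (Hc eps He) as [d [Hd H]]. exists d. split; [exact Hd|].
    intros r Hr. specialize (H (RtoC r)).
    replace (c * 1 ^ n)%C with c in H by (rewrite Cpow_1_l; ring). apply H.
    rewrite <- RtoC_minus, Cmod_R. apply Rabs_def1; lra.
Qed.

Hypothesis Hbeta : forall n, 0 < beta n.
Hypothesis Hroot : is_lim_seq (fun n => Rpower (beta n) (/ INR n)) 1.

Lemma beta_lower (s : R) : 0 < s < 1 -> exists N, forall n, (N <= n)%nat -> s ^ n <= beta n.
Proof.
  intros Hs. apply is_lim_seq_spec in Hroot.
  assert (He : 0 < 1 - s) by lra. destruct (Hroot (mkposreal _ He)) as [N HN].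
  (* [S N] excludes [n = 0], where [/ INR n] is not an inverse. *)
  exists (S N). intros n Hn. specialize (HN n ltac:(lia)). simpl in HN.
  apply Rabs_def2 in HN. set (x := Rpower (beta n) (/ INR n)) in *.
  assert (Hn0 : INR n <> 0) by (apply not_0_INR; lia).
  assert (Hx : x ^ n = beta n).
  { rewrite <- Rpower_pow by lra. unfold x. rewrite Rpower_mult, Rinv_l by exact Hn0.
    now apply Rpower_1. }
  rewrite <- Hx. apply pow_incr. lra.
Qed.

(** The root condition gives the kernel series radius of convergence at least [1]; the finitely many
    indices before [beta_lower] applies are bounded by hand. *)
Lemma coef_bd_inv_beta : coef_bd (fun n => RtoC (/ beta n)) 1.
Proof.
  intros r Hr. set (s := (r + 1) / 2). assert (Hs : 0 < s < 1) by (unfold s; lra).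
  destruct (beta_lower s Hs) as [N HN].
  destruct (list_bound (fun n => Cmod (RtoC (/ beta n)) * r ^ n) (List.seq 0 N)) as [M HM].
  exists (Rmax M 1). intros n. destruct (Nat.lt_ge_cases n N) as [Hn|Hn].
  - eapply Rle_trans; [|apply Rmax_l]. apply HM. apply in_seq. lia.
  - eapply Rle_trans; [|apply Rmax_r]. specialize (HN n Hn). assert (Hb := Hbeta n).
    rewrite Cmod_R, Rabs_pos_eq by (apply Rlt_le, Rinv_0_lt_compat, Hb).
    rewrite Rmult_comm. apply (Rle_div_l (r ^ n) 1 (beta n)); [exact Hb|].
    rewrite Rmult_1_l. eapply Rle_trans; [|exact HN]. apply pow_incr. unfold s. lra.
Qed.

(** The kernel is antianalytic in its base point. Its conjugate is a power series in [z], which is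
    why [G] integrates the conjugate and conjugates the result. *)
Lemma kernel_psum (z w : C) : disc z -> disc w ->
  psum (fun n => Cconj w ^ n * RtoC (/ beta n))%C z (Cconj (kernel beta z w)).
Proof.
  intros Hz Hw. unfold disc in *.
  assert (Hzw : Cmod (w * Cconj z) < 1).
  { rewrite Cmod_mult, Cmod_conj. assert (A := Cmod_ge_0 z). assert (B := Cmod_ge_0 w). nra. }
  destruct (coef_bd_psum _ _ _ coef_bd_inv_beta Hzw) as [l Hl].
  assert (Hk : cser (fun n => (w * Cconj z) ^ n / RtoC (beta n))%C (kernel beta z w)).
  { apply (cser_ext _ (fun n => (w * Cconj z) ^ n / RtoC (beta n))%C) in Hl.
    - unfold kernel. rewrite (iota_unique (V := C_CompleteNormedModule) _ l); [exact Hl| |exact Hl].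
      intros m Hm. exact (cser_unique _ _ _ Hm Hl).
    - intros n. rewrite RtoC_inv by (generalize (Hbeta n); lra). apply Cmult_comm. }
  apply cser_conj in Hk. eapply cser_ext; [|exact Hk]. intros n. cbv beta.
  assert (Hb : RtoC (beta n) <> 0) by (apply RtoC_neq_0; generalize (Hbeta n); lra).
  rewrite Cdiv_conj, Cconj_RtoC, Cpow_conj, Cmult_conj, Cconj_conj, Cpow_mult_l by exact Hb.
  rewrite RtoC_inv by (generalize (Hbeta n); lra). unfold Cdiv. ring.
Qed.

Variable g : C -> C.
Hypothesis Hg : analytic g.

(** [G] is the conjugate of [Tg] applied to the conjugated kernel; expanding by [Tg_series] and
    conjugating leaves a power series in [w]. *)
Lemma G_psum (z w : C) : disc z -> disc w ->
  psum (fun n => Cconj (Tg g (fun v => v ^ n)%C z) * RtoC (/ beta n))%C w (G beta g z w).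
Proof.
  intros Hz Hw. set (k := fun zeta => Cconj (kernel beta zeta w)).
  assert (Hkp : forall v, disc v -> psum (fun n => Cconj w ^ n * RtoC (/ beta n))%C v (k v))
    by (intros v Hv; now apply kernel_psum).
  assert (Hk : analytic k) by (apply (psum_analytic _ k Hkp)).
  assert (HS := Tg_series g k z Hg Hk Hz). apply cser_conj in HS.
  assert (E : G beta g z w = Cconj (Tg g k z)).
  { unfold G, Tg, path_int. do 2 f_equal. apply RInt_ext. intros t _. apply Cmult_comm. }
  rewrite E. eapply cser_ext; [|exact HS]. intros n. cbv beta.
  rewrite (psum_taylor _ k 1 n Rlt_0_1 Hkp).
  rewrite !Cmult_conj, Cpow_conj, Cconj_conj, Cconj_RtoC. ring.
Qed.

Lemma G_taylor (z : C) (n : nat) : disc z ->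
  taylor_coef (G beta g z) n = (Cconj (Tg g (fun v => v ^ n)%C z) * RtoC (/ beta n))%C.
Proof. intros Hz. exact (psum_taylor _ _ 1 n Rlt_0_1 (fun w Hw => G_psum z w Hz Hw)). Qed.

(** The weights [beta n] cancel. Since [Tg g] of the monomial [v ^ n] at [z] is [O(|z|^n)], the
    remaining series in [r] converges beyond [r = 1], so its limit at [1] is its value there, given
    by [Tg_series]. *)
Lemma is_pairing_G (f : C -> C) (z : C) : analytic f -> disc z ->
  is_pairing beta f (G beta g z) (Tg g f z).
Proof.
  intros Hf Hz. unfold disc in Hz. assert (Hz0 := Cmod_ge_0 z).
  set (m := fun n => Tg g (fun v => v ^ n)%C z). set (c := fun n => (taylor_coef f n * m n)%C).
  destruct (analytic_bounded (C_derive g) (Cmod z) (analytic_deriv g Hg) Hz) as [D [HD0 HD]].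
  (* A number strictly between [|z|] and [1]; the series then converges up to radius [/ q > 1]. *)
  set (q := (Cmod z + 1) / 2). assert (Hq : 0 < q < 1) by (unfold q; lra).
  assert (Hq1 : 1 < / q) by (rewrite <- Rinv_1; apply Rinv_lt_contravar; lra).
  assert (Hc : coef_bd c (/ q)).
  { intros r Hr. destruct (analytic_taylor_bd f Hf (q * r)) as [M HM].
    { split; [apply Rmult_le_pos; lra|]. rewrite <- (Rinv_r q) by lra.
      apply Rmult_lt_compat_l; lra. }
    exists (M * D). intros n. unfold c. rewrite Cmod_mult.
    assert (Hm : Cmod (m n) <= q ^ n * D).
    { eapply Rle_trans; [apply (Tg_pow_bound g z n D Hg Hz HD)|].
      apply Rmult_le_compat_r; [exact HD0|]. apply pow_incr. unfold q. lra. }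
    specialize (HM n). rewrite Rpow_mult_distr in HM.
    assert (Hrn : 0 <= r ^ n) by (apply pow_le; lra).
    assert (Hcf := Cmod_ge_0 (taylor_coef f n)).
    apply Rle_trans with (Cmod (taylor_coef f n) * (q ^ n * D) * r ^ n).
    - apply Rmult_le_compat_r; [exact Hrn|]. now apply Rmult_le_compat_l.
    - replace (Cmod (taylor_coef f n) * (q ^ n * D) * r ^ n)
        with (Cmod (taylor_coef f n) * (q ^ n * r ^ n) * D) by ring.
      now apply Rmult_le_compat_r. }
  set (P := fun w => csum (fun n => c n * w ^ n)%C).
  assert (HP : forall w, Cmod w < / q -> psum c w (P w)).
  { intros w Hw. apply csum_correct. exact (coef_bd_psum c _ w Hc Hw). }
  assert (H1 : P 1 = Tg g f z).
  { apply (cser_unique (fun n => c n * 1 ^ n)%C).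
    - apply HP. rewrite Cmod_1. lra.
    - eapply cser_ext; [|exact (Tg_series g f z Hg Hf Hz)]. intros n. cbv beta.
      rewrite Cpow_1_l. unfold c, m. ring. }
  apply is_pairing_eps. exists (fun r => P (RtoC r)). split.
  - intros r Hr. eapply cser_ext; [|apply (HP (RtoC r)); rewrite Cmod_R, Rabs_pos_eq; lra].
    intros n. cbv beta. rewrite G_taylor, Cmult_conj, Cconj_conj, Cconj_RtoC by exact Hz.
    unfold c. fold (m n). assert (Hb := Hbeta n).
    rewrite RtoC_inv by lra. field. apply RtoC_neq_0. lra.
  - assert (Hcont : ccont P 1).
    { eapply cderiv_ccont. apply (psum_C_derive c P (/ q) HP). rewrite Cmod_1. lra. }
    intros eps He. destruct (Hcont eps He) as [d [Hd H]]. exists d. split; [exact Hd|].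
    intros r Hr. rewrite <- H1. apply H. rewrite <- RtoC_minus, Cmod_R. apply Rabs_def1; lra.
Qed.

Lemma eq_G_of_pairing (h : C -> C) (z : C) : analytic h -> disc z ->
  (forall n, Tg g (fun v => v ^ n)%C z = pairing beta (fun v => v ^ n)%C h) ->
  eq_disc h (G beta g z).
Proof.
  intros Hh Hz H w Hw.
  apply (cser_unique (fun n => taylor_coef h n * w ^ n)%C); [now apply analytic_taylor|].
  eapply cser_ext; [|exact (G_psum z w Hz Hw)]. intros n. cbv beta. f_equal.
  rewrite H, (pairing_eq _ _ _ (is_pairing_pow n h)), Cmult_conj, Cconj_conj, Cconj_RtoC.
  assert (Hb := Hbeta n). rewrite RtoC_inv by lra. field. apply RtoC_neq_0. lra.
Qed.

End Pairing.

(** * Compactness of [Tg] and relative compactness of the functions [G] *)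

Section PartTwo.

Variables (g : C -> C) (X Y : fspace) (beta : nat -> R).
Hypotheses (Hg : analytic g) (HX : banach X) (Hadm : admissible X) (HHX : subspace Hinfty X).
Hypothesis Hbeta : forall n, 0 < beta n.
Hypothesis Hroot : is_lim_seq (fun n => Rpower (beta n) (/ INR n)) 1.
Hypothesis HY : banach Y.
Hypothesis Hdual : dual_via_pairing beta X Y.

Let inG (h : C -> C) : Prop := exists z, disc z /\ h = G beta g z.

Local Lemma Xa (f : C -> C) : mem X f -> analytic f.
Proof. apply (banach_analytic X HX). Qed.

Local Lemma scale_to_ball (f : C -> C) : mem X f -> exists c, 0 < c /\
  mem X (fscal (RtoC c) f) /\ nrm X (fscal (RtoC c) f) <= 1.
Proof.
  intros Hf. assert (H0 := nrm_ge_0 X HX f Hf). exists (/ (1 + nrm X f)).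
  assert (Hc : 0 < / (1 + nrm X f)) by (apply Rinv_0_lt_compat; lra).
  assert (E : / (1 + nrm X f) * (1 + nrm X f) = 1) by (field; lra).
  split; [exact Hc|]. split; [now apply banach_scal|].
  rewrite nrm_scal_pos by (try assumption; lra). nra.
Qed.

Local Lemma pairing_sub (f h h' : C -> C) : mem X f -> mem Y h -> mem Y h' ->
  pairing beta f (fsub h h') = (pairing beta f h - pairing beta f h')%C.
Proof.
  intros Hf Hh Hh'. destruct (proj1 Hdual f h Hf Hh) as [l Hl].
  destruct (proj1 Hdual f h' Hf Hh') as [l' Hl'].
  rewrite (pairing_eq _ _ _ _ Hl), (pairing_eq _ _ _ _ Hl').
  apply pairing_eq, is_pairing_sub_r; try assumption; now apply (banach_analytic Y HY).
Qed.

Local Lemma pairing_G (f : C -> C) (z : C) : mem X f -> disc z ->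
  pairing beta f (G beta g z) = Tg g f z.
Proof. intros Hf Hz. apply pairing_eq, is_pairing_G; try assumption. now apply Xa. Qed.

(** The norm equivalence freed from extended reals: an upper bound for pairings on the unit ball,
    and a bound for [nrm Y] obtained from the pairings. *)
Local Lemma dual_bounds : exists K, 0 < K /\
  (forall f h, mem X f -> nrm X f <= 1 -> mem Y h -> Cmod (pairing beta f h) <= K * nrm Y h) /\
  (forall h M, mem Y h -> (forall f, mem X f -> nrm X f <= 1 -> Cmod (pairing beta f h) <= M) ->
     nrm Y h <= K * M).
Proof.
  destruct Hdual as [_ [[K [HK HKb]] _]]. exists K. split; [exact HK|].
  assert (Hlub := fun h => Lub_Rbar_correct
    (fun x => exists f, mem X f /\ nrm X f <= 1 /\ x = Cmod (pairing beta f h))).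
  split.
  - intros f h Hf Hf1 Hh. destruct (Hlub h) as [Hub _].
    assert (H := Hub (Cmod (pairing beta f h)) ltac:(now exists f)).
    exact (Rbar_le_trans _ _ _ H (proj2 (HKb h Hh))).
  - intros h M Hh HM. destruct (Hlub h) as [_ Hleast].
    assert (H : Rbar_le (dual_norm X (fun f => pairing beta f h)) M).
    { apply Hleast. intros x [f [Hf [Hf1 ->]]]. now apply HM. }
    assert (H' : / K * nrm Y h <= M) by exact (Rbar_le_trans _ _ _ (proj1 (HKb h Hh)) H).
    apply (Rmult_le_compat_l K) in H'; [|lra].
    rewrite <- Rmult_assoc, Rinv_r, Rmult_1_l in H' by lra. exact H'.
Qed.

Section Forward.

Hypothesis HT : compact_operator X disc_algebra (Tg g).

Let ball (h : C -> C) : Prop := exists f, mem X f /\ nrm X f <= 1 /\ h = Tg g f.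

Local Lemma ball_bounded (h : C -> C) : ball h -> bounded_disc h.
Proof. intros [f [Hf [_ ->]]]. now apply disc_algebra_Hinfty, (proj1 HT). Qed.

Local Lemma ball_net (eps : R) : 0 < eps -> exists l, (forall h, In h l -> ball h) /\
  forall f, mem X f -> nrm X f <= 1 -> exists h, In h l /\
    forall z, disc z -> Cmod (Tg g f z - h z) <= eps.
Proof.
  intros He.
  destruct (relatively_compact_totally_bounded _ banach_disc_algebra _ (proj2 HT) eps He)
    as [l [Hl Hcov]].
  exists l. split; [exact Hl|]. intros f Hf Hf1.
  assert (Hb : ball (Tg g f)) by (now exists f).
  destruct (Hcov _ Hb) as [h [Hh Hhe]]. exists h. split; [exact Hh|]. intros z Hz.
  assert (Hbd := bounded_disc_sub _ _ (ball_bounded _ Hb) (ball_bounded _ (Hl h Hh))).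
  assert (H := sup_norm_ub _ z Hbd Hz). unfold fsub in H at 1. simpl in Hhe. lra.
Qed.

Local Lemma eval_Tg_in_dual (z : C) : disc z -> in_dual X (fun f => Tg g f z).
Proof.
  intros Hz. split; [|split].
  - intros f h Hf Hh. symmetry. exact (Tg_add g f h Hg (Xa f Hf) (Xa h Hh) z Hz).
  - intros c f Hf. symmetry. exact (Tg_scal g f c Hg (Xa f Hf) z Hz).
  - destruct (ball_net 1 Rlt_0_1) as [l [_ Hcov]].
    destruct (list_bound (fun h : C -> C => Cmod (h z)) l) as [M HM].
    assert (H1 : forall f, mem X f -> nrm X f <= 1 -> Cmod (Tg g f z) <= M + 1).
    { intros f Hf Hf1. destruct (Hcov f Hf Hf1) as [h [Hh Hhe]]. specialize (HM h Hh).
      specialize (Hhe z Hz). generalize (Cmod_triangle_minus (Tg g f z) (h z)). lra. }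
    assert (HM0 : 0 <= M + 1).
    { eapply Rle_trans; [apply Cmod_ge_0|apply (H1 _ (banach_zero X HX))]. rewrite (nrm_fzero X HX). lra. }
    (* A violation would allow scaling [f] so that the value becomes [M + 2] while the norm stays at
       most [1]; dividing by the value instead of the norm covers norm [0] too. *)
    exists (M + 2). intros f Hf. assert (H0 := nrm_ge_0 X HX f Hf). apply Rnot_lt_le. intros Hlt.
    set (y := Cmod (Tg g f z)) in *. assert (Hy : 0 < y) by nra.
    assert (Hc : 0 <= (M + 2) / y) by (apply Rdiv_le_0_compat; lra).
    assert (H := H1 (fscal (RtoC ((M + 2) / y)) f) (banach_scal X HX _ _ Hf)).
    rewrite nrm_scal_pos, <- (Tg_scal g f _ Hg (Xa f Hf) z Hz) in H by assumption.
    unfold fscal in H. rewrite Cmod_scal_pos in H by exact Hc. fold y in H.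
    replace ((M + 2) / y * y) with (M + 2) in H by (field; lra).
    enough (M + 2 <= M + 1) by lra. apply H.
    replace ((M + 2) / y * nrm X f) with ((M + 2) * nrm X f / y) by (field; lra).
    apply Rle_div_l; lra.
Qed.

(** The evaluation functional is represented by some [h] in [Y]; monomials, which lie in [Hinfty]
    and so in [X], show that [h] is [G]. *)
Local Lemma G_mem (z : C) : disc z -> mem Y (G beta g z).
Proof.
  intros Hz. destruct (proj2 (proj2 Hdual) _ (eval_Tg_in_dual z Hz)) as [h [Hh Hhp]].
  apply (banach_eq_mem Y HY h); [|exact Hh].
  apply eq_G_of_pairing; try assumption; [now apply (banach_analytic Y HY)|].
  intros n. apply Hhp. apply HHX. split; [apply analytic_pow|]. exists 1. intros w Hw.
  unfold disc in Hw. rewrite Cmod_pow. rewrite <- (pow1 n). apply pow_incr.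
  split; [apply Cmod_ge_0|lra].
Qed.

Local Lemma forward : relatively_compact Y inG.
Proof.
  apply totally_bounded_relatively_compact; [exact HY|intros h [z [Hz ->]]; now apply G_mem|].
  intros eps He. destruct dual_bounds as [K [HK [_ Hlow]]].
  set (e := eps / (4 * K)). assert (He0 : 0 < e) by (apply Rdiv_lt_0_compat; lra).
  destruct (ball_net e He0) as [l [Hl Hcov]].
  (* Points of the disc are grouped by the values of the finitely many net functions; within a group
     every [Tg g f] from the unit ball varies by at most [3 * e]. *)
  destruct (colorable_net disc (fun z z' => forall h : C -> C, In h l -> Cmod (h z - h z') < e))
    as [lz [Hlz Hnet]].
  { apply (colorable_list disc (fun (h : C -> C) z z' => Cmod (h z - h z') < e)).
    intros h Hh. destruct (ball_bounded h (Hl h Hh)) as [M HM]. now apply (colorable_C _ _ M). }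
  exists (map (G beta g) lz). split.
  - intros h Hh. apply in_map_iff in Hh. destruct Hh as [z [<- Hz]]. exists z. split; auto.
  - intros h [z [Hz ->]]. destruct (Hnet z Hz) as [z' [Hz' Hnear]].
    exists (G beta g z'). split; [now apply in_map|]. assert (Hzd' := Hlz z' Hz').
    apply Rle_lt_trans with (K * (3 * e)).
    + apply Hlow; [apply banach_sub; auto using G_mem|]. intros f Hf Hf1.
      rewrite pairing_sub, !pairing_G by auto using G_mem.
      destruct (Hcov f Hf Hf1) as [h [Hh Hhe]]. specialize (Hnear h Hh).
      assert (A := Hhe z Hz). assert (B := Hhe z' Hzd'). rewrite Cmod_minus_sym in B.
      generalize (Cmod_dist (h z) (Tg g f z) (Tg g f z')) (Cmod_dist (h z') (h z) (Tg g f z')). lra.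
    + unfold e. replace (K * (3 * (eps / (4 * K)))) with (3 / 4 * eps) by (field; lra). lra.
Qed.

End Forward.

Section Backward.

Hypothesis HG : relatively_compact Y inG.

Local Lemma G_mem' (z : C) : disc z -> mem Y (G beta g z).
Proof. intros Hz. apply (proj1 HG). now exists z. Qed.

Local Lemma G_net (eps : R) : 0 < eps -> exists l, (forall h, In h l -> mem Y h) /\
  forall z, disc z -> exists h, In h l /\ forall f, mem X f -> nrm X f <= 1 ->
    Cmod (Tg g f z - pairing beta f h) <= eps.
Proof.
  intros He. destruct dual_bounds as [K [HK [Hup _]]].
  assert (He0 : 0 < eps / K) by now apply Rdiv_lt_0_compat.
  destruct (relatively_compact_totally_bounded Y HY _ HG _ He0) as [l [Hl Hcov]].
  assert (HlY : forall h, In h l -> mem Y h) by (intros h Hh; apply (proj1 HG), Hl, Hh).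
  exists l. split; [exact HlY|]. intros z Hz.
  destruct (Hcov (G beta g z)) as [h [Hh Hhe]]; [now exists z|]. exists h. split; [exact Hh|].
  intros f Hf Hf1. assert (Hm := G_mem' z Hz).
  rewrite <- pairing_G, <- pairing_sub by auto.
  eapply Rle_trans; [apply Hup; auto using banach_sub|].
  apply Rlt_le. apply Rlt_div_r in Hhe; [|exact HK]. lra.
Qed.

Local Lemma Tg_ball_bounded (f : C -> C) : mem X f -> nrm X f <= 1 -> bounded_disc (Tg g f).
Proof.
  intros Hf Hf1. destruct (G_net 1 Rlt_0_1) as [l [_ Hcov]].
  destruct (list_bound (fun h => Cmod (pairing beta f h)) l) as [M HM].
  exists (M + 1). intros z Hz. destruct (Hcov z Hz) as [h [Hh Hhe]].
  specialize (HM h Hh). specialize (Hhe f Hf Hf1).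
  generalize (Cmod_triangle_minus (Tg g f z) (pairing beta f h)). lra.
Qed.

Local Lemma Tg_mem_Hinfty (f : C -> C) : mem X f -> mem Hinfty (Tg g f).
Proof.
  intros Hf. split; [apply Tg_analytic; [exact Hg|now apply Xa]|].
  destruct (scale_to_ball f Hf) as [c [Hc [Hm H1]]].
  apply (bounded_disc_ext (fscal (RtoC (/ c)) (Tg g (fscal (RtoC c) f)))).
  - intros z Hz. unfold fscal at 1. rewrite <- (Tg_scal g f _ Hg (Xa f Hf) z Hz).
    unfold fscal. rewrite RtoC_inv by lra. field. apply RtoC_neq_0. lra.
  - now apply bounded_disc_scal, Tg_ball_bounded.
Qed.

(** The mirror image of [forward]: a finite net of the functions [G] replaces that of the images,
    and the unit ball is grouped by its pairings with that net instead of the disc by its values. *)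
Local Lemma backward_Hinfty : compact_operator X Hinfty (Tg g).
Proof.
  split; [exact Tg_mem_Hinfty|].
  apply totally_bounded_relatively_compact; [exact banach_Hinfty| |].
  { intros h [f [Hf [_ ->]]]. now apply Tg_mem_Hinfty. }
  intros eps He. set (e := eps / 4). assert (He0 : 0 < e) by (unfold e; lra).
  destruct (G_net e He0) as [l [Hl Hcov]]. destruct dual_bounds as [K [HK [Hup _]]].
  destruct (colorable_net (fun f => mem X f /\ nrm X f <= 1)
    (fun f f' => forall h : C -> C, In h l -> Cmod (pairing beta f h - pairing beta f' h) < e))
    as [lf [Hlf Hnet]].
  { apply (colorable_list (fun f => mem X f /\ nrm X f <= 1)
      (fun (h : C -> C) f f' => Cmod (pairing beta f h - pairing beta f' h) < e)).
    intros h Hh. apply (colorable_C _ (fun f => pairing beta f h) (K * nrm Y h)); [|exact He0].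
    intros f [Hf Hf1]. auto. }
  exists (map (Tg g) lf). split.
  - intros h Hh. apply in_map_iff in Hh. destruct Hh as [f [<- Hf]].
    destruct (Hlf f Hf) as [A B]. now exists f.
  - intros h [f [Hf [Hf1 ->]]]. destruct (Hnet f (conj Hf Hf1)) as [f' [Hf' Hnear]].
    destruct (Hlf f' Hf') as [A B]. exists (Tg g f'). split; [now apply in_map|].
    apply Rle_lt_trans with (3 * e); [|unfold e; lra]. simpl. apply sup_norm_le. intros z Hz.
    destruct (Hcov z Hz) as [h [Hh Hhe]]. specialize (Hnear h Hh).
    assert (P := Hhe f Hf Hf1). assert (Q := Hhe f' A B). rewrite Cmod_minus_sym in Q. unfold fsub.
    generalize (Cmod_dist (pairing beta f h) (Tg g f z) (Tg g f' z))
      (Cmod_dist (pairing beta f' h) (pairing beta f h) (Tg g f' z)). lra.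
Qed.

End Backward.

(** The converse reaches only [Hinfty] by duality; boundary continuity of the images comes from part
    (i). *)
Lemma compact_iff_G_relatively_compact :
  compact_operator X disc_algebra (Tg g) <-> relatively_compact Y inG.
Proof.
  split; [exact forward|]. intros HG.
  exact (compact_Hinfty_disc_algebra g X Hg HX Hadm HHX (backward_Hinfty HG)).
Qed.

End PartTwo.

Theorem theorem1p6 (g : C -> C) (X : fspace)
    (hg : analytic g) (hX : banach X) (hadm : admissible X)
    (hHX : subspace Hinfty X) :
  (compact_operator X Hinfty (Tg g) <-> compact_operator X disc_algebra (Tg g))
  /\
  (forall beta : nat -> R,
     (forall n, 0 < beta n) ->
     is_lim_seq (fun n => Rpower (beta n) (/ INR n)) 1 ->
     forall Y : fspace,
       banach Y ->
       dual_via_pairing beta X Y ->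
       bounded_cv_subseq X ->
       (compact_operator X disc_algebra (Tg g) <->
        relatively_compact Y (fun h => exists z, disc z /\ h = G beta g z))).
Proof.
  split.
  - split.
    + exact (compact_Hinfty_disc_algebra g X hg hX hadm hHX).
    + apply compact_disc_algebra_Hinfty.
  - intros beta Hbeta Hroot Y HY Hdual _.
    exact (compact_iff_G_relatively_compact g X Y beta hg hX hadm hHX Hbeta Hroot HY Hdual).
Qed.
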